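(* The following procedure can be implemented so that it terminates in time $O((n+m)\log n)$ on every input digraph $G$ with $V(G)=\{1,\ldots,n\}$ and $m$ edges: (1) compute a surjective canonical $k$-colouring $\beta$ of $G$ such that $\pi_\beta$ is the coarsest stable partition of $V(G)$; (2) while $k<n$: set $\alpha:=\beta$ and $\ell:=k$, choose a vertex $v$ whose colour under $\alpha$ is shared with another vertex, set $\ell:=\ell+1$ and redefine $\alpha(v):=\ell$, and then compute a surjective canonical $k$-colouring $\beta$ of $G$, starting from $\alpha$, such that $\pi_\beta$ is the coarsest stable partition that refines $\pi_\alpha$; (3) return $\beta$.
   Context: A colouring of a digraph $G$ is a function $\alpha:V(G)\to\mathbb{Z}$; it is a surjective $k$-colouring if its image is exactly $\{1,\ldots,k\}$. $\pi_\alpha$ is the partition of $V(G)$ into nonempty colour classes. $N^+(v)$ is the out-neighbourhood of $v$. A partition $\pi$ of $V(G)$ is stable if for all $u,v$ in a common cell and every cell $R\in\pi$, $|N^+(u)\cap R|=|N^+(v)\cap R|$. A partition $\rho$ refines $\pi$ if every cell of $\rho$ lies in a cell of $\pi$. An isomorphism $h$ between digraphs $G,G'$ with colourings $\alpha,\alpha'$ is colour preserving if $\alpha(v)=\alpha'(h(v))$ for all $v$. A colouring method (producing $\beta$ from $G$ and initial colouring $\alpha$; the unit colouring if none is given) is canonical if for any isomorphic digraphs $G,G'$ with initial colourings $\alpha,\alpha'$ and any isomorphism $h$ colour preserving for $\alpha,\alpha'$, $h$ is colour preserving for the outputs $\beta,\beta'$; $\beta$ is then called a canonical colouring of $G$ starting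 from $\alpha$. *)

(* Defs.v *)
From HB Require Import structures.
From mathcomp Require Import all_boot all_order all_algebra.

Set Implicit Arguments.
Unset Strict Implicit.
Unset Printing Implicit Defensive.

(** * Digraphs, colourings, stable partitions

    A digraph on the finite vertex set [V] is its arc relation [rel V]. *)

Definition out_nbr (V : finType) (G : rel V) (v : V) : {set V} :=
  [set w | G v w].

Definition num_edges (V : finType) (G : rel V) : nat :=
  #|[set e : V * V | G e.1 e.2]|.

Definition surjective_colouring (V : finType) (k : nat) (a : V -> int) : Prop :=
  forall c : int, (exists v, a v = c) <-> (1 <= c <= k%:Z)%R.

Definition unit_colouring (V : finType) : V -> int := fun=> 1%R.

(** [cells a] is the partition pi_a of [V] into the nonempty colour classes. *)
Definition cells (V : finType) (a : V -> int) : {set {set V}} :=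
  preim_partition a [set: V].

Definition stable (V : finType) (G : rel V) (P : {set {set V}}) : Prop :=
  forall C R, C \in P -> R \in P ->
  forall u v, u \in C -> v \in C ->
  #|out_nbr G u :&: R| = #|out_nbr G v :&: R|.

Definition refines (V : finType) (P Q : {set {set V}}) : Prop :=
  forall A, A \in P -> exists2 B, B \in Q & A \subset B.

Definition stable_partition (V : finType) (G : rel V) (P : {set {set V}}) :=
  partition P [set: V] /\ stable G P.

Definition coarsest_stable (V : finType) (G : rel V) (P : {set {set V}}) :=
  stable_partition G P /\
  forall Q, stable_partition G Q -> refines Q P.

Definition coarsest_stable_refining (V : finType) (G : rel V)
    (P0 P : {set {set V}}) :=
  [/\ stable_partition G P, refines P P0 &
      forall Q, stable_partition G Q -> refines Q P0 -> refines Q P].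

(** * Canonical colouring methods *)

Definition colouring_method : Type :=
  forall V : finType, rel V -> (V -> int) -> V -> int.

Definition isomorphism (V V' : finType) (G : rel V) (G' : rel V')
    (h : V -> V') : Prop :=
  bijective h /\ forall u v, G' (h u) (h v) = G u v.

Definition colour_preserving (V V' : finType) (a : V -> int) (a' : V' -> int)
    (h : V -> V') : Prop :=
  forall v, a v = a' (h v).

Definition canonical (F : colouring_method) : Prop :=
  forall (V V' : finType) (G : rel V) (G' : rel V')
         (a : V -> int) (a' : V' -> int) (h : V -> V'),
  isomorphism G G' h -> colour_preserving a a' h ->
  colour_preserving (F V G a) (F V' G' a') h.

(** * A random access machine

    Programs of a structured RAM with registers and arrays, both indexed by
    [nat], with arithmetic limited to addition and truncated subtraction.  A
    program mentions only finitely many registers and arrays.  Every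
    constructor of an expression, test or command that is executed costs one
    time unit.  In particular array cells are accessed in constant time. *)

Record memory : Type := Mem { reg : nat -> nat; arr : nat -> nat -> nat }.

Inductive expr : Type :=
| Const of nat
| Reg of nat
| Cell of nat & expr
| Plus of expr & expr
| Minus of expr & expr.

Inductive test : Type :=
| Lt of expr & expr
| Eq of expr & expr.

Inductive com : Type :=
| Skip
| SetReg of nat & expr
| SetCell of nat & expr & expr
| Seq of com & com
| If of test & com & com
| While of test & com.

Fixpoint eval (e : expr) (s : memory) : nat :=
  match e with
  | Const c => c
  | Reg r => reg s r
  | Cell a e1 => arr s a (eval e1 s)
  | Plus e1 e2 => eval e1 s + eval e2 s
  | Minus e1 e2 => eval e1 s - eval e2 s
  end.

Fixpoint expr_cost (e : expr) : nat :=
  match e with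
  | Const _ | Reg _ => 1
  | Cell _ e1 => (expr_cost e1).+1
  | Plus e1 e2 | Minus e1 e2 => (expr_cost e1 + expr_cost e2).+1
  end.

Definition holds (b : test) (s : memory) : bool :=
  match b with
  | Lt e1 e2 => eval e1 s < eval e2 s
  | Eq e1 e2 => eval e1 s == eval e2 s
  end.

Definition test_cost (b : test) : nat :=
  match b with
  | Lt e1 e2 | Eq e1 e2 => (expr_cost e1 + expr_cost e2).+1
  end.

Definition set_reg (s : memory) (r x : nat) : memory :=
  Mem (fun i => if i == r then x else reg s i) (arr s).

Definition set_cell (s : memory) (a i x : nat) : memory :=
  Mem (reg s)
      (fun b j => if (b == a) && (j == i) then x else arr s b j).

(** [exec W c s t s']: started in [s], the command [c] halts after [t] time
    units in [s'], and every index and value it writes with is below the word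
    bound [W].  There is no rule for overflow: a program that overflows gets
    stuck. *)
Inductive exec (W : nat) : com -> memory -> nat -> memory -> Prop :=
| ExecSkip s : exec W Skip s 1 s
| ExecSetReg r e s :
    eval e s < W ->
    exec W (SetReg r e) s (expr_cost e).+1 (set_reg s r (eval e s))
| ExecSetCell a e1 e2 s :
    eval e1 s < W -> eval e2 s < W ->
    exec W (SetCell a e1 e2) s (expr_cost e1 + expr_cost e2).+1
         (set_cell s a (eval e1 s) (eval e2 s))
| ExecSeq c1 c2 s t1 s1 t2 s2 :
    exec W c1 s t1 s1 -> exec W c2 s1 t2 s2 ->
    exec W (Seq c1 c2) s (t1 + t2).+1 s2
| ExecIf b c1 c2 s t s' :
    exec W (if holds b s then c1 else c2) s t s' ->
    exec W (If b c1 c2) s (test_cost b + t).+1 s'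
| ExecWhileExit b c s :
    ~~ holds b s ->
    exec W (While b c) s (test_cost b).+1 s
| ExecWhileIter b c s t1 s1 t2 s2 :
    holds b s -> exec W c s t1 s1 -> exec W (While b c) s1 t2 s2 ->
    exec W (While b c) s (test_cost b + t1 + t2).+1 s2.

(** * Input and output conventions

    The vertices 1, ..., n are represented by [0, ..., n.-1], and array cell
    [i] belongs to vertex [i].  The arcs are listed in arbitrary order. *)

Definition edge_list (n : nat) (G : rel 'I_n) (es : seq ('I_n * 'I_n)) : Prop :=
  uniq es /\ forall u v, ((u, v) \in es) = G u v.

Definition n_reg : nat := 0.
Definition m_reg : nat := 1.
Definition k_reg : nat := 2.
Definition src_arr : nat := 0.
Definition tgt_arr : nat := 1.
Definition col_arr : nat := 2.

Definition input_mem (n : nat) (es : seq ('I_n * 'I_n)) : memory :=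
  Mem (fun r => if r == n_reg then n
                else if r == m_reg then size es else 0)
      (fun a i => if a == src_arr then nth 0 [seq val e.1 | e <- es] i
                  else if a == tgt_arr then nth 0 [seq val e.2 | e <- es] i
                  else 0).

(** The colourings alpha and beta share the array [col_arr], so that the
    assignment alpha := beta takes no time. *)
Definition colour_of (n : nat) (s : memory) : 'I_n -> int :=
  fun v => Posz (arr s col_arr v).
Arguments colour_of n s _ : clear implicits.

Definition k_of (s : memory) : nat := reg s k_reg.

(** * The procedure *)

Definition initial_step (F : colouring_method) (n : nat) (G : rel 'I_n)
    (b : 'I_n -> int) (k : nat) : Prop :=
  [/\ b =1 F _ G (@unit_colouring 'I_n),
      surjective_colouring k b &
      coarsest_stable G (cells b)].

(** [a] is [b] with one vertex, whose colour was shared, recoloured [k.+1]. *)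
Definition choose_step (n : nat) (b : 'I_n -> int) (k : nat)
    (a : 'I_n -> int) : Prop :=
  exists2 v, (exists2 u, u != v & b u = b v) &
    a =1 (fun w => if w == v then Posz k.+1 else b w).

Definition refine_step (F : colouring_method) (n : nat) (G : rel 'I_n)
    (a b : 'I_n -> int) (k : nat) : Prop :=
  [/\ b =1 F _ G a,
      surjective_colouring k b &
      coarsest_stable_refining G (cells a) (cells b)].

Definition loop_test : test := Lt (Reg k_reg) (Reg n_reg).

(** [loop_run] is an execution of [While loop_test (Seq choose refine)] in
    which every pass through the body performs a choice of a vertex followed
    by a refinement.  The register [n_reg] has to keep the value [n], so that
    [loop_test] is the test k < n. *)
Inductive loop_run (W : nat) (F : colouring_method) (n : nat) (G : rel 'I_n)
    (choose refine : com) : memory -> nat -> memory -> Prop :=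
| LoopExit s :
    reg s n_reg = n -> ~~ holds loop_test s ->
    loop_run W F G choose refine s (test_cost loop_test).+1 s
| LoopIter s t1 s1 t2 s2 t3 s3 :
    reg s n_reg = n -> holds loop_test s ->
    exec W choose s t1 s1 ->
    choose_step (colour_of n s) (k_of s) (colour_of n s1) ->
    exec W refine s1 t2 s2 ->
    refine_step F G (colour_of n s1) (colour_of n s2) (k_of s2) ->
    loop_run W F G choose refine s2 t3 s3 ->
    loop_run W F G choose refine s
             (test_cost loop_test + (t1 + t2).+1 + t3).+1 s3.

(** An execution of [Seq init (While loop_test (Seq choose refine))] that
    carries out the procedure on [G] and returns the colouring in [s']. *)
Definition procedure_run (W : nat) (F : colouring_method) (n : nat)
    (G : rel 'I_n) (init choose refine : com)
    (s : memory) (t : nat) (s' : memory) : Prop :=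
  exists t0 s0 t1,
    [/\ exec W init s t0 s0,
        initial_step F G (colour_of n s0) (k_of s0),
        loop_run W F G choose refine s0 t1 s' &
        t = (t0 + t1).+1].

(* Main.v *)
(** The classes are used as refining classes in the order 1, 2, 3, ... of their
    colours, each colour once.  When a class is split by the numbers of arcs
    into the refining class, a largest part keeps the colour and the other
    parts receive fresh colours k+1, k+2, ..., hence they are used later on.

    This suffices for stability: all counts into the class of r at the time of
    its use are constant on the cells, that class is the final class of r plus
    final classes of later colours, and one concludes by downward induction on
    r.  A vertex that changes its colour moves to a class of at most half the
    size, so it belongs to a refining class at most 1 + log n times, also
    across individualizations, and every such event costs its in-degree plus
    one.  All choices depend only on colours and counts, so the colouring is
    canonical provided that the classes to be split are sorted; a radix sort
    does this at the price of log n for each new colour. *)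

Require Import Defs.
From mathcomp Require Import all_boot all_order all_algebra.
From mathcomp Require Import zify.
Set Implicit Arguments.
Unset Strict Implicit.
Unset Printing Implicit Defensive.

(** * Splitting colour classes *)

(** A canonical method sees only the digraph and the initial colouring, not which colours have
    already been used for refining. Hence [refinement] always starts with only the largest colour
    pending. This is right in both uses: the unit colouring has one colour, and after an
    individualization the largest colour belongs to the singleton, while counts into the former
    classes are constant because the previous colouring was stable. The time bound is a potential
    argument. A vertex, weighted by in-degree plus one, holds the logarithm of its class size plus
    one unit while its colour is pending. Individualizing does not raise this potential. Sorting and
    the overhead of rounds are paid by the colours and rounds still possible, and the search for a
    shared colour by a cursor that never moves back. Overflow is treated apart from correctness.
    Runs are first built under some word bound; as values grow by at most n+1 per time unit, the
    time bound then yields a polynomial word bound. *)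

Definition heaviest (f : nat -> nat) (N : nat) : nat :=
  foldl (fun b i => if f b < f i then i else b) 0 (iota 0 N).

Lemma heaviestS f N :
  heaviest f N.+1 = if f (heaviest f N) < f N then N else heaviest f N.
Proof. by rewrite /heaviest -{1}addn1 iotaD foldl_cat. Qed.

Lemma heaviest_le f N : heaviest f N <= N.
Proof. by elim: N => // N IH; rewrite heaviestS; case: ifP => _ //; apply: leqW. Qed.

Lemma heaviest_max f N i : i < N -> f i <= f (heaviest f N).
Proof.
elim: N i => // N IH i; rewrite heaviestS ltnS leq_eqVlt => /orP[/eqP-> | /IH lt_i].
  by case: leqP.
by case: ltnP => // lt_N; rewrite (leq_trans lt_i) // ltnW.
Qed.

Lemma eq_heaviest f g N : f =1 g -> heaviest f N = heaviest g N.
Proof. by move=> fg; elim: N => // N IH; rewrite !heaviestS IH !fg. Qed.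

(** The strict comparison never selects an index of value 0, so the scan may stop at the largest
    count that occurs. Scanning all possible counts for every class would be too slow. *)
Lemma heaviest_trunc f M N :
  M <= N -> (forall i, M <= i -> f i = 0) -> heaviest f N = heaviest f M.
Proof.
move=> leMN f0; rewrite -(subnKC leMN); elim: (N - M) => [|j IH].
  by rewrite addn0.
by rewrite addnS heaviestS (f0 (M + j)) ?leq_addr // ltn0 IH.
Qed.

Definition renamed (f : nat -> nat) (b i : nat) : bool := (0 < f i) && (i != b).

(** Fresh colours are handed out in increasing order of the counts: the part of count [i] gets the
    colour [k + (rank f b i).+1]. *)
Definition rank (f : nat -> nat) (b i : nat) : nat := count (renamed f b) (iota 0 i).

Lemma rankS f b i : rank f b i.+1 = rank f b i + renamed f b i.
Proof. by rewrite /rank -{1}addn1 iotaD count_cat /= addn0. Qed.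

Lemma eq_rank f g b i : f =1 g -> rank f b i = rank g b i.
Proof. by move=> fg; apply: eq_count => j; rewrite /renamed fg. Qed.

Lemma rank_le f b i j : i <= j -> rank f b i <= rank f b j.
Proof. by move=> le_ij; rewrite /rank -(subnKC le_ij) iotaD count_cat leq_addr. Qed.

Lemma rank_inj f b i j :
  renamed f b i -> renamed f b j -> rank f b i = rank f b j -> i = j.
Proof.
wlog lt_ij : i j / i < j => [W Hi Hj E | Hi _].
  have [lt_ij | lt_ji | //] := ltngtP i j; first exact: W lt_ij Hi Hj E.
  exact: esym (W _ _ lt_ji Hj Hi (esym E)).
by have := @rank_le f b _ _ lt_ij; rewrite rankS Hi; lia.
Qed.

Lemma rank_onto f b N c :
  c < rank f b N -> exists i, [/\ i < N, renamed f b i & rank f b i = c].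
Proof.
elim: N => // N IH; rewrite rankS.
have [/IH[i [lt_i Hi Ei]] | ge_c] := ltnP c (rank f b N).
  by exists i; split=> //; apply: ltnW.
case HN: (renamed f b N) => //= lt_c; last by lia.
by exists N; split=> //; lia.
Qed.

Lemma rank_trunc f b M N :
  M <= N -> (forall i, M <= i -> f i = 0) -> rank f b N = rank f b M.
Proof.
move=> leMN f0; rewrite -(subnKC leMN); elim: (N - M) => [|j IH].
  by rewrite addn0.
by rewrite addnS rankS IH /renamed (f0 (M + j)) ?leq_addr // addn0.
Qed.

Section Splitting.

Variable V : finType.
Implicit Types (a d : V -> nat) (k s : nat).

Definition class_size a s : nat := #|[set v | a v == s]|.

Definition part_size a d s i : nat := #|[set v | (a v == s) && (d v == i)]|.

(** Only sizes of parts enter: among the largest parts, the one of smallest count keeps the colour,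
    which makes the split invariant under isomorphisms. The range covers all counts from 0 to
    [#|V|]. *)
Definition split_class d (st : (V -> nat) * nat) s : (V -> nat) * nat :=
  let f := part_size st.1 d s in
  let b := heaviest f #|V|.+1 in
  (fun v => if (st.1 v == s) && (d v != b) then st.2 + (rank f b (d v)).+1
            else st.1 v,
   st.2 + rank f b #|V|.+1).

Definition splits a d s : bool :=
  1 < count (fun i => 0 < part_size a d s i) (iota 0 #|V|.+1).

Definition onto a k : Prop := forall c, (exists v, a v = c) <-> 1 <= c <= k.

Lemma onto_le a k v : onto a k -> 1 <= a v <= k.
Proof. by move/(_ (a v)) => [H _]; apply: H; exists v. Qed.

Lemma onto_card a k : onto a k -> k <= #|V|.
Proof.
move=> Ha; have sub : {subset iota 1 k <= [seq a v | v : V]}.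
  move=> c; rewrite mem_iota => /andP[c_gt0 lt_c].
  have [_ [|v <-]] := Ha c; first by lia.
  by apply: map_f; rewrite mem_enum.
have := uniq_leq_size (iota_uniq 1 k) sub.
by rewrite size_iota size_map -cardE.
Qed.

Lemma part_size_gt0 a d v : 0 < part_size a d (a v) (d v).
Proof. by apply/card_gt0P; exists v; rewrite inE !eqxx. Qed.

Lemma part_size_gt0P a d s i :
  reflect (exists v, a v = s /\ d v = i) (0 < part_size a d s i).
Proof.
apply: (iffP card_gt0P) => -[v]; first by rewrite inE => /andP[/eqP ? /eqP ?]; exists v.
by move=> [Ea Ed]; exists v; rewrite inE Ea Ed !eqxx.
Qed.

Lemma splitsP a d s :
  (forall v, d v <= #|V|) ->
  reflect (exists u v, [/\ a u = s, a v = s & d u != d v]) (splits a d s).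
Proof.
move=> d_le; rewrite /splits -size_filter.
set L := filter _ _.
have L_uniq : uniq L by rewrite filter_uniq ?iota_uniq.
have L_mem i : (i \in L) = (0 < part_size a d s i).
  rewrite mem_filter mem_iota /= add0n; apply: andb_idr => /part_size_gt0P[v [_ <-]].
  by rewrite ltnS.
apply: (iffP idP) => [|[u [v [Eu Ev ne]]]].
  case E: L => [|i [|j L']] //= _; move: L_uniq; rewrite E /= inE.
  case/andP=> /norP[ne _] _.
  have /part_size_gt0P[u [Eu Du]] : 0 < part_size a d s i by rewrite -L_mem E !inE eqxx.
  have /part_size_gt0P[v [Ev Dv]] : 0 < part_size a d s j.
    by rewrite -L_mem E !inE eqxx orbT.
  by exists u, v; split; rewrite ?Du ?Dv.
have sub : {subset [:: d u; d v] <= L}.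
  by move=> i; rewrite !inE L_mem => /orP[]/eqP->;
    apply/part_size_gt0P; [exists u | exists v].
by apply: leq_trans (uniq_leq_size _ sub); rewrite //= inE ne.
Qed.

Lemma part_size2 a d s i j :
  i != j -> part_size a d s i + part_size a d s j <= class_size a s.
Proof.
move=> ne; rewrite /part_size /class_size -leq_subRL; last first.
  by apply: subset_leq_card; apply/subsetP=> v; rewrite !inE => /andP[].
rewrite -cardsDS; last by apply/subsetP=> v; rewrite !inE => /andP[].
apply: subset_leq_card; apply/subsetP=> v; rewrite !inE => /andP[-> /eqP->] /=.
by rewrite eq_sym ne.
Qed.

Section OneClass.

Variables (d a : V -> nat) (k s : nat).
Hypotheses (d_le : forall v, d v <= #|V|) (a_onto : onto a k) (s_le : 1 <= s <= k).

Let f := part_size a d s.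
Let b := heaviest f #|V|.+1.
Let a' := (split_class d (a, k) s).1.
Let k' := (split_class d (a, k) s).2.

Let a'E v : a' v = if (a v == s) && (d v != b) then k + (rank f b (d v)).+1 else a v.
Proof. by []. Qed.

Let renamed_d v : a v = s -> renamed f b (d v) = (d v != b).
Proof. by move=> Ev; rewrite /renamed /f -{1}Ev part_size_gt0. Qed.

Let heaviest_gt0 : 0 < f b.
Proof.
have [_ [//|v Ev]] := a_onto s.
apply: leq_trans (heaviest_max f _ : f (d v) <= _); last by rewrite ltnS.
by rewrite /f -{1}Ev part_size_gt0.
Qed.

Lemma split_class_alt v :
  a' v = a v \/ [/\ k < a' v, a v = s & d v != b].
Proof.
rewrite a'E; case: ifP => [/andP[/eqP-> ne] | _]; [right | by left].
by split=> //; rewrite addnS ltnS leq_addr.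
Qed.

(** Fresh colours exceed [k], so they do not collide with old ones, and [rank] separates them from
    each other. *)
Lemma split_class_kernel u v :
  a' u = a' v <-> a u = a v /\ (a u = s -> d u = d v).
Proof.
have [/andP[_ le_u] /andP[_ le_v]] := (onto_le u a_onto, onto_le v a_onto).
rewrite !a'E; case: (a u =P s) => [Eu | neu]; case: (a v =P s) => [Ev | nev] /=.
- rewrite Eu Ev; case: (d u =P b) => [Du | nDu]; case: (d v =P b) => [Dv | nDv] /=.
  + by rewrite Du Dv.
  + by split=> [|[_ /(_ erefl)]]; [lia | rewrite Du => /esym].
  + by split=> [|[_ /(_ erefl)]]; [lia | rewrite Dv].
  + split=> [E|[_ /(_ erefl)->] //]; split=> // _.
    apply: (@rank_inj f b); [| | by lia]; rewrite renamed_d //; exact/eqP.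
- rewrite Eu; case: (d u != b) => /=; last by split=> [/esym|[/esym]].
  by split=> [|[/esym]]; [lia|].
- rewrite Ev; case: (d v != b) => /=; last by split=> [|[]].
  by split=> [|[]]; [lia|].
- by split=> [|[]].
Qed.

Lemma split_class_onto : onto a' k'.
Proof.
move=> c; have Ek : k' = k + rank f b #|V|.+1 by [].
split=> [[v <-] | /andP[c_gt0 le_c]].
  rewrite a'E; have := onto_le v a_onto; case: ifP => [/andP[/eqP Ev ne] _ | _].
    have : rank f b (d v).+1 <= rank f b #|V|.+1 by apply: rank_le; rewrite ltnS.
    by rewrite rankS renamed_d // ne Ek; lia.
  by rewrite Ek; lia.
have [le_ck | lt_kc] := leqP c k.
  have [-> | nc] := eqVneq c s.
    have /part_size_gt0P[v [Ev Dv]] := heaviest_gt0.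
    by exists v; rewrite a'E Dv eqxx andbF.
  have [_ [|v Ev]] := a_onto c; first by rewrite c_gt0.
  by exists v; rewrite a'E Ev (negbTE nc).
have [|i [lt_i Hi Ei]] := @rank_onto f b #|V|.+1 (c - k).-1; first by lia.
have /andP[/part_size_gt0P[v [Ev Dv]] ne] := Hi.
by exists v; rewrite a'E Ev Dv eqxx ne /= Ei; lia.
Qed.

Lemma split_class_le : k <= k'.
Proof. exact: leq_addr. Qed.

Lemma split_class_lt : splits a d s -> k < k'.
Proof.
case/splitsP=> // u [v [Eu Ev ne]].
have [w [Ew Dw]] : exists w, a w = s /\ d w != b.
  have [Du | Du] := eqVneq (d u) b; last by exists u.
  by exists v; rewrite -Du eq_sym.
have : rank f b (d w).+1 <= rank f b #|V|.+1 by apply: rank_le; rewrite ltnS.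
have -> : k' = k + rank f b #|V|.+1 by [].
by rewrite rankS renamed_d // Dw; lia.
Qed.

End OneClass.

Definition split_classes d (st : (V -> nat) * nat) (S : seq nat) :=
  foldl (split_class d) st S.

(** Splitting one class sends vertices only to colours above [k], hence outside [S]. The remaining
    classes of [S] and their part sizes are thus those of the original [a], and everything can be
    stated in terms of [a]. *)
Lemma split_classes_spec d a k S (a' := (split_classes d (a, k) S).1)
    (k' := (split_classes d (a, k) S).2) :
  (forall v, d v <= #|V|) -> onto a k -> uniq S ->
  (forall s, s \in S -> 1 <= s <= k) ->
  [/\ onto a' k', k <= k', (forall s, s \in S -> splits a d s) -> k + size S <= k',
      forall v, a' v = a v \/
        [/\ k < a' v, a v \in S & d v != heaviest (part_size a d (a v)) #|V|.+1] &
      forall u v, a' u = a' v <-> a u = a v /\ (a u \in S -> d u = d v)].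
Proof.
move=> d_le; rewrite {}/a' {}/k'.
elim: S a k => [|s S IH] a k a_onto /= => [_ _ | /andP[s_notin S_uniq] S_le].
  split=> //; first by rewrite addn0.
  - by left.
  - by split=> // -[].
have s_le : 1 <= s <= k by apply: S_le; rewrite inE eqxx.
have onto1 := split_class_onto d_le a_onto s_le.
have alt1 := @split_class_alt d a k s.
have ker1 := split_class_kernel d_le a_onto s_le.
have le1 := split_class_le d a k s.
have lt1 := split_class_lt d_le a_onto s_le.
move: onto1 alt1 ker1 le1 lt1.
case: (split_class d (a, k) s) => a1 k1 /= onto1 alt1 ker1 le1 lt1.
have S_le' t : t \in S -> 1 <= t <= k.
  by move=> St; apply: S_le; rewrite inE St orbT.
have classE v t : t \in S -> (a1 v == t) = (a v == t).
  move=> St; have := S_le' t St; have [-> // | [lt Ev _] le_t] := alt1 v.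
  rewrite Ev; have -> : (s == t) = false by apply: contraNF s_notin => /eqP->.
  by apply/eqP; lia.
have partE t i : t \in S -> part_size a1 d t i = part_size a d t i.
  by move=> St; apply: eq_card => v; rewrite !inE classE.
have memE v : (a1 v \in S) = (a v \in S).
  apply/idP/idP => St; have := classE v _ St; rewrite eqxx.
    by move=> /esym H; rewrite (eqP H).
  by move=> H; rewrite (eqP H).
have [|onto' le' size' alt' ker'] := IH a1 k1 onto1 S_uniq.
  by move=> t /S_le'; lia.
split=> //.
- exact: leq_trans le1 le'.
- move=> Hs; have /lt1 lt_k : splits a d s by apply: Hs; rewrite inE eqxx.
  rewrite addnS -addSn (leq_trans _ (size' _)) ?leq_add2r // => t St.
  have := Hs t; rewrite inE St orbT => /(_ isT).
  by rewrite /splits; congr (1 < _); apply: eq_count => i; rewrite partE.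
- move=> v; have [E' | [lt' Sv ne]] := alt' v.
    rewrite E'; have [-> | [lt Ev ne]] := alt1 v; [by left | right].
    by rewrite Ev inE eqxx.
  right; split; first exact: leq_ltn_trans lt'.
    by rewrite inE -memE Sv orbT.
  have /eqP Ea : a v == a1 v by rewrite -(classE v _ Sv).
  suff -> : heaviest (part_size a d (a v)) #|V|.+1 =
            heaviest (part_size a1 d (a1 v)) #|V|.+1 by [].
  by rewrite Ea; apply: eq_heaviest => i; rewrite partE.
- move=> u v; rewrite ker' ker1 memE inE; split.
    by move=> [[E Hs] HS]; split=> // /orP[/eqP/Hs | /HS].
  move=> [E H]; split=> [|St]; last by apply: H; rewrite St orbT.
  by split=> // Es; apply: H; rewrite Es eqxx.
Qed.

End Splitting.

(** * Colour refinement *)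

Definition out_count (V : finType) (G : rel V) (a : V -> nat) (r : nat) (v : V) : nat :=
  #|[set x | G v x && (a x == r)]|.

Definition split_round (V : finType) (G : rel V) (a : V -> nat) (k r : nat) :
    (V -> nat) * nat :=
  let d := out_count G a r in
  split_classes d (a, k) [seq s <- iota 1 k | splits a d s].

(* A state [(a, k, p)] consists of a colouring with the colours [1, ..., k],
   the first [p] of which have already been used as refining colours. *)
Definition next_state (V : finType) (G : rel V) (st : (V -> nat) * nat * nat) :
    (V -> nat) * nat * nat :=
  let: (a, k, p) := st in
  if p < k then (split_round G a k p.+1, p.+1) else st.

(** The number of iterations suffices because each of them advances [p] until it meets [k], and [k]
    never exceeds [#|V|]. *)
Definition final_state (V : finType) (G : rel V) (st : (V -> nat) * nat * nat) :=
  iter #|V| (next_state G) st.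

Definition refinement : colouring_method := fun V G a =>
  let a0 v := absz (a v) in
  let k := \max_v a0 v in
  fun v => Posz ((final_state G (a0, k, k.-1)).1.1 v).

Section Refinement.

Variables (V : finType) (G : rel V).
Implicit Types (a : V -> nat) (k p r : nat) (u v w x : V).

Definition out_card v (A : {set V}) : nat := #|[set x in A | G v x]|.

(** The colours have an arbitrary type so that [pblock Q], which colours each vertex by its cell, is
    an instance. *)
Definition stable_colouring (T : eqType) (b : V -> T) : Prop :=
  forall u v, b u = b v -> forall w,
    out_card u [set x | b x == b w] = out_card v [set x | b x == b w].

Lemma out_countE a r v : out_count G a r v = out_card v [set x | a x == r].
Proof. by apply: eq_card => x; rewrite !inE andbC. Qed.

Lemma out_count_le a r v : out_count G a r v <= #|V|.
Proof. exact: max_card. Qed.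

Lemma out_cardD v (A B : {set V}) :
  B \subset A -> out_card v A = out_card v B + out_card v (A :\: B).
Proof.
move=> sBA; rewrite /out_card -(cardsID B); congr (_ + _); apply: eq_card => x.
  rewrite !inE; case Bx: (x \in B); rewrite ?andbF //= andbT.
  by rewrite (subsetP sBA).
by rewrite !inE andbA.
Qed.

(** The set [A] is a union of colour classes of [b]; they are removed one at a time. *)
Lemma out_card_closed (T : eqType) (b : V -> T) (A : {set V}) u v :
  (forall x y, b x = b y -> x \in A -> y \in A) ->
  (forall w, w \in A ->
     out_card u [set x | b x == b w] = out_card v [set x | b x == b w]) ->
  out_card u A = out_card v A.
Proof.
have [N leN] := ubnP #|A|; elim: N A leN => // N IH A leN closedA eqA.
have [-> | [w Aw]] := set_0Vmem A.
  by rewrite /out_card !(eq_card (B := pred0)) // => x; rewrite !inE.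
have sBA : [set x | b x == b w] \subset A.
  by apply/subsetP => x; rewrite inE => /eqP E; apply: closedA Aw.
rewrite !(out_cardD _ sBA) eqA //; congr (_ + _); apply: IH.
- have B_gt0 : 0 < #|[set x | b x == b w]| by apply/card_gt0P; exists w; rewrite inE.
  by have := cardsDS sBA; have := subset_leq_card sBA; lia.
- by move=> x y E; rewrite !inE E => /andP[-> /(closedA _ _ E)].
- by move=> x; rewrite inE => /andP[_ /eqA].
Qed.

(** The kernel is described on all classes although only those in the filtered list are processed:
    on the others the counts are constant. For the halving, a moved vertex lies in a part that is no
    larger than the heaviest one, and the two are disjoint inside the old class. *)
Lemma split_round_spec a k r (a' := (split_round G a k r).1)
    (k' := (split_round G a k r).2) :
  onto a k ->
  [/\ onto a' k',
      k + size [seq s <- iota 1 k | splits a (out_count G a r) s] <= k',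
      forall u v, a' u = a' v <->
        a u = a v /\ out_count G a r u = out_count G a r v,
      forall v, a' v = a v \/ k < a' v &
      forall v, a' v != a v -> (class_size a' (a' v)).*2 <= class_size a (a v)].
Proof.
move=> a_onto; rewrite /a' /k' /split_round.
set d := out_count G a r; set S := filter _ _.
have d_le v : d v <= #|V| by apply: out_count_le.
have [||onto' _ size' alt' ker'] := split_classes_spec d_le a_onto (S := S).
- by rewrite filter_uniq ?iota_uniq.
- by move=> s; rewrite mem_filter mem_iota => /and3P[_ -> /=]; rewrite add1n ltnS.
move: onto' size' alt' ker'.
case: (split_classes d (a, k) S) => {a' k'} a' k' /= onto' size' alt' ker'.
have ker u v : a' u = a' v <-> a u = a v /\ d u = d v.
  rewrite ker'; split=> -[E H]; split=> //.
  case: (boolP (a u \in S)) => [/H // | ]; rewrite mem_filter mem_iota add1n ltnS.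
  have := onto_le u a_onto => -> ; rewrite andbT => no.
  have [// | ne] := eqVneq (d u) (d v); case/negP: no.
  by apply/splitsP => //; exists u, v.
split=> //.
- by apply: size' => s; rewrite mem_filter => /andP[].
- by move=> v; have [-> | []] := alt' v; [left | right].
move=> v ne; have [E | [_ _ ne']] := alt' v; first by rewrite E eqxx in ne.
set b := heaviest _ _ in ne'.
have -> : class_size a' (a' v) = part_size a d (a v) (d v).
  apply: eq_card => u; rewrite !inE; apply/eqP/andP => [/ker[-> ->] // | [/eqP E /eqP D]].
  exact/ker.
apply: leq_trans (part_size2 a d (a v) ne').
by rewrite -addnn leq_add2l; apply: heaviest_max; rewrite ltnS.
Qed.

(* The set [A] is the class of [c] at the moment when [c] was the refining
   colour; the colours that have left it since then are still to be used. *)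
Definition used_colour a (c : nat) : Prop :=
  exists A : {set V},
    [/\ forall v, a v = c -> v \in A,
        forall u v, a u = a v -> u \in A -> v \in A,
        forall v, v \in A -> c <= a v &
        forall u v, a u = a v -> out_card u A = out_card v A].

(** The last two clauses place [a] between [a0] and every stable colouring finer than [a0]. Once [p]
    equals [k], the third clause makes [a] itself stable, hence the coarsest one. *)
Definition sound_state (a0 : V -> nat) (st : (V -> nat) * nat * nat) : Prop :=
  let: (a, k, p) := st in
  [/\ onto a k, p <= k, forall c, 1 <= c <= p -> used_colour a c,
      forall u v, a u = a v -> a0 u = a0 v &
      forall (T : eqType) (b : V -> T), stable_colouring b ->
        (forall u v, b u = b v -> a0 u = a0 v) ->
        forall u v, b u = b v -> a u = a v].

(** The witness for the colour just used is its class before the split. Earlier witnesses survive,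
    because cells only get finer and vertices only move to larger colours. For coarseness, the
    refining class is a union of classes of any stable [b] finer than [a0], so vertices equal under
    [b] have equal counts into it. *)
Lemma sound_state_next a0 st : sound_state a0 st -> sound_state a0 (next_state G st).
Proof.
case: st => [[a k] p] /= [a_onto le_pk used ref coarse]; case: ltnP => // lt_pk.
have := split_round_spec p.+1 a_onto.
case: (split_round G a k p.+1) => a' k' /= [onto' size' ker' alt' _].
have le_k : k <= k' by apply: leq_trans size'; rewrite leq_addr.
have ker u v : a' u = a' v -> a u = a v by case/ker'.
split=> //.
- exact: leq_trans le_k.
- have old c v : c <= k -> a' v = c -> a v = c by case: (alt' v) => [-> // |]; lia.
  move=> c /andP[c_gt0]; rewrite leq_eqVlt => /orP[/eqP-> | lt_c].
    exists [set v | a v == p.+1]; split.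
    + by move=> v /(old _ _ lt_pk); rewrite inE => ->.
    + by move=> u v /ker E; rewrite !inE E.
    + by move=> v; rewrite inE => /eqP E; case: (alt' v); lia.
    + by move=> u v /ker'[_]; rewrite !out_countE.
  have [|A [A1 A2 A3 A4]] := used c; first by lia.
  exists A; split.
  + by move=> v E; apply/A1/old => //; lia.
  + by move=> u v /ker; apply: A2.
  + by move=> v /A3; case: (alt' v); lia.
  + by move=> u v /ker; apply: A4.
- by move=> u v /ker; apply: ref.
- move=> T b b_stable b_ref u v E; apply/ker'; split; first exact: coarse E.
  rewrite !out_countE; apply: (@out_card_closed _ b).
    by move=> x y /(coarse T b b_stable b_ref); rewrite !inE => ->.
  by move=> w _; apply: b_stable.
Qed.

Lemma final_state_done a0 st :
  sound_state a0 st ->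
  sound_state a0 (final_state G st) /\ (final_state G st).2 = (final_state G st).1.2.
Proof.
move=> Ist; pose st_ j := iter j (next_state G) st.
have Ij j : sound_state a0 (st_ j) by elim: j => //= j /sound_state_next.
split; first exact: Ij.
have Hj j : (st_ j).2 = (st_ j).1.2 \/ j <= (st_ j).2 < (st_ j).1.2.
  elim: j => [|j].
    have := Ij 0; rewrite /st_ /=; case: (st) => [[a k] p] /= [_ le_pk _ _ _].
    by rewrite ltn_neqAle le_pk andbT; case: eqP; [left | right].
  have := Ij j.+1; rewrite /= -/(st_ j).
  case: (st_ j) => [[a k] p] /= + [-> | /andP[le_j lt_p]]; first by rewrite ltnn; left.
  rewrite lt_p /=; case: split_round => a' k' /= [_ le_p _ _ _].
  by have [|] := eqVneq p.+1 k'; [left | right]; lia.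
case: (Hj #|V|) => // /andP[le_V lt]; rewrite /final_state -/(st_ _).
move: (Ij #|V|) le_V lt; case: (st_ #|V|) => [[a k] p] /= [/onto_card le_k _ _ _ _] le_V lt.
by have := leq_ltn_trans (leq_trans le_k le_V) lt; rewrite ltnn.
Qed.

Lemma final_state_next a0 st :
  sound_state a0 st -> final_state G (next_state G st) = final_state G st.
Proof.
move=> /final_state_done[_]; rewrite /final_state -iterSr iterS.
by case: (iter _ _ _) => [[a k] p] /= ->; rewrite ltnn.
Qed.

Lemma final_state_id a k : final_state G (a, k, k) = (a, k, k).
Proof. by rewrite /final_state; elim: #|V| => //= j ->; rewrite /= ltnn. Qed.

Lemma sound_state_stable a0 a k : sound_state a0 (a, k, k) -> stable_colouring a.
Proof.
case=> a_onto _ used _ _ u v E w.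
suff H N : forall c, 1 <= c <= k -> k - c < N ->
    out_card u [set x | a x == c] = out_card v [set x | a x == c].
  exact: H (onto_le w a_onto) (ltnSn _).
elim: N => // N IH c c_le leN; have [A [A1 A2 A3 A4]] := used c c_le.
have sCA : [set x | a x == c] \subset A.
  by apply/subsetP=> x; rewrite inE => /eqP/A1.
have := A4 u v E; rewrite !(out_cardD _ sCA).
(* [A] minus the class of [c] is a union of classes of larger colours, for which the induction
   hypothesis gives equal counts. *)
rewrite (@out_card_closed _ a (A :\: [set x | a x == c]) u v); first by lia.
- by move=> x y Exy; rewrite !inE Exy => /andP[-> /(A2 _ _ Exy)].
- move=> x; rewrite !inE => /andP[ne /A3 le_c].
  have := onto_le x a_onto => /andP[x_gt0 x_le].
  by apply: IH; rewrite ?x_gt0 //; lia.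
Qed.

(** On the empty vertex set no colour occurs, so the number of colours is 0 there and 1
    otherwise. *)
Lemma sound_state_unit : sound_state (fun=> 1) ((fun=> 1), (0 < #|V| : nat), 0).
Proof.
split=> //; last by move=> c; lia.
move=> c; split=> [[v <-] | ]; first by rewrite (_ : 0 < #|V|) //; apply/card_gt0P; exists v.
case V_gt0: (0 < #|V|); last by lia.
by move=> H; have /card_gt0P[v _] := V_gt0; exists v; lia.
Qed.

(** All [k] old colours count as used. The witness for [c] is its class under [a], which is its
    class under [a1], possibly together with [v], whose new colour is larger; counts into it are
    constant because [a] is stable. *)
Lemma sound_state_individualize a k v a1 :
  onto a k -> stable_colouring a -> (exists2 u, u != v & a u = a v) ->
  a1 =1 (fun w => if w == v then k.+1 else a w) ->
  sound_state a1 (a1, k.+1, k).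
Proof.
move=> a_onto a_stable [u ne_u Eu] E1.
have a_le w := onto_le w a_onto.
split=> //.
- move=> c; split=> [[w <-] | c_le].
    by rewrite E1; case: eqP => _; first lia; have := a_le w; lia.
  have [-> | nc] := eqVneq c k.+1; first by exists v; rewrite E1 eqxx.
  have [_ [|w Ew]] := a_onto c; first by lia.
  have [Evw | ne] := eqVneq w v; last by exists w; rewrite E1 (negbTE ne).
  by exists u; rewrite E1 (negbTE ne_u) Eu -Evw.
- have ker x y : a1 x = a1 y -> a x = a y.
    rewrite !E1; have := a_le x; have := a_le y.
    by case: eqP => [-> | _]; case: eqP => [-> | _] //; lia.
  move=> c c_le; have [_ /(_ c_le)[x Ex]] := a_onto c.
  exists [set w | a w == c]; split.
  + by move=> w; rewrite E1 inE; case: eqP => _ => [|->//]; lia.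
  + by move=> w w' /ker E; rewrite !inE E.
  + by move=> w; rewrite inE E1 => /eqP E; case: eqP => _; lia.
  + by move=> w w' /ker E; rewrite -Ex; apply: a_stable.
Qed.

(** * Amortised cost *)

Variable wt : V -> nat.

(** The logarithm bounds how often the vertex can still move to a class of at most half the size;
    the boolean is the unit reserved for a colour that is still pending. *)
Definition potential a p : nat :=
  \sum_v wt v * (trunc_log 2 (class_size a (a v)) + (p < a v)).

Lemma class_size_gt0 a v : 0 < class_size a (a v).
Proof. by apply/card_gt0P; exists v; rewrite inE. Qed.

Lemma trunc_log_double m n : 0 < m -> m.*2 <= n -> (trunc_log 2 m).+1 <= trunc_log 2 n.
Proof.
by move=> m_gt0 le_n; rewrite -trunc_log2_double // leq_trunc_log.
Qed.

(** A vertex that moves loses one unit of its logarithm, which pays for its fresh colour being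
    pending. A vertex of colour [p.+1] also gives up its pending unit, and this pays for scanning
    it. *)
Lemma potential_split_round a k p a' k' :
  onto a k -> p < k -> split_round G a k p.+1 = (a', k') ->
  potential a' p.+1 + \sum_(v | a v == p.+1) wt v <= potential a p.
Proof.
move=> a_onto lt_pk E; have := split_round_spec p.+1 a_onto; rewrite E /=.
case=> onto' size' ker' alt' half.
rewrite [\sum_(v | _) _]big_mkcond -big_split /=; apply: leq_sum => v _.
have [Ev | ne] := eqVneq (a' v) (a v); last first.
  have := trunc_log_double (class_size_gt0 a' v) (half v ne).
  have := onto_le v a_onto; case: eqP => [-> | _]; last by nia.
  by rewrite ltnSn; nia.
have le_log : trunc_log 2 (class_size a' (a' v)) <= trunc_log 2 (class_size a (a v)).
  apply: leq_trunc_log; apply: subset_leq_card; apply/subsetP=> u.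
  by rewrite !inE => /eqP/ker'[->].
rewrite Ev in le_log *; case: eqP => [Er | ne].
  by rewrite Er ltnn ltnSn in le_log *; nia.
rewrite addn0 leq_mul2l; apply/orP; right; apply: leq_add => //.
by case: (ltnP p.+1 (a v)) => // lt; rewrite (ltnW lt).
Qed.

(** The class of [v] had at least two vertices, so the logarithm of [v] drops from at least 1 to 0
    and pays for its new pending colour. *)
Lemma potential_individualize a k v a1 :
  onto a k -> (exists2 u, u != v & a u = a v) ->
  a1 =1 (fun w => if w == v then k.+1 else a w) ->
  potential a1 k <= potential a k.
Proof.
move=> a_onto [u ne_u Eu] E1; apply: leq_sum => w _; rewrite leq_mul2l; apply/orP; right.
have a_le x := onto_le x a_onto.
have [-> | ne] := eqVneq w v.
  have -> : class_size a1 (a1 v) = 1.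
    rewrite -(cards1 v); apply: eq_card => x; rewrite !inE !E1 eqxx.
    have [_ | _] := eqVneq x v; first by rewrite eqxx.
    by apply/eqP; have := a_le x; lia.
  rewrite E1 eqxx ltnSn trunc_log1 add0n.
  apply: (leq_trans _ (leq_addr _ _)); apply: trunc_log_max => //; rewrite expn1.
  apply: (leq_trans (_ : _ <= #|[set u; v]|)); first by rewrite cards2 ne_u.
  apply: subset_leq_card; apply/subsetP=> x; rewrite !inE => /orP[]/eqP-> //.
  by rewrite Eu.
rewrite !E1 (negbTE ne) leq_add2r; apply: leq_trunc_log; apply: subset_leq_card.
apply/subsetP=> x; rewrite !inE E1; have [_ | _ //] := eqVneq x v.
by have := a_le w; move=> /andP[_ le_w] /eqP Ew; lia.
Qed.

End Refinement.

(** * Canonicity *)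

Section Canonicity.

Variables (V V' : finType) (G : rel V) (G' : rel V') (h : V -> V').
Hypothesis h_iso : isomorphism G G' h.

Lemma iso_card (P : pred V) (P' : pred V') :
  (forall v, P v = P' (h v)) -> #|[set v | P v]| = #|[set v | P' v]|.
Proof.
have [[g hK gK] _] := h_iso => PP'.
rewrite -(card_imset _ (can_inj hK)); apply: eq_card => x; rewrite inE.
apply/imsetP/idP => [[v] | Px]; first by rewrite inE PP' => Pv ->.
by exists (g x); rewrite ?inE ?PP' gK.
Qed.

Lemma iso_cardT : #|V| = #|V'|.
Proof. by have [/bij_eq_card] := h_iso. Qed.

Lemma iso_part_size a d a' d' s i :
  (forall v, a v = a' (h v)) -> (forall v, d v = d' (h v)) ->
  part_size a d s i = part_size a' d' s i.
Proof. by move=> Ha Hd; apply: iso_card => v; rewrite Ha Hd. Qed.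

Lemma iso_split_classes d d' S (st : (V -> nat) * nat) (st' : (V' -> nat) * nat) :
  (forall v, d v = d' (h v)) -> (forall v, st.1 v = st'.1 (h v)) -> st.2 = st'.2 ->
  (forall v, (split_classes d st S).1 v = (split_classes d' st' S).1 (h v)) /\
  (split_classes d st S).2 = (split_classes d' st' S).2.
Proof.
move=> Hd; elim: S st st' => //= s S IH [a k] [a' k'] /= Ha Ek.
have Ef := iso_part_size s _ Ha Hd.
apply: IH => /= [v |]; rewrite -iso_cardT -(eq_heaviest _ Ef).
  by rewrite -Ha -Hd Ek -(eq_rank _ _ Ef).
by rewrite Ek -(eq_rank _ _ Ef).
Qed.

Lemma iso_split_round a a' k r :
  (forall v, a v = a' (h v)) ->
  (forall v, (split_round G a k r).1 v = (split_round G' a' k r).1 (h v)) /\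
  (split_round G a k r).2 = (split_round G' a' k r).2.
Proof.
move=> Ha; have Hd v : out_count G a r v = out_count G' a' r (h v).
  by apply: iso_card => x; rewrite Ha; have [_ ->] := h_iso.
rewrite /split_round (@eq_filter _ _ (splits a' (out_count G' a' r))).
  exact: iso_split_classes.
move=> s; rewrite /splits -iso_cardT; congr (1 < _); apply: eq_count => i.
by rewrite (iso_part_size _ _ Ha Hd).
Qed.

Lemma iso_final_state a a' k p v :
  (forall v, a v = a' (h v)) ->
  (final_state G (a, k, p)).1.1 v = (final_state G' (a', k, p)).1.1 (h v).
Proof.
move=> Ha; rewrite /final_state -iso_cardT.
pose eqst (st : (V -> nat) * nat * nat) (st' : (V' -> nat) * nat * nat) :=
  [/\ forall v, st.1.1 v = st'.1.1 (h v), st.1.2 = st'.1.2 & st.2 = st'.2].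
suff: eqst (iter #|V| (next_state G) (a, k, p)) (iter #|V| (next_state G') (a', k, p)).
  by case.
elim: #|V| => //= j.
case: (iter j _ _) => [[b kb] pb]; case: (iter j _ _) => [[b' kb'] pb'].
case=> /= Hb <- <-; case: ifP => // _.
by have [H1 H2] := iso_split_round kb pb.+1 Hb; split.
Qed.

End Canonicity.

Lemma refinement_canonical : canonical refinement.
Proof.
move=> V V' G G' a a' h h_iso Ha v; rewrite /refinement.
have -> : \max_v absz (a' v) = \max_v absz (a v).
  have [h_bij _] := h_iso; rewrite (reindex h) /=; last exact: onW_bij.
  by apply: eq_bigr => x _; rewrite Ha.
congr Posz; apply: iso_final_state => // x; by rewrite Ha.
Qed.

(** * Coarsest stable partitions *)

Section Cells.

Variables (V : finType) (G : rel V).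
Implicit Types (a b : V -> int) (P Q : {set {set V}}).

Lemma cells_partition a : partition (cells a) [set: V].
Proof. exact: preim_partitionP. Qed.

Lemma cell_in a v : [set x | a x == a v] \in cells a.
Proof.
apply/imsetP; exists v; rewrite ?inE //.
by apply/setP=> x; rewrite !inE eq_sym.
Qed.

Lemma cellsP a A : A \in cells a -> exists v, A = [set x | a x == a v].
Proof.
case/imsetP=> v _ ->; exists v.
by apply/setP=> x; rewrite !inE eq_sym.
Qed.

Lemma out_nbrI v (A : {set V}) : #|out_nbr G v :&: A| = out_card G v A.
Proof. by apply: eq_card => x; rewrite !inE andbC. Qed.

Lemma cells_stable a : stable_colouring G a -> stable_partition G (cells a).
Proof.
move=> a_stable; split; first exact: cells_partition.
move=> C R /cellsP[x ->] /cellsP[y ->] u v; rewrite !inE => /eqP Eu /eqP Ev.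
by rewrite !out_nbrI; apply: a_stable; rewrite Eu Ev.
Qed.

Lemma pblock_stable Q : stable_partition G Q -> stable_colouring G (pblock Q).
Proof.
move=> [Q_part Q_stable] u v E w; have /and3P[/eqP coverQ trivQ _] := Q_part.
have inQ x : x \in cover Q by rewrite coverQ inE.
have -> : [set x | pblock Q x == pblock Q w] = pblock Q w.
  by apply/setP=> x; rewrite inE eq_sym eq_pblock.
rewrite -!out_nbrI; apply: (Q_stable (pblock Q u)); rewrite ?pblock_mem ?mem_pblock //.
by rewrite E mem_pblock.
Qed.

Lemma cells_coarsest (a0 a : V -> nat) k :
  sound_state G a0 (a, k, k) ->
  coarsest_stable_refining G (cells (Posz \o a0)) (cells (Posz \o a)).
Proof.
move=> Ia; have a_stable := sound_state_stable Ia.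
have [_ _ _ ref coarse] := Ia; split.
- by apply: cells_stable => u v [E] w; apply: a_stable.
- move=> A /cellsP[v ->]; exists [set x | (Posz \o a0) x == (Posz \o a0) v].
    exact: cell_in.
  by apply/subsetP=> x; rewrite !inE /= => /eqP[/ref->].
- move=> Q Q_stable Q_ref A QA; have [Q_part _] := Q_stable.
  have /and3P[/eqP coverQ trivQ set0Q] := Q_part.
  have inQ x : x \in cover Q by rewrite coverQ inE.
  have [A0 | [v Av]] := set_0Vmem A; first by rewrite -A0 QA in set0Q.
  exists [set x | (Posz \o a) x == (Posz \o a) v]; first exact: cell_in.
  apply/subsetP=> x Ax; rewrite inE /=; apply/eqP; congr Posz.
  apply: (coarse _ _ (pblock_stable Q_stable)); last first.
    by rewrite (def_pblock trivQ QA Ax) (def_pblock trivQ QA Av).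
  move=> u w E; have [B /cellsP[y ->] sB] := Q_ref _ (pblock_mem (inQ u)).
  have := subsetP sB u; rewrite mem_pblock inE => /(_ (inQ u)) /eqP /= [->].
  by have := subsetP sB w; rewrite E mem_pblock inE => /(_ (inQ w)) /eqP /= [->].
Qed.

Lemma onto_surjective (a : V -> nat) k :
  onto a k -> surjective_colouring k (Posz \o a).
Proof.
move=> a_onto [c|c]; last by split=> [[v] //|]; lia.
have [H1 H2] := a_onto c; split=> [[v [E]] | c_le].
  by have /H1 : exists v, a v = c by [exists v]; lia.
by have [|v <-] := H2; [lia | exists v].
Qed.

Lemma refinementE (a0 a : V -> nat) k k0 :
  onto a0 k0 -> final_state G (a0, k0, k0.-1) = (a, k, k) ->
  refinement G (Posz \o a0) =1 Posz \o a.
Proof.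
move=> a0_onto E v; rewrite /refinement /=.
suff -> : \max_x a0 x = k0 by rewrite E.
apply/eqP; rewrite eqn_leq; apply/andP; split.
  by apply/bigmax_leqP => x _; have /andP[] := onto_le x a0_onto.
case: k0 a0_onto {E} => // k0 /(_ k0.+1)[_ [|x <-]]; first by rewrite leqnn.
exact: leq_bigmax.
Qed.

End Cells.
(** * Executions of the random access machine *)

Lemma exec_weaken W W' c s t s' : W <= W' -> exec W c s t s' -> exec W' c s t s'.
Proof.
move=> le_W; elim=> {c s t s'}.
- by move=> s; apply: ExecSkip.
- by move=> r e s lt_e; apply: ExecSetReg; apply: leq_trans le_W.
- by move=> a e1 e2 s lt1 lt2; apply: ExecSetCell; apply: leq_trans le_W.
- by move=> c1 c2 s t1 s1 t2 s2 _ IH1 _ IH2; apply: ExecSeq IH1 IH2.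
- by move=> b c1 c2 s t s' _ IH; apply: ExecIf.
- by move=> b c s Hb; apply: ExecWhileExit.
- by move=> b c s t1 s1 t2 s2 Hb _ IH1 _ IH2; apply: ExecWhileIter IH1 IH2.
Qed.

Fixpoint written_regs (c : com) : seq nat :=
  match c with
  | SetReg r _ => [:: r]
  | Seq c1 c2 | If _ c1 c2 => written_regs c1 ++ written_regs c2
  | While _ c1 => written_regs c1
  | _ => [::]
  end.

Fixpoint written_arrs (c : com) : seq nat :=
  match c with
  | SetCell a _ _ => [:: a]
  | Seq c1 c2 | If _ c1 c2 => written_arrs c1 ++ written_arrs c2
  | While _ c1 => written_arrs c1
  | _ => [::]
  end.

(** The written registers and arrays are computed from the syntax, so side conditions about concrete
    commands are discharged by [isT]. *)
Definition frame (c : com) (s s' : memory) : Prop :=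
  (forall r, r \notin written_regs c -> reg s' r = reg s r) /\
  (forall a, a \notin written_arrs c -> arr s' a = arr s a).

Lemma frame_refl c s : frame c s s.
Proof. by []. Qed.

Lemma frame_trans c s1 s2 s3 : frame c s1 s2 -> frame c s2 s3 -> frame c s1 s3.
Proof.
move=> [R1 A1] [R2 A2]; split=> [r Hr | a Ha]; first by rewrite R2 ?R1.
by rewrite A2 ?A1.
Qed.

Lemma frame_sub c c' s s' :
  {subset written_regs c <= written_regs c'} ->
  {subset written_arrs c <= written_arrs c'} ->
  frame c s s' -> frame c' s s'.
Proof.
move=> sR sA [R A]; split=> [r | a] Hn; first by rewrite R // (contra (sR r)).
by rewrite A // (contra (sA a)).
Qed.

Lemma exec_frame W c s t s' : exec W c s t s' -> frame c s s'.
Proof.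
elim=> {c s t s'} //.
- move=> r e s _; split=> // r'; rewrite inE => ne /=.
  by rewrite (negbTE ne).
- move=> a e1 e2 s _ _; split=> // b; rewrite inE => ne /=.
  by rewrite (negbTE ne).
- move=> c1 c2 s t1 s1 t2 s2 _ IH1 _ IH2.
  by apply: frame_trans (frame_sub _ _ IH1) (frame_sub _ _ IH2);
    move=> x Hx; rewrite mem_cat Hx ?orbT.
- move=> b c1 c2 s t s' _ IH; apply: (frame_sub _ _ IH);
    by move=> x; rewrite mem_cat; case: holds => ->; rewrite ?orbT.
- by move=> b c s t1 s1 t2 s2 _ _ IH1 _ IH2; apply: frame_trans IH1 IH2.
Qed.

(** * Word size *)

(** Adding two arbitrary values could double the largest one at each step. Only a constant of at
    most 1 or [n_reg] may be added, which keeps the growth linear in time. *)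
Fixpoint slow_expr (e : expr) : bool :=
  match e with
  | Const x => x <= 1
  | Reg _ | Cell _ _ => true
  | Plus e1 (Const x) => slow_expr e1 && (x <= 1)
  | Plus e1 (Reg r) => slow_expr e1 && (r == n_reg)
  | Plus _ _ => false
  | Minus e1 _ => slow_expr e1
  end.

(* In a slow command a step increases the largest value by at most
   [max 1 (reg s n_reg)], so short runs need only short words. *)
Fixpoint slow (c : com) : bool :=
  match c with
  | Skip => true
  | SetReg r e => (r != n_reg) && slow_expr e
  | SetCell _ e1 e2 => slow_expr e1 && slow_expr e2
  | Seq c1 c2 | If _ c1 c2 => slow c1 && slow c2
  | While _ c1 => slow c1
  end.

Definition bounded (K M : nat) (s : memory) : Prop :=
  [/\ reg s n_reg <= K, forall r, reg s r <= M & forall a i, arr s a i <= M].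

Lemma boundedW K M M' s : M <= M' -> bounded K M s -> bounded K M' s.
Proof.
by move=> le_M [HK Hr Ha]; split=> // [r | a i]; apply: leq_trans le_M.
Qed.

Lemma slow_eval K M e s :
  0 < K -> slow_expr e -> bounded K M s -> eval e s <= M + K * expr_cost e.
Proof.
move=> K_gt0 + [HK Hr Ha].
elim: e => [x | r | a e _ | e1 IH1 e2 _ | e1 IH1 e2 _] /=.
- by move=> le_x; rewrite muln1 (leq_trans le_x) // (leq_trans K_gt0) // leq_addl.
- by rewrite (leq_trans (Hr r)) // leq_addr.
- by move=> _; rewrite (leq_trans (Ha _ _)) // leq_addr.
- case: e2 => // [x | r] /andP[/IH1 le1 H2] /=; first by nia.
  by rewrite (eqP H2); nia.
- by move/IH1=> le1; nia.
Qed.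

(** The bound [W] under which the run was found is forgotten: the values that a slow command can
    reach in [t] steps fit under [W'] anyway. *)
Lemma exec_slow K M W W' c s t s' :
  0 < K -> slow c -> exec W c s t s' -> bounded K M s -> M + K * t < W' ->
  exec W' c s t s' /\ bounded K (M + K * t) s'.
Proof.
move=> K_gt0 + ex; elim: ex M => {c s t s'}.
- move=> s M _ Hs _; split; first exact: ExecSkip.
  by apply: boundedW Hs; apply: leq_addr.
- move=> r e s _ M /= /andP[r_ne0 /(slow_eval K_gt0) Se] Hs lt_W.
  have := Se _ _ Hs => {}Se; split.
    by apply: ExecSetReg; apply: leq_ltn_trans lt_W; nia.
  case: Hs => HK Hr Ha; split=> /= [|r' | a i].
  + by rewrite eq_sym (negbTE r_ne0).
  + case: eqP => _; first by nia.
    by apply: leq_trans (Hr _) (leq_addr _ _).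
  + by apply: leq_trans (Ha _ _) (leq_addr _ _).
- move=> a e1 e2 s _ _ M /= /andP[/(slow_eval K_gt0) S1 /(slow_eval K_gt0) S2].
  move=> Hs lt_W.
  have := S1 _ _ Hs => {}S1; have := S2 _ _ Hs => {}S2; split.
    by apply: ExecSetCell; apply: leq_ltn_trans lt_W; nia.
  case: Hs => HK Hr Ha; split=> //= [r' | b i].
  + by apply: leq_trans (Hr _) (leq_addr _ _).
  + case: ifP => _; first by nia.
    by apply: leq_trans (Ha _ _) (leq_addr _ _).
- move=> c1 c2 s t1 s1 t2 s2 _ IH1 _ IH2 M /= /andP[S1 S2] Hs lt_W.
  have [|ex1 H1] := IH1 _ S1 Hs; first by nia.
  have [|ex2 H2] := IH2 _ S2 H1; first by nia.
  split; first exact: ExecSeq ex1 ex2.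
  by apply: boundedW H2; nia.
- move=> b c1 c2 s t s' _ IH M /= /andP[S1 S2] Hs lt_W.
  have [||ex H] := IH _ _ Hs; [by case: holds | by nia|].
  split; first exact: ExecIf.
  by apply: boundedW H; nia.
- move=> b c s Hb M _ Hs _; split; first exact: ExecWhileExit.
  by apply: boundedW Hs; apply: leq_addr.
- move=> b c s t1 s1 t2 s2 Hb _ IH1 _ IH2 M /= S Hs lt_W.
  have [|ex1 H1] := IH1 _ S Hs; first by nia.
  have [|ex2 H2] := IH2 _ S H1; first by nia.
  split; first exact: ExecWhileIter ex1 ex2.
  by apply: boundedW H2; nia.
Qed.

(** * Total correctness with a time bound *)

(** The word bound is existential, so that correctness proofs need not track overflow; [exec_slow]
    replaces it by one computed from the time. *)
Definition run (c : com) (s : memory) (B : nat) (Q : memory -> Prop) : Prop :=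
  exists W t s', [/\ exec W c s t s', t <= B & Q s'].

Lemma run_weaken c s B B' (Q Q' : memory -> Prop) :
  run c s B Q -> B <= B' -> (forall s', frame c s s' -> Q s' -> Q' s') ->
  run c s B' Q'.
Proof.
move=> [W [t [s' [ex le_t Qs']]]] le_B QQ'; exists W, t, s'; split=> //.
  exact: leq_trans le_B.
exact: QQ' (exec_frame ex) Qs'.
Qed.

Lemma run_seq c1 c2 s B1 B2 B Q :
  run c1 s B1 (fun s1 => run c2 s1 B2 Q) -> B1 + B2 < B ->
  run (Seq c1 c2) s B Q.
Proof.
move=> [W1 [t1 [s1 [ex1 le1 [W2 [t2 [s2 [ex2 le2 Qs2]]]]]]]] lt_B.
exists (maxn W1 W2), (t1 + t2).+1, s2; split=> //.
  by apply: ExecSeq (exec_weaken _ ex1) (exec_weaken _ ex2);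
    rewrite ?leq_maxl ?leq_maxr.
by apply: leq_trans lt_B; rewrite ltnS leq_add.
Qed.

Lemma run_if b c1 c2 s B B' Q :
  (if holds b s then run c1 s B Q else run c2 s B Q) ->
  test_cost b + B < B' -> run (If b c1 c2) s B' Q.
Proof.
move=> H lt_B.
have {H} [W [t [s' [ex le_t Qs']]]] : run (if holds b s then c1 else c2) s B Q.
  by case: (holds b s) H.
exists W, (test_cost b + t).+1, s'; split=> //; first exact: ExecIf.
by apply: leq_trans lt_B; rewrite ltnS leq_add2l.
Qed.

Lemma run_while_exit b c s B (Q : memory -> Prop) :
  ~~ holds b s -> Q s -> test_cost b < B -> run (While b c) s B Q.
Proof.
by move=> Hb Qs lt_B; exists 0, (test_cost b).+1, s; split=> //; apply: ExecWhileExit.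
Qed.

Lemma run_while_iter b c s B1 B2 B Q :
  holds b s -> run c s B1 (fun s1 => run (While b c) s1 B2 Q) ->
  test_cost b + B1 + B2 < B -> run (While b c) s B Q.
Proof.
move=> Hb [W1 [t1 [s1 [ex1 le1 [W2 [t2 [s2 [ex2 le2 Qs2]]]]]]]] lt_B.
exists (maxn W1 W2), (test_cost b + t1 + t2).+1, s2; split=> //.
  by apply: ExecWhileIter Hb (exec_weaken _ ex1) (exec_weaken _ ex2);
    rewrite ?leq_maxl ?leq_maxr.
by apply: leq_trans lt_B; lia.
Qed.

(* [I T s]: the invariant holds in [s] with [T] time units left. *)
Lemma run_while b c s0 T0 (I : nat -> memory -> Prop) (Q : memory -> Prop) :
  I T0 s0 ->
  (forall T s, frame c s0 s -> I T s -> ~~ holds b s -> test_cost b < T /\ Q s) ->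
  (forall T s, frame c s0 s -> I T s -> holds b s ->
     exists B, run c s B (fun s' =>
       exists2 T', I T' s' & test_cost b + B + T' < T)) ->
  run (While b c) s0 T0 Q.
Proof.
move=> Is0 Hexit Hiter.
suff H N : forall T s, T < N -> I T s -> frame c s0 s -> run (While b c) s T Q.
  exact: H (ltnSn T0) Is0 (frame_refl c s0).
elim: N => // N IH T s leN Is Fs.
have [Hb | Hb] := boolP (holds b s); last first.
  by have [lt Qs] := Hexit _ _ Fs Is Hb; apply: run_while_exit.
have [B [W [t [s' [ex le_t [T' Is' lt_T]]]]]] := Hiter _ _ Fs Is Hb.
apply: (@run_while_iter _ _ _ B T') => //.
exists W, t, s'; split=> //.
apply: IH => //; first by lia.
exact: frame_trans Fs (exec_frame ex).
Qed.

(** * Counting loops and straight-line programs *)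

Definition incr r := SetReg r (Plus (Reg r) (Const 1)).

Definition for_loop (r : nat) (hi : expr) (c : com) : com :=
  While (Lt (Reg r) hi) (Seq c (incr r)).

(** The limit [hi] is evaluated anew at each test, hence the hypothesis that it keeps the value
    [top] throughout the frame. The constant 9 covers the test without [hi], the increment and the
    control overhead of an iteration. *)
Lemma run_for r hi c s0 lo top (B : nat -> nat) T (I : nat -> memory -> Prop) :
  reg s0 r = lo -> lo <= top ->
  (forall s, frame (for_loop r hi c) s0 s -> eval hi s = top) ->
  r \notin written_regs c ->
  I lo s0 ->
  (forall i s, lo <= i < top -> reg s r = i ->
     frame (for_loop r hi c) s0 s -> I i s ->
     run c s (B i) (fun s' => I i.+1 (set_reg s' r i.+1))) ->
  \sum_(lo <= i < top) (B i + expr_cost hi + 9) + expr_cost hi + 3 <= T ->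
  run (for_loop r hi c) s0 T (fun s => reg s r = top /\ I top s).
Proof.
move=> r_lo le_lo Hhi r_nw I_lo Hbody leT.
pose J U s := exists2 i, lo <= i <= top /\ reg s r = i &
  I i s /\ \sum_(i <= j < top) (B j + expr_cost hi + 9) + expr_cost hi + 3 <= U.
apply: (@run_while _ _ _ _ J).
- by exists lo; rewrite ?leqnn.
- move=> U s F [i [/andP[le_i le_top] ri] [Ii leU]] /=.
  rewrite Hhi // ri -leqNgt => ge_top.
  have Ei : i = top by apply/eqP; rewrite eqn_leq le_top.
  by rewrite -Ei; split=> //; apply: leq_trans leU; lia.
- move=> U s F [i [/andP[le_i le_top] ri] [Ii leU]] /=.
  rewrite Hhi // ri => lt_i; exists (B i + 5).
  move: leU; rewrite big_ltn // => leU.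
  have run_c : run c s (B i) (fun s' => I i.+1 (set_reg s' r i.+1)).
    by apply: Hbody; rewrite ?le_i.
  apply: (@run_seq _ _ _ (B i) 4); last by lia.
  apply: run_weaken run_c (leqnn _) _ => s' [Fr _] Is'.
  exists (reg s' r + 1).+1, 4, (set_reg s' r i.+1); split=> //=.
    have -> : i.+1 = eval (Plus (Reg r) (Const 1)) s' by rewrite /= Fr // ri addn1.
    exact: ExecSetReg.
  exists (\sum_(i.+1 <= j < top) (B j + expr_cost hi + 9) + expr_cost hi + 3).
    exists i.+1; first by rewrite /= eqxx lt_i ltnW.
    by split.
  by apply: leq_trans leU; lia.
Qed.

(** The value at [While] is a dummy: [wp] is [False] there. *)
Fixpoint straight_cost (c : com) : nat :=
  match c with
  | Skip => 1
  | SetReg _ e => (expr_cost e).+1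
  | SetCell _ e1 e2 => (expr_cost e1 + expr_cost e2).+1
  | Seq c1 c2 => (straight_cost c1 + straight_cost c2).+1
  | If b c1 c2 => (test_cost b + maxn (straight_cost c1) (straight_cost c2)).+1
  | While _ _ => 0
  end.

Fixpoint wp (c : com) (Q : memory -> Prop) (s : memory) : Prop :=
  match c with
  | Skip => Q s
  | SetReg r e => Q (set_reg s r (eval e s))
  | SetCell a e1 e2 => Q (set_cell s a (eval e1 s) (eval e2 s))
  | Seq c1 c2 => wp c1 (wp c2 Q) s
  | If b c1 c2 => if holds b s then wp c1 Q s else wp c2 Q s
  | While _ _ => False
  end.

Lemma wp_impl c s (Q Q' : memory -> Prop) :
  (forall s', Q s' -> Q' s') -> wp c Q s -> wp c Q' s.
Proof.
elim: c s Q Q' => /= [|r e|a e1 e2|c1 IH1 c2 IH2|b c1 IH1 c2 IH2|//] s Q Q' H.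
- exact: H.
- exact: H.
- exact: H.
- by apply: IH1 => s'; apply: IH2.
- by case: holds; [apply: IH1 | apply: IH2].
Qed.

Lemma run_straight c s B (Q : memory -> Prop) :
  straight_cost c <= B -> wp c Q s -> run c s B Q.
Proof.
elim: c s B Q => //.
- by move=> s B Q le_B Qs; exists 0, 1, s; split=> //; apply: ExecSkip.
- move=> r e s B Q /= le_B Qs.
  by exists (eval e s).+1, (expr_cost e).+1, (set_reg s r (eval e s)); split=> //;
    apply: ExecSetReg.
- move=> a e1 e2 s B Q /= le_B Qs; exists (maxn (eval e1 s) (eval e2 s)).+1.
  exists (expr_cost e1 + expr_cost e2).+1, (set_cell s a (eval e1 s) (eval e2 s)).
  by split=> //; apply: ExecSetCell; rewrite ltnS ?leq_maxl ?leq_maxr.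
- move=> c1 IH1 c2 IH2 s B Q /= le_B Qs.
  apply: run_seq le_B; apply: IH1 (leqnn _) _.
  by apply: wp_impl Qs => s'; apply: IH2.
- move=> b c1 IH1 c2 IH2 s B Q /= le_B Qs.
  by apply: run_if le_B; case: (holds b s) Qs => Qs; [apply: IH1 | apply: IH2];
    rewrite ?leq_maxl ?leq_maxr.
Qed.

(** * The program *)

Notation p_reg := 3 (only parsing).
Notation cursor_reg := 4 (only parsing).
Notation c_reg := 5 (only parsing).
Notation w_reg := 6 (only parsing).
Notation t_reg := 7 (only parsing).
Notation q_reg := 8 (only parsing).
Notation e_reg := 9 (only parsing).
Notation j_reg := 10 (only parsing).
Notation ntouched_reg := 11 (only parsing).
Notation nsplit_reg := 12 (only parsing).
Notation flag_reg := 13 (only parsing).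
Notation x_reg := 14 (only parsing).
Notation top_reg := 15 (only parsing).
Notation b_reg := 16 (only parsing).
Notation i_reg := 17 (only parsing).
Notation y_reg := 18 (only parsing).
Notation g_reg := 19 (only parsing).
Notation l_reg := 20 (only parsing).

Notation head_arr := 3 (only parsing).
Notation next_arr := 4 (only parsing).
Notation base_arr := 5 (only parsing).
Notation end_arr := 6 (only parsing).
Notation elt_arr := 7 (only parsing).
Notation pos_arr := 8 (only parsing).
Notation tend_arr := 9 (only parsing).
Notation telt_arr := 10 (only parsing).
Notation deg_arr := 11 (only parsing).
Notation touched_arr := 12 (only parsing).
Notation split_arr := 13 (only parsing).
Notation cnt_arr := 14 (only parsing).
Notation name_arr := 15 (only parsing).
Notation half_arr := 16 (only parsing).
Notation key_arr := 17 (only parsing).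
Notation tmp_arr := 18 (only parsing).
Notation mov_arr := 19 (only parsing).

Notation "c1 ;; c2" := (Seq c1 c2) (at level 90, right associativity).

(** A vertex with [deg_arr] 0 is met for the first time in this round, and a class whose [tend_arr]
    equals its [base_arr] has no touched vertex yet. [reset] restores this state for touched classes
    only, so no round initializes whole arrays. *)
Definition scan_vertex : com :=
  If (Eq (Cell deg_arr (Reg w_reg)) (Const 0))
    (SetReg c_reg (Cell col_arr (Reg w_reg)) ;;
     If (Eq (Cell tend_arr (Reg c_reg)) (Cell base_arr (Reg c_reg)))
       (SetCell touched_arr (Reg ntouched_reg) (Reg c_reg) ;; incr ntouched_reg)
       Skip ;;
     SetCell telt_arr (Cell tend_arr (Reg c_reg)) (Reg w_reg) ;;
     SetCell tend_arr (Reg c_reg) (Plus (Cell tend_arr (Reg c_reg)) (Const 1)))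
    Skip ;;
  SetCell deg_arr (Reg w_reg) (Plus (Cell deg_arr (Reg w_reg)) (Const 1)).

Definition scan_list : com :=
  While (Lt (Const 0) (Reg e_reg))
    (SetReg w_reg (Cell src_arr (Minus (Reg e_reg) (Const 1))) ;;
     scan_vertex ;;
     SetReg e_reg (Cell next_arr (Minus (Reg e_reg) (Const 1)))).

Definition scan_class : com :=
  SetReg ntouched_reg (Const 0) ;;
  SetReg q_reg (Cell base_arr (Reg p_reg)) ;;
  for_loop q_reg (Cell end_arr (Reg p_reg))
    (SetReg e_reg (Cell head_arr (Cell elt_arr (Reg q_reg))) ;; scan_list).

(** The flag starts as the number of untouched vertices of the class. These have count 0 while
    touched ones have positive counts, so a positive start already means a split; otherwise the flag
    is set by two different positive counts. *)
Definition select : com :=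
  SetReg nsplit_reg (Const 0) ;;
  SetReg j_reg (Const 0) ;;
  for_loop j_reg (Reg ntouched_reg)
    (SetReg c_reg (Cell touched_arr (Reg j_reg)) ;;
     SetReg flag_reg (Minus (Cell end_arr (Reg c_reg)) (Cell tend_arr (Reg c_reg))) ;;
     SetReg q_reg (Cell base_arr (Reg c_reg)) ;;
     SetReg x_reg (Cell deg_arr (Cell telt_arr (Reg q_reg))) ;;
     for_loop q_reg (Cell tend_arr (Reg c_reg))
       (If (Eq (Cell deg_arr (Cell telt_arr (Reg q_reg))) (Reg x_reg))
         Skip (SetReg flag_reg (Const 1))) ;;
     If (Lt (Const 0) (Reg flag_reg))
       (SetCell split_arr (Reg nsplit_reg) (Reg c_reg) ;; incr nsplit_reg) Skip).

(** The lowest bit of the key, as the key minus twice its half. The half is looked up in a table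
    since the machine cannot divide. *)
Definition key_bit : expr :=
  let key := Cell key_arr (Cell split_arr (Reg l_reg)) in
  Minus (Minus key (Cell half_arr key)) (Cell half_arr key).

Definition collect (bit : nat) : com :=
  SetReg l_reg (Const 0) ;;
  for_loop l_reg (Reg nsplit_reg)
    (If (Eq key_bit (Const bit))
      (SetCell tmp_arr (Reg y_reg) (Cell split_arr (Reg l_reg)) ;; incr y_reg) Skip).

(** Starting from [n], [g_reg] is halved along with the keys and reaches 0 when all bits that a
    colour can have are processed. *)
Definition sort_classes : com :=
  SetReg l_reg (Const 0) ;;
  for_loop l_reg (Reg nsplit_reg)
    (SetCell key_arr (Cell split_arr (Reg l_reg)) (Cell split_arr (Reg l_reg))) ;;
  SetReg g_reg (Reg n_reg) ;;
  While (Lt (Const 0) (Reg g_reg))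
    (SetReg y_reg (Const 0) ;; collect 0 ;; collect 1 ;;
     SetReg l_reg (Const 0) ;;
     for_loop l_reg (Reg nsplit_reg)
       (SetReg c_reg (Cell tmp_arr (Reg l_reg)) ;;
        SetCell split_arr (Reg l_reg) (Reg c_reg) ;;
        SetCell key_arr (Reg c_reg) (Cell half_arr (Cell key_arr (Reg c_reg)))) ;;
     SetReg g_reg (Cell half_arr (Reg g_reg))).

(** The last vertex of the old class fills the gap left by the moved one. Every colour owns a block
    of [n] cells, so a class can grow in constant time without relocation. *)
Definition move : com :=
  SetCell end_arr (Reg c_reg) (Minus (Cell end_arr (Reg c_reg)) (Const 1)) ;;
  SetReg x_reg (Cell elt_arr (Cell end_arr (Reg c_reg))) ;;
  SetCell elt_arr (Cell pos_arr (Reg w_reg)) (Reg x_reg) ;;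
  SetCell pos_arr (Reg x_reg) (Cell pos_arr (Reg w_reg)) ;;
  SetCell elt_arr (Cell end_arr (Reg t_reg)) (Reg w_reg) ;;
  SetCell pos_arr (Reg w_reg) (Cell end_arr (Reg t_reg)) ;;
  SetCell end_arr (Reg t_reg) (Plus (Cell end_arr (Reg t_reg)) (Const 1)) ;;
  SetCell col_arr (Reg w_reg) (Reg t_reg).

Definition count_degrees : com :=
  SetCell cnt_arr (Const 0)
    (Minus (Cell end_arr (Reg c_reg)) (Cell tend_arr (Reg c_reg))) ;;
  SetReg top_reg (Const 0) ;;
  SetReg q_reg (Cell base_arr (Reg c_reg)) ;;
  for_loop q_reg (Cell tend_arr (Reg c_reg))
    (SetReg i_reg (Cell deg_arr (Cell telt_arr (Reg q_reg))) ;;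
     SetCell cnt_arr (Reg i_reg) (Plus (Cell cnt_arr (Reg i_reg)) (Const 1)) ;;
     If (Lt (Reg top_reg) (Reg i_reg)) (SetReg top_reg (Reg i_reg)) Skip).

Definition find_heaviest : com :=
  SetReg b_reg (Const 0) ;;
  SetReg i_reg (Const 0) ;;
  for_loop i_reg (Plus (Reg top_reg) (Const 1))
    (If (Lt (Cell cnt_arr (Reg b_reg)) (Cell cnt_arr (Reg i_reg)))
      (SetReg b_reg (Reg i_reg)) Skip).

Definition name_parts : com :=
  SetReg i_reg (Const 0) ;;
  for_loop i_reg (Plus (Reg top_reg) (Const 1))
    (If (Eq (Reg i_reg) (Reg b_reg)) (SetCell name_arr (Reg i_reg) (Reg c_reg))
      (If (Lt (Const 0) (Cell cnt_arr (Reg i_reg)))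
        (incr k_reg ;; SetCell name_arr (Reg i_reg) (Reg k_reg)) Skip) ;;
     SetCell cnt_arr (Reg i_reg) (Const 0)).

Definition copy_loop (elt limit : nat) : com :=
  for_loop q_reg (Cell limit (Reg c_reg))
    (SetCell mov_arr (Reg y_reg) (Cell elt (Reg q_reg)) ;; incr y_reg).

(* The untouched vertices are moved only if they are not a heaviest part, so
   that they are at most as many as the touched ones. *)
Definition list_movable : com :=
  SetReg y_reg (Const 0) ;;
  SetReg q_reg (Cell base_arr (Reg c_reg)) ;;
  If (Eq (Reg b_reg) (Const 0))
    (copy_loop telt_arr tend_arr) (copy_loop elt_arr end_arr).

Definition move_parts : com :=
  SetReg l_reg (Const 0) ;;
  for_loop l_reg (Reg y_reg)
    (SetReg w_reg (Cell mov_arr (Reg l_reg)) ;;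
     SetReg t_reg (Cell name_arr (Cell deg_arr (Reg w_reg))) ;;
     If (Eq (Reg t_reg) (Reg c_reg)) Skip move).

Definition split_com : com :=
  count_degrees ;; find_heaviest ;; name_parts ;; list_movable ;; move_parts.

Definition split_all : com :=
  SetReg j_reg (Const 0) ;;
  for_loop j_reg (Reg nsplit_reg)
    (SetReg c_reg (Cell split_arr (Reg j_reg)) ;; split_com).

Definition reset : com :=
  SetReg j_reg (Const 0) ;;
  for_loop j_reg (Reg ntouched_reg)
    (SetReg c_reg (Cell touched_arr (Reg j_reg)) ;;
     SetReg q_reg (Cell base_arr (Reg c_reg)) ;;
     for_loop q_reg (Cell tend_arr (Reg c_reg))
       (SetCell deg_arr (Cell telt_arr (Reg q_reg)) (Const 0)) ;;
     SetCell tend_arr (Reg c_reg) (Cell base_arr (Reg c_reg))).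

Definition round_com : com :=
  incr p_reg ;; scan_class ;; select ;; sort_classes ;; split_all ;; reset.

Definition refine_com : com := While (Lt (Reg p_reg) (Reg k_reg)) round_com.

(** A singleton class remains a singleton, so the cursor never has to return and its moves cost O(n)
    over all choices together. *)
Definition choose_com : com :=
  While (Lt (Minus (Cell end_arr (Cell col_arr (Reg cursor_reg)))
                   (Cell base_arr (Cell col_arr (Reg cursor_reg)))) (Const 2))
    (incr cursor_reg) ;;
  incr k_reg ;;
  SetReg w_reg (Reg cursor_reg) ;;
  SetReg c_reg (Cell col_arr (Reg w_reg)) ;;
  SetReg t_reg (Reg k_reg) ;;
  move.

Definition build_lists : com :=
  for_loop e_reg (Reg m_reg)
    (SetReg x_reg (Cell tgt_arr (Reg e_reg)) ;;
     SetCell next_arr (Reg e_reg) (Cell head_arr (Reg x_reg)) ;;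
     SetCell head_arr (Reg x_reg) (Plus (Reg e_reg) (Const 1))).

(** Products are formed by repeated addition, and halves by the recursion from [i] to [i + 2]. *)
Definition build_tables : com :=
  for_loop i_reg (Reg n_reg)
    (SetReg x_reg (Plus (Reg i_reg) (Const 1)) ;;
     SetCell base_arr (Reg x_reg) (Plus (Cell base_arr (Reg i_reg)) (Reg n_reg)) ;;
     SetCell end_arr (Reg x_reg) (Cell base_arr (Reg x_reg)) ;;
     SetCell tend_arr (Reg x_reg) (Cell base_arr (Reg x_reg)) ;;
     SetCell half_arr (Plus (Reg x_reg) (Const 1))
       (Plus (Cell half_arr (Reg i_reg)) (Const 1))).

Definition build_class : com :=
  for_loop q_reg (Reg n_reg)
    (SetCell col_arr (Reg q_reg) (Const 1) ;;
     SetReg x_reg (Cell end_arr (Const 1)) ;;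
     SetCell elt_arr (Reg x_reg) (Reg q_reg) ;;
     SetCell pos_arr (Reg q_reg) (Reg x_reg) ;;
     SetCell end_arr (Const 1) (Plus (Reg x_reg) (Const 1))).

Definition setup_com : com :=
  build_lists ;; build_tables ;; build_class ;;
  If (Lt (Const 0) (Reg n_reg)) (SetReg k_reg (Const 1)) Skip.

Definition init_com : com := setup_com ;; refine_com.

(** * Representation of the colour classes *)

(* Locked, so that [simpl] does not unfold it at the limits [0] and [hi.+1]. *)
Fact seg_key : unit. Proof. exact: tt. Qed.

Definition seg (A : nat -> nat) (lo hi : nat) : seq nat :=
  locked_with seg_key [seq A p | p <- iota lo (hi - lo)].

Lemma segE A lo hi : seg A lo hi = [seq A p | p <- iota lo (hi - lo)].
Proof. by rewrite /seg unlock. Qed.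

Lemma segS A lo hi : lo <= hi -> seg A lo hi.+1 = rcons (seg A lo hi) (A hi).
Proof.
by move=> le; rewrite !segE subSn // -addn1 iotaD map_cat /= subnKC // cats1.
Qed.

Lemma seg_nil A lo : seg A lo lo = [::].
Proof. by rewrite segE subnn. Qed.

Lemma size_seg A lo hi : size (seg A lo hi) = hi - lo.
Proof. by rewrite segE size_map size_iota. Qed.

Lemma eq_seg A B lo hi :
  (forall p, lo <= p < hi -> A p = B p) -> seg A lo hi = seg B lo hi.
Proof.
move=> AB; rewrite !segE; apply/eq_in_map => p; rewrite mem_iota => H; apply: AB; lia.
Qed.

Lemma segP A lo hi x :
  reflect (exists2 p, lo <= p < hi & A p = x) (x \in seg A lo hi).
Proof.
rewrite segE; apply: (iffP mapP) => [[p + ->] | [p H <-]].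
  by rewrite mem_iota => H; exists p => //; lia.
by exists p => //; rewrite mem_iota; lia.
Qed.

Lemma seg_rcons A B lo hi x :
  lo <= hi -> (forall p, lo <= p < hi -> B p = A p) -> B hi = x ->
  seg B lo hi.+1 = rcons (seg A lo hi) x.
Proof. by move=> le eqB Bx; rewrite segS // Bx (eq_seg eqB). Qed.

Lemma sum_seg A lo hi (F : nat -> nat) :
  \sum_(lo <= p < hi) F (A p) = \sum_(x <- seg A lo hi) F x.
Proof. by rewrite segE big_map. Qed.

Section Vertices.

Variable n : nat.
Implicit Types (v w : 'I_n) (c p : nat) (P Q : pred 'I_n).

Definition vertices (P : pred 'I_n) : seq nat := [seq val v | v <- enum P].

Lemma vertices_uniq P : uniq (vertices P).
Proof. by rewrite map_inj_uniq ?enum_uniq //; apply: val_inj. Qed.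

Lemma mem_vertices P v : (val v \in vertices P) = P v.
Proof. by rewrite mem_map ?mem_enum //; apply: val_inj. Qed.

Lemma verticesP P x :
  reflect (exists2 v, P v & x = val v) (x \in vertices P).
Proof.
apply: (iffP mapP) => [[v + ->] | [v Pv ->]]; first by rewrite mem_enum; exists v.
by exists v; rewrite ?mem_enum.
Qed.

Lemma size_vertices P : size (vertices P) = #|[set v | P v]|.
Proof. by rewrite size_map -cardE cardsE. Qed.

Lemma sum_vertices P (F : nat -> nat) :
  \sum_(x <- vertices P) F x = \sum_(v | P v) F v.
Proof. by rewrite big_map big_enum. Qed.

Lemma vertices_add P Q w :
  ~~ P w -> (forall v, Q v = P v || (v == w)) ->
  perm_eq (vertices Q) (rcons (vertices P) (val w)).
Proof.
move=> Pw QP; apply: uniq_perm; first exact: vertices_uniq.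
  by rewrite rcons_uniq mem_vertices Pw vertices_uniq.
move=> x; rewrite mem_rcons inE; apply/verticesP/orP.
  case=> v; rewrite QP => /orP[Pv | /eqP->] ->; last by left.
  by right; rewrite mem_vertices.
case=> [/eqP-> | /verticesP[v Pv ->]]; first by exists w; rewrite ?QP ?eqxx ?orbT.
by exists v; rewrite ?QP ?Pv.
Qed.

Lemma eq_vertices P Q : P =1 Q -> vertices P = vertices Q.
Proof. by move=> PQ; rewrite /vertices (eq_enum PQ). Qed.

(* The vertices of colour [c] are stored in the cells [c * n], ..., [en c - 1]
   of [elt], and [pos] is the inverse of [elt]. *)
Definition classes_ok (col en elt pos : nat -> nat) : Prop :=
  (forall v, [/\ col v <= n, col v * n <= pos v < en (col v) & elt (pos v) = v]) /\
  forall c, c <= n -> en c = c * n + class_size (fun v : 'I_n => col v) c.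

Lemma class_size_le (a : 'I_n -> nat) c : class_size a c <= n.
Proof. by rewrite -[leqRHS]card_ord; apply: max_card. Qed.

Section Classes.

Variables col en elt pos : nat -> nat.
Hypothesis ok : classes_ok col en elt pos.

(** No cell of the block is vacant: the positions of the vertices of colour [c] are distinct, lie in
    the block, and are as many as its cells. *)
Lemma class_member c p :
  c <= n -> c * n <= p < en c -> exists v, [/\ elt p = v, col v = c & pos v = p].
Proof.
move=> c_le Hp; have [okv oke] := ok.
pose s1 := [seq pos v | v <- enum [pred v : 'I_n | col v == c]].
have s1_uniq : uniq s1.
  rewrite map_inj_in_uniq ?enum_uniq // => u v _ _ E; apply: val_inj.
  by have [_ _ Eu] := okv u; have [_ _ Ev] := okv v; rewrite /= -Eu E Ev.
have s12 : {subset s1 <= iota (c * n) (en c - c * n)}.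
  move=> x /mapP[v]; rewrite mem_enum inE => /eqP Ev ->.
  by have [_ + _] := okv v; rewrite Ev mem_iota; lia.
have [|_ E] := uniq_min_size s1_uniq s12.
  rewrite size_iota size_map -cardE oke // addKn /class_size.
  by apply: subset_leq_card; apply/subsetP=> v; rewrite !inE.
have : p \in s1 by rewrite E mem_iota; lia.
case/mapP=> v; rewrite mem_enum inE => /eqP Ev Ep; exists v.
by split=> //; rewrite Ep; have [] := okv v.
Qed.

Lemma class_seg c :
  c <= n -> perm_eq (seg elt (c * n) (en c)) (vertices (fun v => col v == c)).
Proof.
move=> c_le; apply: uniq_perm; last first.
- move=> x; apply/segP/verticesP => [[p Hp <-] | [v /eqP Ev ->]].
    by have [v [Ev Cv _]] := class_member c_le Hp; exists v; rewrite ?Cv.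
  have [okv _] := ok; exists (pos v); last by have [] := okv v.
  by have [_ + _] := okv v; rewrite Ev.
- exact: vertices_uniq.
- rewrite segE map_inj_in_uniq ?iota_uniq // => p q; rewrite !mem_iota => Hp Hq E.
  have [|v [Ev _ <-]] := @class_member c p c_le; first by lia.
  have [|w [Ew _ <-]] := @class_member c q c_le; first by lia.
  by congr (pos _); congr val; apply: val_inj; rewrite /= -Ev -Ew.
Qed.

End Classes.

End Vertices.

(** * Scanning the refining class *)

Section Program.

Variables (n : nat) (G : rel 'I_n) (es : seq ('I_n * 'I_n)).
Hypothesis es_G : edge_list G es.
Implicit Types (s : memory) (v w x : 'I_n) (L : seq 'I_n).

(* Pointers into the edge list are shifted by one, and 0 ends a list. *)
Fixpoint in_list (src next : nat -> nat) (e : nat) (L : seq 'I_n) : Prop :=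
  if L is w :: L' then
    [/\ 0 < e, src (e - 1) = w & in_list src next (next (e - 1)) L']
  else e = 0.

(** Reversed because [build_lists] pushes each arc at the front of its list. *)
Definition in_nbrs x : seq 'I_n := rev [seq e.1 | e <- es & e.2 == x].

(** The data that stay fixed once the setup is done. *)
Definition static s : Prop :=
  [/\ reg s n_reg = n,
      forall x, in_list (arr s src_arr) (arr s next_arr) (arr s head_arr x) (in_nbrs x),
      forall c, c <= n -> arr s base_arr c = c * n &
      forall i, i <= n -> arr s half_arr i = i./2].

Lemma static_frame c s s' :
  n_reg \notin written_regs c ->
  all [pred a | a \notin written_arrs c] [:: src_arr; head_arr; next_arr; base_arr; half_arr] ->
  frame c s s' -> static s -> static s'.
Proof.
move=> r0 /and5P[a0 a3 a4 a5 /andP[a16 _]] [Fr Fa]; rewrite /static.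
by rewrite !(Fr _ r0) (Fa _ a0) (Fa _ a3) (Fa _ a4) (Fa _ a5) (Fa _ a16).
Qed.

(** [L] lists the sources of the arcs scanned so far, with multiplicity. *)
Definition scan_inv L s : Prop :=
  [/\ forall v, arr s deg_arr v = count_mem v L,
      forall c, c <= n -> c * n <= arr s tend_arr c /\
        perm_eq (seg (arr s telt_arr) (c * n) (arr s tend_arr c))
          (vertices (fun v : 'I_n => (arr s col_arr v == c) && (v \in L))),
      uniq (seg (arr s touched_arr) 0 (reg s ntouched_reg)) &
      forall c, (c \in seg (arr s touched_arr) 0 (reg s ntouched_reg)) =
        (c <= n) && (c * n < arr s tend_arr c)].

Lemma scan_inv_tend L s c :
  scan_inv L s -> c <= n ->
  arr s tend_arr c = c * n + #|[set v : 'I_n | (arr s col_arr v == c) && (v \in L)]|.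
Proof.
move=> [_ tl _ _] c_le; have [le] := tl c c_le.
by move/perm_size; rewrite size_seg size_vertices => <-; rewrite subnKC.
Qed.

Lemma scan_vertexP L s w :
  static s -> (forall v, arr s col_arr v <= n) -> reg s w_reg = w -> scan_inv L s ->
  run scan_vertex s 50 (scan_inv (rcons L w)).
Proof.
move=> [_ _ base _] col_le Ew inv; have tendE := scan_inv_tend inv.
have [degE tlE tc_uniq tcE] := inv.
have countE v : count_mem v (rcons L w) = count_mem v L + (v == w).
  by rewrite -cats1 count_cat /= addn0 eq_sym.
have wordE v : (v == w :> nat) = (v == w) by [].
apply: run_straight => //; rewrite /= Ew !addn1.
have deg' v : (if v == w :> nat then (arr s deg_arr w).+1 else arr s deg_arr v) =
    count_mem v (rcons L w).
  by rewrite countE -degE wordE; case: eqP => [->|] /=; rewrite ?addn0 ?addn1.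
have [Lw | Lw] := boolP (w \in L).
  have -> : (arr s deg_arr w == 0) = false.
    by rewrite degE; apply/negP => /eqP/count_memPn; rewrite Lw.
  split=> //= c c_le.
  have [le tl] := tlE c c_le; split=> //.
  rewrite (eq_vertices (Q := fun v : 'I_n => (arr s col_arr v == c) && (v \in L))) //.
  by move=> v; rewrite mem_rcons inE; have [-> | //] := eqVneq v w; rewrite Lw.
have -> : arr s deg_arr w == 0 by rewrite degE; apply/eqP/count_memPn.
set c := arr s col_arr w; have c_le : c <= n := col_le w.
have size_lt c' : c' <= n -> arr s tend_arr c' <= c' * n + n.
  move=> c'_le; rewrite tendE // leq_add2l -[leqRHS]card_ord; exact: max_card.
(* As [w] is not listed yet, the block of [c] has a free cell, and writing there disturbs no other
   block. *)
have size_ltc : arr s tend_arr c < c * n + n.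
  rewrite tendE // ltn_add2l -[ltnRHS]card_ord; apply: proper_card.
  by apply/properP; split; [apply/subsetP | exists w; rewrite ?inE ?(negbTE Lw) ?andbF].
have [le_c tl_c] := tlE c c_le.
have tl' c' : c' <= n ->
    c' * n <= (if c' == c then (arr s tend_arr c).+1 else arr s tend_arr c') /\
    perm_eq (seg (fun p => if p == arr s tend_arr c then w : nat else arr s telt_arr p)
                 (c' * n) (if c' == c then (arr s tend_arr c).+1 else arr s tend_arr c'))
      (vertices (fun v : 'I_n => (arr s col_arr v == c') && (v \in rcons L w))).
  move=> c'_le; have [-> | ne] := eqVneq c' c.
    split; first by apply: leq_trans le_c _.
    rewrite (@seg_rcons (arr s telt_arr) _ _ _ w) ?eqxx //; last first.
      by move=> p Hp; case: eqP => //; lia.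
    rewrite perm_sym; pose P := fun v : 'I_n => (arr s col_arr v == c) && (v \in L).
    apply: (perm_trans (vertices_add (P := P) (w := w) _ _)); rewrite /P.
    - by rewrite (negbTE Lw) andbF.
    - move=> v; rewrite mem_rcons inE; have [-> | _] := eqVneq v w.
        by rewrite eqxx orbT.
      by rewrite orbF.
    by rewrite -!cats1 perm_cat2r perm_sym.
  have [le tl] := tlE c' c'_le; split=> //.
  rewrite (@eq_seg _ (arr s telt_arr)); last first.
    move=> p Hp; case: eqP => // Ep; have := size_lt c' c'_le.
    by move: ne; rewrite neq_ltn => /orP[]; nia.
  rewrite (eq_vertices (Q := fun v : 'I_n => (arr s col_arr v == c') && (v \in L))) //.
  move=> v; rewrite mem_rcons inE; have [-> | //] := eqVneq v w.
  by rewrite -/c eq_sym (negbTE ne).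
rewrite base //; case: eqP => [Ec | nEc]; rewrite /scan_inv /=.
  split=> //.
  - rewrite (@seg_rcons (arr s touched_arr) _ _ _ c) ?eqxx // => [|p].
      by rewrite rcons_uniq tc_uniq tcE Ec ltnn andbF.
    by case: eqP => //; lia.
  - move=> c'; rewrite (@seg_rcons (arr s touched_arr) _ _ _ c) ?eqxx // => [|p].
      rewrite mem_rcons inE tcE; case: eqP => [-> | //].
      by rewrite c_le Ec ltnS leqnn.
    by case: eqP => //; lia.
split=> // c'; rewrite tcE; case: eqP => [-> | //].
by rewrite c_le ltnS le_c ltn_neqAle le_c andbT; case: eqP => // E; case: nEc.
Qed.

Lemma scan_listP L l s :
  static s -> (forall v, arr s col_arr v <= n) ->
  in_list (arr s src_arr) (arr s next_arr) (reg s e_reg) l -> scan_inv L s ->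
  run scan_list s (80 * size l + 10) (scan_inv (L ++ l)).
Proof.
elim: l L s => [|w l IH] L s st col_le /=.
  by move=> Ee inv; apply: run_while_exit => /=; rewrite ?Ee ?cats0 //; lia.
case=> e_gt0 Ew tail_l inv.
apply: (@run_while_iter _ _ _ 70 (80 * size l + 10)) => //=; last by lia.
apply: (@run_seq _ _ _ 10 58) => //; apply: run_straight => //=.
set s1 := set_reg s _ _.
have run1 : run scan_vertex s1 50 (scan_inv (rcons L w)) by apply: scan_vertexP.
apply: (@run_seq _ _ _ 50 6) => //; apply: (run_weaken run1) => // s2 F inv2.
have st2 : static s2 := static_frame (c := scan_vertex) isT isT F st.
have [Fr Fa] := F.
apply: run_straight => //=; rewrite -cat_rcons; apply: IH => //=.
- by move=> v; rewrite (Fa col_arr isT); apply: col_le.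
- by rewrite (Fa src_arr isT) (Fa next_arr isT) (Fr e_reg isT).
Qed.

Lemma scan_inv0 s s' :
  (forall v, arr s deg_arr v = 0) -> (forall c, c <= n -> arr s tend_arr c = c * n) ->
  arr s' deg_arr = arr s deg_arr -> arr s' tend_arr = arr s tend_arr ->
  reg s' ntouched_reg = 0 -> scan_inv [::] s'.
Proof.
move=> deg0 tend0 Ed Et E0; rewrite /scan_inv Ed Et E0 seg_nil; split=> // [c c_le | c].
  rewrite tend0 // seg_nil leqnn; split=> //.
  rewrite (eq_vertices (Q := pred0)); last by move=> v; rewrite andbF.
  by rewrite /vertices enum0.
by rewrite in_nil; case: (leqP c n) => //= c_le; rewrite tend0 // ltnn.
Qed.

Definition wt v : nat := (size (in_nbrs v)).+1.

Lemma in_nbrs_count x v : count_mem v (in_nbrs x) = G v x.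
Proof.
have [es_uniq es_mem] := es_G.
have in_uniq : uniq (in_nbrs x).
  rewrite /in_nbrs rev_uniq map_inj_in_uniq ?filter_uniq //.
  move=> [u1 u2] [v1 v2]; rewrite !mem_filter /= => /andP[/eqP-> _] /andP[/eqP-> _] ->.
  by [].
rewrite count_uniq_mem // /in_nbrs mem_rev -es_mem; congr nat_of_bool.
apply/mapP/idP => [[[u1 u2]] | Hvx]; last by exists (v, x); rewrite ?mem_filter /= ?eqxx.
by rewrite mem_filter /= => /andP[/eqP-> H] ->.
Qed.

Lemma scan_classP s a r :
  static s -> (forall v, arr s col_arr v = a v) -> 
  classes_ok n (arr s col_arr) (arr s end_arr) (arr s elt_arr) (arr s pos_arr) ->
  (forall v, arr s deg_arr v = 0) -> (forall c, c <= n -> arr s tend_arr c = c * n) ->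
  reg s p_reg = r -> r <= n ->
  run scan_class s (100 * (1 + \sum_(v | a v == r) wt v)) (fun s' =>
    exists2 L, scan_inv L s' &
      (forall v, count_mem v L = out_count G a r v) /\
      size L <= \sum_(v | a v == r) wt v).
Proof.
move=> st colE ok deg0 tend0 Er r_le; have [okv okc] := ok.
set S := \sum_(v | _) _.
have [_ in_l baseE _] := st.
have le_r : r * n <= arr s end_arr r by rewrite okc // leq_addr.
apply: (@run_seq _ _ _ 2 (100 * (S) + 90)) => //; last by lia.
apply: run_straight => //=.
apply: (@run_seq _ _ _ 3 (100 * (S) + 80)) => //; last by lia.
apply: run_straight => //=; rewrite Er baseE //.
set s1 := set_reg _ _ _.
(* [elt_arr] holds numbers, so the lists of in-neighbours are extended to [nat] by the empty
   list. *)
pose in_n (x : nat) : seq 'I_n := oapp in_nbrs [::] (insub x).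
pose L q := flatten (map in_n (seg (arr s elt_arr) (r * n) q)).
have LS q : r * n <= q -> L q.+1 = L q ++ in_n (arr s elt_arr q).
  by move=> le_q; rewrite /L segS // -cats1 map_cat flatten_cat /= cats0.
have sumE (F : nat -> nat) : \sum_(r * n <= q < arr s end_arr r) F (arr s elt_arr q) =
    \sum_(v | a v == r) F v.
  rewrite sum_seg (perm_big _ (class_seg ok r_le)) /= sum_vertices.
  by apply: eq_bigl => v; rewrite colE.
have in_nE v : in_n v = in_nbrs v by rewrite /in_n valK.
set prog := for_loop _ _ _.
have run1 : run prog s1 (100 * (S) + 80)
    (fun s' => reg s' q_reg = arr s end_arr r /\ scan_inv (L (arr s end_arr r)) s').
  apply: (@run_for _ _ _ _ (r * n) _
    (fun q => 80 * size (in_n (arr s elt_arr q)) + 15) _ (fun q => scan_inv (L q))) => //.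
  - by move=> s2 [Fr Fa] /=; rewrite Fa // Fr //= Er.
  - by rewrite /L seg_nil; apply: scan_inv0 deg0 tend0 _ _ _.
  - move=> q s2 Hq Eq F inv; have st2 : static s2 := static_frame (c := prog) isT isT F st.
    have [Fr Fa] := F; have [v [Ev Cv Pv]] := class_member ok r_le Hq.
    apply: (@run_seq _ _ _ 4 (80 * size (in_n (arr s elt_arr q)) + 10)); last by lia.
    apply: run_straight => //=; rewrite Eq (Fa elt_arr isT) /= Ev in_nE.
    apply: (@run_weaken _ _ (80 * size (in_nbrs v) + 10)
              _ (scan_inv (L q ++ in_nbrs v))) => //; last first.
      by move=> s3 _; rewrite LS; [rewrite Ev in_nE | lia].
    apply: scan_listP => //=; first by move=> w; rewrite (Fa col_arr isT); have [] := okv w.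
    by rewrite (Fa head_arr isT) (Fa src_arr isT) (Fa next_arr isT); apply: in_l.
  - rewrite (sumE (fun z => 80 * size (in_n z) + 15 + 2 + 9)) /= -addnA leq_add //.
    rewrite big_distrr /=; apply: leq_sum => v _; rewrite in_nE /wt; lia.
apply: (run_weaken run1) => // s' _ [_ inv]; exists (L (arr s end_arr r)) => //; split.
  (* A vertex occurs in the list once for each of its out-neighbours in the refining class. *)
  move=> v; rewrite /L count_flatten -map_comp sumnE big_map.
  rewrite -(sum_seg _ _ _ (fun z => count_mem v (in_n z))).
  rewrite (sumE (fun z => count_mem v (in_n z))) /out_count -sum1dep_card.
  rewrite [RHS]big_mkcond [LHS]big_mkcond /=; apply: eq_bigr => x _.
  by rewrite in_nE in_nbrs_count andbC; case: eqP => // _; case: G.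
rewrite /L size_flatten /shape -map_comp sumnE big_map.
rewrite -(sum_seg _ _ _ (fun z => size (in_n z))) (sumE (fun z => size (in_n z))).
by apply: leq_sum => v _; rewrite in_nE.
Qed.

End Program.

(** * Selecting the classes that have to be split *)

Section Select.

Variables (n : nat) (es : seq ('I_n * 'I_n)).
Implicit Types (s : memory) (a d : 'I_n -> nat) (v : 'I_n) (c k : nat).

(** This speaks of the colouring [a] at the beginning of the round and not of [col_arr], and so it
    persists while classes are being split. *)
Definition touched_ok a d s : Prop :=
  [/\ forall v, arr s deg_arr v = d v,
      forall c, c <= n -> c * n <= arr s tend_arr c /\
        perm_eq (seg (arr s telt_arr) (c * n) (arr s tend_arr c))
          (vertices (fun v : 'I_n => (a v == c) && (0 < d v))),
      uniq (seg (arr s touched_arr) 0 (reg s ntouched_reg)) &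
      forall c, (c \in seg (arr s touched_arr) 0 (reg s ntouched_reg)) =
        (c <= n) && (c * n < arr s tend_arr c)].

Lemma scan_inv_touched a d L s :
  (forall v, arr s col_arr v = a v) -> (forall v, count_mem v L = d v) ->
  scan_inv L s -> touched_ok a d s.
Proof.
move=> colE countE [degE tl tc_uniq tc]; split=> // [v | c c_le]; first by rewrite degE.
have [le perm] := tl c c_le; split=> //.
by rewrite (eq_vertices (Q := fun v : 'I_n => (arr s col_arr v == c) && (v \in L))) //
  => v; rewrite colE -countE -has_count has_pred1.
Qed.

Section Touched.

Variables (a d : 'I_n -> nat) (s : memory).
Hypothesis tok : touched_ok a d s.

Definition touched_size c : nat := #|[set v : 'I_n | (a v == c) && (0 < d v)]|.

Lemma tendE c : c <= n -> arr s tend_arr c = c * n + touched_size c.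
Proof.
move=> c_le; have [_ /(_ c c_le)[le]] := tok.
by move/perm_size; rewrite size_seg size_vertices /touched_size => <- _ _; rewrite subnKC.
Qed.

Lemma touched_member c q :
  c <= n -> c * n <= q < arr s tend_arr c ->
  exists v, [/\ arr s telt_arr q = v, a v = c & 0 < d v].
Proof.
move=> c_le Hq; have [_ /(_ c c_le)[_ /perm_mem tl] _ _] := tok.
have : arr s telt_arr q \in seg (arr s telt_arr) (c * n) (arr s tend_arr c).
  by apply/segP; exists q.
by rewrite tl => /verticesP[v /andP[/eqP Ev dv] ->]; exists v.
Qed.

Lemma touchedP c :
  reflect (c <= n /\ exists2 v, a v = c & 0 < d v)
    (c \in seg (arr s touched_arr) 0 (reg s ntouched_reg)).
Proof.
have [_ _ _ ->] := tok; apply: (iffP andP) => [[c_le] | [c_le [v Ev dv]]].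
  rewrite tendE // -[ltnLHS]addn0 ltn_add2l => /card_gt0P[v].
  by rewrite inE => /andP[/eqP Ev dv]; split=> //; exists v.
split=> //; rewrite tendE // -[ltnLHS]addn0 ltn_add2l; apply/card_gt0P; exists v.
by rewrite inE Ev eqxx.
Qed.

Lemma touched_size_le c : touched_size c <= \sum_(v | a v == c) d v.
Proof.
rewrite /touched_size -sum1dep_card big_mkcond [leqRHS]big_mkcond.
by apply: leq_sum => v _; case: eqP => //= _; case: (d v).
Qed.

Lemma sum_classes_le (r : seq nat) (F : 'I_n -> nat) :
  uniq r -> \sum_(c <- r) \sum_(v | a v == c) F v <= \sum_v F v.
Proof.
move=> r_uniq; rewrite (exchange_big_dep predT) //=; apply: leq_sum => v _.
rewrite big_const_seq iter_addn_0 -[leqRHS]muln1 leq_mul2l.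
rewrite (@eq_count _ (eq_op (a v)) (pred1 (a v))) ?count_uniq_mem ?leq_b1 ?orbT // => c; exact: eq_sym.
Qed.

(** Charges the work on touched classes to the counted arcs. With [F] constantly 1 it bounds the
    number of touched classes. *)
Lemma sum_ntouched (F : nat -> nat) :
  (forall c, 0 < touched_size c -> F c <= \sum_(v | a v == c) d v) ->
  \sum_(0 <= j < reg s ntouched_reg) F (arr s touched_arr j) <= \sum_v d v.
Proof.
move=> F_le; rewrite (sum_seg _ _ _ F); have [_ _ tc_uniq _] := tok.
apply: leq_trans (sum_classes_le _ tc_uniq).
rewrite big_seq [leqRHS]big_seq; apply: leq_sum => c /touchedP[_ [v Ev dv]].
by apply: F_le; apply/card_gt0P; exists v; rewrite inE Ev eqxx.
Qed.

Lemma splits_touched c :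
  (forall v, d v <= #|'I_n|) -> splits a d c -> exists2 v, a v = c & 0 < d v.
Proof.
move=> d_le /(splitsP _ _ d_le)[u [v [Eu Ev ne]]].
have [Du | Du] := posnP (d u); last by exists u.
by exists v => //; rewrite Du in ne; case: (d v) ne.
Qed.

End Touched.

(** Comparing with the first touched vertex suffices: an untouched vertex differs from it by its
    count 0, and of two vertices with different counts at least one differs from it. *)
Lemma splits_flag a d s c :
  touched_ok a d s -> (forall v, d v <= #|'I_n|) ->
  arr s end_arr c = c * n + class_size a c ->
  c \in seg (arr s touched_arr) 0 (reg s ntouched_reg) ->
  (arr s tend_arr c < arr s end_arr c) ||
    has (fun z => arr s deg_arr z != arr s deg_arr (arr s telt_arr (c * n)))
      (seg (arr s telt_arr) (c * n) (arr s tend_arr c)) = splits a d c.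
Proof.
move=> tok d_le endE /(touchedP tok)[c_le [w Ew dw]].
have [degE tl _ _] := tok; have [_ /perm_mem tl_c] := tl c c_le.
have tsize : 0 < touched_size a d c by apply/card_gt0P; exists w; rewrite inE Ew eqxx.
have Hc : c * n <= c * n < arr s tend_arr c by rewrite (tendE tok) //; lia.
have [x [Ex Cx dx]] := touched_member tok c_le Hc.
rewrite Ex (tendE tok) // endE ltn_add2l -(tendE tok) //.
apply/orP/(splitsP _ _ d_le) => [[lt | /hasP[z]] | [u [v [Eu Ev ne]]]].
- have [v] : exists v, v \in [set v | a v == c] :\: [set v | (a v == c) && (0 < d v)].
    apply/set0Pn; rewrite -card_gt0 cardsDS ?subn_gt0 //.
    by apply/subsetP=> v; rewrite !inE => /andP[].
  rewrite !inE => /andP[+ /eqP Ev]; rewrite Ev eqxx /= -eqn0Ngt => /eqP Dv.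
  by exists v, x; split; rewrite ?Dv // eq_sym -lt0n.
- by rewrite tl_c => /verticesP[v /andP[/eqP Ev dv] ->]; rewrite !degE; exists v, x.
case: ltnP => [_ | ge]; [by left | right].
have all_touched y : a y = c -> 0 < d y.
  move=> Ey; have /eqP/setP/(_ y) : [set v | (a v == c) && (0 < d v)] == [set v | a v == c].
    rewrite eqEcard ge andbT.
    by apply/subsetP=> v'; rewrite !inE => /andP[].
  by rewrite !inE Ey eqxx.
have in_seg y : a y = c -> val y \in seg (arr s telt_arr) (c * n) (arr s tend_arr c).
  by move=> Ey; rewrite tl_c mem_vertices Ey eqxx all_touched.
have [Dux | Dux] := eqVneq (d u) (d x).
  by apply/hasP; exists (val v); rewrite ?in_seg //= !degE -Dux eq_sym.
by apply/hasP; exists (val u); rewrite ?in_seg //= !degE.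
Qed.

Lemma selectP a d s k :
  static es s -> touched_ok a d s -> (forall v, d v <= #|'I_n|) ->
  onto a k -> k <= n ->
  (forall c, c <= n -> arr s end_arr c = c * n + class_size a c) ->
  run select s (200 * (1 + \sum_v d v)) (fun s' =>
    perm_eq (seg (arr s' split_arr) 0 (reg s' nsplit_reg))
      [seq c <- iota 1 k | splits a d c]).
Proof.
move=> [_ _ baseE _] tok d_le a_onto k_le endE; set D := \sum_v d v.
have [degE tl tc_uniq tcE] := tok.
have tcP j : j < reg s ntouched_reg ->
    arr s touched_arr j \in seg (arr s touched_arr) 0 (reg s ntouched_reg).
  by move=> lt; apply/segP; exists j.
have tc_le j : j < reg s ntouched_reg -> arr s touched_arr j <= n.
  by move/tcP; rewrite tcE => /andP[].
apply: (@run_seq _ _ _ 2 (200 * D + 190)) => //; last by lia.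
apply: run_straight => //=.
apply: (@run_seq _ _ _ 2 (200 * D + 180)) => //; last by lia.
apply: run_straight => //=; set s1 := set_reg _ _ _.
set prog := for_loop _ _ _.
pose sel j := [seq c <- seg (arr s touched_arr) 0 j | splits a d c].
pose cost j := 100 * touched_size a d (arr s touched_arr j) + 80.
have run1 : run prog s1 (200 * D + 180) (fun s' => reg s' j_reg = reg s ntouched_reg /\
    seg (arr s' split_arr) 0 (reg s' nsplit_reg) = sel (reg s ntouched_reg)).
  apply: (@run_for _ _ _ _ 0 _ cost _
    (fun j s' => seg (arr s' split_arr) 0 (reg s' nsplit_reg) = sel j)) => //.
  - by move=> s2 [Fr Fa] /=; rewrite (Fr ntouched_reg isT).
  - by rewrite /= /sel !seg_nil.
  - move=> j s2 /andP[_ lt_j] Ej [Fr Fa] sel2; set c := arr s touched_arr j.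
    have c_le := tc_le _ lt_j; rewrite -/c in c_le.
    apply: (@run_seq _ _ _ 3 (100 * touched_size a d c + 75)) => //; last first.
      by rewrite /cost -/c; lia.
    apply: run_straight => //=; rewrite Ej (Fa touched_arr isT) -/c.
    apply: (@run_seq _ _ _ 8 (100 * touched_size a d c + 65)) => //; last by lia.
    apply: run_straight => //=.
    rewrite (Fa tend_arr isT) (Fa end_arr isT) /=.
    rewrite -/c.
    set f0 := arr s end_arr c - arr s tend_arr c.
    apply: (@run_seq _ _ _ 3 (100 * touched_size a d c + 60)) => //; last by lia.
    apply: run_straight => //=; rewrite (Fa base_arr isT) /= baseE //.
    apply: (@run_seq _ _ _ 4 (100 * touched_size a d c + 50)) => //; last by lia.
    apply: run_straight => //=; rewrite (Fa deg_arr isT) (Fa telt_arr isT) /=.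
    set x := arr s deg_arr _; set s3 := set_reg _ _ _; set prog2 := for_loop _ _ _.
    pose fl hi := has (fun z => arr s deg_arr z != x) (seg (arr s telt_arr) (c * n) hi).
    have run2 : run prog2 s3 (100 * touched_size a d c + 20) (fun s' =>
        reg s' q_reg = arr s tend_arr c /\
        (0 < reg s' flag_reg) = (0 < f0) || fl (arr s tend_arr c)).
      apply: (@run_for _ _ _ _ (c * n) _ (fun=> 20) _
        (fun q s' => (0 < reg s' flag_reg) = (0 < f0) || fl q)) => //.
      + by have [] := tl c c_le.
      + by move=> s4 [Fr4 Fa4] /=; rewrite (Fa4 tend_arr isT) (Fr4 c_reg isT) /= (Fa tend_arr isT).
      + by rewrite /fl seg_nil /= orbF.
      + move=> q s4 /andP[ge_q lt_q] Eq4 [Fr4 Fa4] fl4; apply: run_straight => //=.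
        rewrite /fl segS // has_rcons Eq4 (Fa4 deg_arr isT) (Fa4 telt_arr isT).
        rewrite (Fr4 x_reg isT) /= (Fa deg_arr isT) (Fa telt_arr isT) /= fl4 -/x.
        by case: eqP => _ /=; rewrite ?orbT.
      + rewrite sum_nat_const_nat (tendE tok) // addKn /=; lia.
    apply: (@run_seq _ _ _ (100 * touched_size a d c + 20) 20) => //; last by lia.
    apply: (run_weaken run2) => // s4 [Fr4 Fa4] [_ fl4]; apply: run_straight => //=.
    have -> : sel j.+1 = if 0 < reg s4 flag_reg then rcons (sel j) c else sel j.
      rewrite fl4 /f0 subn_gt0 (splits_flag tok) ?endE ?tcP // /sel segS // filter_rcons.
      by [].
    rewrite (Fr4 nsplit_reg isT) (Fa4 split_arr isT) (Fr4 c_reg isT) /= addn1 -sel2.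
    case: (0 < _) => //.
    apply: (@seg_rcons (arr s2 split_arr)) => // [p /= Hp|]; last by rewrite /= eqxx.
    by case: eqP => //; lia.
  - have -> : \sum_(0 <= i < reg s ntouched_reg) (cost i + expr_cost (Reg ntouched_reg) + 9) =
        \sum_(0 <= i < reg s ntouched_reg)
          (fun c => 100 * touched_size a d c + 90) (arr s touched_arr i).
      by apply: eq_bigr => i _; rewrite /cost /=; lia.
    have : \sum_(0 <= i < reg s ntouched_reg) touched_size a d (arr s touched_arr i) <= D.
      by apply: (sum_ntouched tok) => c _; apply: touched_size_le.
    have : \sum_(0 <= i < reg s ntouched_reg) (fun=> 1) (arr s touched_arr i) <= D.
      apply: (sum_ntouched tok (F := fun=> 1)) => c c_gt0.
      exact: leq_trans c_gt0 (touched_size_le _ _ _).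
    rewrite big_split /= -big_distrr /= sum_nat_const_nat (sum_nat_const_nat _ _ 90).
    by set X := \sum_(_ <= _ < _) _; rewrite /=; lia.
apply: (run_weaken run1) => // s' _ [_ ->].
apply: uniq_perm; rewrite ?filter_uniq ?iota_uniq // => c.
rewrite !mem_filter mem_iota; case Sc: (splits a d c) => //=.
have [v Ev dv] := splits_touched d_le Sc.
have := onto_le v a_onto; rewrite Ev add1n ltnS => c_le; rewrite c_le.
apply/(touchedP tok); split; first by lia.
by exists v.
Qed.

End Select.

(** * Sorting the classes that have to be split *)

Section Sort.

Variables (n : nat) (es : seq ('I_n * 'I_n)).
Implicit Types (s : memory) (L : seq nat).

Lemma collectP bit s L key :
  bit <= 1 -> static es s -> seg (arr s split_arr) 0 (reg s nsplit_reg) = L ->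
  (forall c, c \in L -> arr s key_arr c = key c /\ key c <= n) ->
  run (collect bit) s (60 * (size L).+1) (fun s' =>
    seg (arr s' tmp_arr) 0 (reg s' y_reg) =
    seg (arr s tmp_arr) 0 (reg s y_reg) ++ [seq c <- L | odd (key c) == (bit == 1)]).
Proof.
move=> bit_le st segL keyE; have [_ _ _ halfE] := st.
have sizeL : size L = reg s nsplit_reg by rewrite -segL size_seg subn0.
apply: (@run_seq _ _ _ 2 (60 * size L + 40)) => //; last by lia.
apply: run_straight => //=; set s1 := set_reg _ _ _; set prog := for_loop _ _ _.
set X := seg _ _ _; pose L' j := seg (arr s split_arr) 0 j.
have run1 : run prog s1 (60 * size L + 40) (fun s' => reg s' l_reg = size L /\
    seg (arr s' tmp_arr) 0 (reg s' y_reg) =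
      X ++ [seq c <- L' (size L) | odd (key c) == (bit == 1)]).
  apply: (@run_for _ _ _ _ 0 _ (fun=> 30) _ (fun j s' =>
    seg (arr s' tmp_arr) 0 (reg s' y_reg) =
      X ++ [seq c <- L' j | odd (key c) == (bit == 1)])) => //.
  - by move=> s2 [Fr Fa] /=; rewrite (Fr nsplit_reg isT).
  - by rewrite /L' seg_nil cats0.
  - move=> j s2 /andP[_ lt_j] Ej [Fr Fa] E2; apply: run_straight => //=.
    rewrite /L' segS // filter_rcons -/(L' j) Ej.
    rewrite (Fa split_arr isT) (Fa key_arr isT) (Fa half_arr isT) /=.
    set c := arr s split_arr j.
    have [|Ek k_le] := keyE c.
      by rewrite -segL; apply/segP; exists j; rewrite // -sizeL.
    rewrite Ek halfE //.
    have -> : key c - (key c)./2 - (key c)./2 = odd (key c) by have := odd_double_half (key c); lia.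
    have -> : (odd (key c) == bit :> nat) = (odd (key c) == (bit == 1)).
      by case: (odd _); case: (bit) bit_le => [|[|]].
    case: (_ == (bit == 1)) => //=.
    rewrite addn1 (@seg_rcons (arr s2 tmp_arr) _ _ _ c) ?eqxx // => [|p].
      by rewrite E2 rcons_cat.
    by case: eqP => //; lia.
  - by rewrite sum_nat_const_nat /=; lia.
apply: (run_weaken run1) => // s' _ [_ ->].
by rewrite /L' sizeL segL.
Qed.

Definition bit_length (g : nat) : nat := if g is 0 then 0 else (trunc_log 2 g).+1.

Lemma bit_length_half g : 0 < g -> (bit_length g./2).+1 = bit_length g.
Proof.
case: g => [|[|g]] // _.
by rewrite {2}/bit_length trunc_log2S.
Qed.

Lemma sort_pass s L t :
  static es s -> seg (arr s split_arr) 0 (reg s nsplit_reg) = L -> uniq L ->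
  {in L, forall c, c <= n} ->
  {in L, forall c, arr s key_arr c = c %/ 2 ^ t} ->
  run (SetReg y_reg (Const 0) ;; collect 0 ;; collect 1 ;;
       SetReg l_reg (Const 0) ;;
       for_loop l_reg (Reg nsplit_reg)
         (SetReg c_reg (Cell tmp_arr (Reg l_reg)) ;;
          SetCell split_arr (Reg l_reg) (Reg c_reg) ;;
          SetCell key_arr (Reg c_reg) (Cell half_arr (Cell key_arr (Reg c_reg)))) ;;
       SetReg g_reg (Cell half_arr (Reg g_reg)))
    s (200 * (size L).+1) (fun s' => let L' :=
      [seq c <- L | ~~ odd (c %/ 2 ^ t)] ++ [seq c <- L | odd (c %/ 2 ^ t)] in
      [/\ seg (arr s' split_arr) 0 (reg s' nsplit_reg) = L',
          {in L', forall c, arr s' key_arr c = c %/ 2 ^ t.+1} &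
          reg s' g_reg = arr s half_arr (reg s g_reg)]).
Proof.
move=> st segL L_uniq L_le keyE; have [_ _ _ halfE] := st.
set L' := _ ++ _.
have perm : perm_eq L' L.
  rewrite /L' perm_catC; apply/permPl.
  exact: perm_filterC (fun c => odd (c %/ 2 ^ t)) L.
have sizeL : size L = reg s nsplit_reg by rewrite -segL size_seg subn0.
have sizeL' := perm_size perm.
have key_le c : c \in L -> c %/ 2 ^ t <= n.
  by move=> /L_le; apply: leq_trans; apply: leq_div.
apply: (@run_seq _ _ _ 2 (200 * size L + 190)) => //; last by lia.
apply: run_straight => //=; set s1 := set_reg _ _ _.
apply: (@run_seq _ _ _ (60 * (size L).+1) (140 * size L + 120)) => //; last by lia.
have run1 : run (collect 0) s1 (60 * (size L).+1) (fun s' =>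
    seg (arr s' tmp_arr) 0 (reg s' y_reg) = [seq c <- L | ~~ odd (c %/ 2 ^ t)]).
  apply: (run_weaken (@collectP 0 s1 L (fun c => c %/ 2 ^ t) _ _ _ _)) => //.
  - by move=> c Lc; rewrite /= keyE // key_le.
  - move=> s' _ ->; rewrite /= seg_nil /=.
    by apply: eq_filter => c; case: odd.
apply: (run_weaken run1) => // s2 F2 E2.
have [Fr2 Fa2] := F2; have st2 : static es s2 := static_frame (c := collect 0) isT isT F2 st.
apply: (@run_seq _ _ _ (60 * (size L).+1) (80 * size L + 50)) => //; last by lia.
have run2 : run (collect 1) s2 (60 * (size L).+1) (fun s' =>
    seg (arr s' tmp_arr) 0 (reg s' y_reg) = L').
  apply: (run_weaken (@collectP 1 s2 L (fun c => c %/ 2 ^ t) _ _ _ _)) => //.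
  - by rewrite (Fa2 split_arr isT) (Fr2 nsplit_reg isT).
  - by move=> c Lc; rewrite (Fa2 key_arr isT) /= keyE // key_le.
  - move=> s' _ ->; rewrite E2; congr (_ ++ _).
    by apply: eq_filter => c; case: odd.
apply: (run_weaken run2) => // s3 F3 E3.
have [Fr3 Fa3] := F3; have st3 : static es s3 := static_frame (c := collect 1) isT isT F3 st2.
have [_ _ _ halfE3] := st3.
apply: (@run_seq _ _ _ 2 (80 * size L + 45)) => //; last by lia.
apply: run_straight => //=; set s4 := set_reg _ _ _; set prog := for_loop _ _ _.
have y3 : reg s3 y_reg = size L by rewrite -sizeL' -E3 size_seg subn0.
rewrite y3 in E3.
have run3 : run prog s4 (80 * size L + 30) (fun s' => reg s' l_reg = size L /\
    seg (arr s' split_arr) 0 (size L) = seg (arr s3 tmp_arr) 0 (size L) /\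
    {in L, forall c, arr s' key_arr c =
      if c \in seg (arr s3 tmp_arr) 0 (size L) then c %/ 2 ^ t.+1 else c %/ 2 ^ t}).
  apply: (@run_for _ _ _ _ 0 _ (fun=> 30) _ (fun j s' =>
    seg (arr s' split_arr) 0 j = seg (arr s3 tmp_arr) 0 j /\
    {in L, forall c, arr s' key_arr c =
      if c \in seg (arr s3 tmp_arr) 0 j then c %/ 2 ^ t.+1 else c %/ 2 ^ t})) => //.
  - by move=> s5 [Fr Fa] /=; rewrite (Fr nsplit_reg isT) /= (Fr3 nsplit_reg isT) (Fr2 nsplit_reg isT).
  - rewrite !seg_nil; split=> // c Lc.
    by rewrite /= (Fa3 key_arr isT) (Fa2 key_arr isT) /= keyE.
  - move=> j s5 /andP[_ lt_j] Ej [Fr Fa] [E5 K5]; apply: run_straight => //=.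
    rewrite Ej (Fa tmp_arr isT) (Fa half_arr isT) /=.
    set c := arr s3 tmp_arr j.
    have L'c : c \in L' by rewrite -E3; apply/segP; exists j.
    have Lc : c \in L by rewrite -(perm_mem perm).
    have segj : seg (arr s3 tmp_arr) 0 j.+1 = rcons (seg (arr s3 tmp_arr) 0 j) c.
      by rewrite segS.
    split.
      rewrite segj -E5; apply: seg_rcons; rewrite ?eqxx // => p Hp.
      by case: eqP => //; lia.
    (* Keys are stored by colour, so the absence of repetitions ensures that each key is halved only
       once in the pass. *)
    have c_notin : c \notin seg (arr s3 tmp_arr) 0 j.
      have : uniq (seg (arr s3 tmp_arr) 0 j.+1).
        have -> : seg (arr s3 tmp_arr) 0 j.+1 = take j.+1 L'.
          rewrite -E3 !segE -map_take take_iota !subn0.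
          by rewrite (minn_idPl _).
        by rewrite take_uniq // (perm_uniq perm).
      by rewrite segj rcons_uniq => /andP[].
    move=> z Lz; rewrite segj mem_rcons inE; have [-> | ne] := eqVneq z c; last exact: K5.
    rewrite /= K5 // (negbTE c_notin) halfE3 ?key_le // -divn2 -divnMA -expnSr.
    by [].
  - by rewrite sum_nat_const_nat /=; lia.
apply: (@run_seq _ _ _ (80 * size L + 30) 10) => //; last by lia.
apply: (run_weaken run3) => // s5 [Fr5 Fa5] [_ [E5 K5]]; apply: run_straight => //=.
split.
- rewrite (Fr5 nsplit_reg isT) /= (Fr3 nsplit_reg isT) (Fr2 nsplit_reg isT) /= -sizeL.
  by rewrite E5.
- move=> c L'c; rewrite K5 -?(perm_mem perm) //.
  by rewrite E3 L'c.
- rewrite (Fa5 half_arr isT) (Fr5 g_reg isT) /= (Fa3 half_arr isT) (Fr3 g_reg isT).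
  by rewrite (Fa2 half_arr isT) (Fr2 g_reg isT).
Qed.

(** The residue modulo [2 ^ t.+1] is bit [t] times [2 ^ t] plus the residue modulo [2 ^ t]. The two
    filters keep the order by the smaller residue, and every entry with bit 0 precedes every entry
    with bit 1. *)
Lemma sorted_pass L t :
  sorted (fun c c' => c %% 2 ^ t <= c' %% 2 ^ t) L ->
  sorted (fun c c' => c %% 2 ^ t.+1 <= c' %% 2 ^ t.+1)
    ([seq c <- L | ~~ odd (c %/ 2 ^ t)] ++ [seq c <- L | odd (c %/ 2 ^ t)]).
Proof.
move=> L_sorted.
have modE c : c %% 2 ^ t.+1 = odd (c %/ 2 ^ t) * 2 ^ t + c %% 2 ^ t.
  have Ec := divn_eq c (2 ^ t); have Eq := odd_double_half (c %/ 2 ^ t).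
  rewrite {1}(_ : c = (c %/ 2 ^ t)./2 * 2 ^ t.+1 + (odd (c %/ 2 ^ t) * 2 ^ t + c %% 2 ^ t)).
    rewrite modnMDl modn_small // expnS.
    have : c %% 2 ^ t < 2 ^ t by rewrite ltn_pmod ?expn_gt0.
    by case: odd => /=; lia.
  by rewrite expnS {1}Ec -{1}Eq; nia.
have tr j : transitive (fun c c' => c %% 2 ^ j <= c' %% 2 ^ j).
  by move=> x y z; apply: leq_trans.
rewrite sorted_pairwise; last exact: tr.
have {}L_sorted : pairwise (fun c c' => c %% 2 ^ t <= c' %% 2 ^ t) L.
  by rewrite -sorted_pairwise; last exact: tr.
have lt_mod c : c %% 2 ^ t < 2 ^ t by rewrite ltn_pmod ?expn_gt0.
have pw (P : pred nat) (b : bool) : {in P, forall c, odd (c %/ 2 ^ t) = b} ->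
    pairwise (fun c c' => c %% 2 ^ t.+1 <= c' %% 2 ^ t.+1) [seq c <- L | P c].
  move=> Pb; apply: (@sub_in_pairwise _ P) (pairwise_filter P L_sorted).
    by move=> c c' Pc Pc'; rewrite !modE !Pb // leq_add2l.
  by apply/allP => c; rewrite mem_filter => /andP[].
rewrite pairwise_cat (pw _ false) ?(pw _ true) ?andbT //.
- apply/allrelP => c c'; rewrite !mem_filter => /andP[/negbTE Oc _] /andP[Oc' _].
  by rewrite !modE Oc Oc' /=; have := lt_mod c; lia.
- by move=> c /negbTE.
Qed.

Lemma sort_classesP s L :
  static es s -> seg (arr s split_arr) 0 (reg s nsplit_reg) = L -> uniq L ->
  {in L, forall c, c <= n} ->
  run sort_classes s (300 * (size L).+1 * (trunc_log 2 n).+2) (fun s' =>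
    seg (arr s' split_arr) 0 (reg s' nsplit_reg) = sort leq L).
Proof.
move=> st segL L_uniq L_le; have [Hn _ _ halfE] := st.
have sizeL : size L = reg s nsplit_reg by rewrite -segL size_seg subn0.
have bit_n : bit_length n <= (trunc_log 2 n).+1 by rewrite /bit_length; case: (n).
set T := 300 * _; apply: (@run_seq _ _ _ 2 (T * (trunc_log 2 n).+2 - 3)); last by nia.
apply: run_straight => //=; set s1 := set_reg _ _ _; set prog := for_loop _ _ _.
have run1 : run prog s1 (30 * size L + 30) (fun s' => reg s' l_reg = size L /\
    forall j, j < size L -> arr s' key_arr (arr s split_arr j) = arr s split_arr j).
  apply: (@run_for _ _ _ _ 0 _ (fun=> 10) _ (fun j s' =>
    forall i, i < j -> arr s' key_arr (arr s split_arr i) = arr s split_arr i)) => //.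
  - by move=> s2 [Fr Fa] /=; rewrite (Fr nsplit_reg isT).
  - move=> j s2 /andP[_ lt_j] Ej [Fr Fa] E2; apply: run_straight => //= i.
    rewrite ltnS leq_eqVlt Ej (Fa split_arr isT) /= => /orP[/eqP-> | lt_i].
      by rewrite eqxx.
    by case: eqP => // _; apply: E2.
  - by rewrite sum_nat_const_nat /=; lia.
apply: (@run_seq _ _ _ (30 * size L + 30) (T * (trunc_log 2 n).+1 + 20)); last by nia.
apply: (run_weaken run1) => // s2 F2 [_ key2].
have [Fr2 Fa2] := F2; have st2 : static es s2 := static_frame (c := prog) isT isT F2 st.
apply: (@run_seq _ _ _ 2 (T * (trunc_log 2 n).+1 + 10)) => //; last by lia.
apply: run_straight => //=; rewrite (Fr2 n_reg isT) /= Hn.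
(* After [t] passes the keys are shifted by [t] bits and the list is sorted by the lowest [t]
   bits. *)
apply: (@run_while _ _ _ _ (fun U s' => exists t L',
  [/\ perm_eq L' L, seg (arr s' split_arr) 0 (reg s' nsplit_reg) = L',
      {in L', forall c, arr s' key_arr c = c %/ 2 ^ t},
      sorted (fun c c' => c %% 2 ^ t <= c' %% 2 ^ t) L' &
      reg s' g_reg = n %/ 2 ^ t /\
      T * bit_length (n %/ 2 ^ t) + 10 <= U])).
- exists 0, L; split=> //=.
  + by rewrite (Fa2 split_arr isT) (Fr2 nsplit_reg isT).
  + move=> c; rewrite -{1}segL -sizeL => /segP[j Hj <-]; rewrite divn1; exact: key2.
  + by case: (L) => //= z L0; elim: L0 z => //= z' L0 IH z; rewrite !modn1 IH.
  + by rewrite divn1 leq_add2r leq_mul2l bit_n orbT.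
- move=> U s3 F3 [t [L' [perm segL' _ sorted_L' [Eg leU]]]] /=.
  rewrite Eg -eqn0Ngt => /eqP g0; split; first by lia.
  (* When [n] is exhausted, all colours are below [2 ^ t] and equal their residues. *)
  have lt_n : n < 2 ^ t by rewrite ltnNge -divn_gt0 ?expn_gt0 // g0.
  rewrite segL'; apply: (sorted_eq leq_trans anti_leq); last 1 first.
  + by rewrite (perm_trans perm) // perm_sym perm_sort.
  + have L'_lt c : c \in L' -> c < 2 ^ t.
      by rewrite (perm_mem perm) => /L_le; lia.
    apply: (@sub_in_sorted _ (mem L')) sorted_L'; last exact/allP.
    by move=> c c' /L'_lt lt_c /L'_lt lt_c'; rewrite !modn_small.
  + exact: sort_sorted leq_total _.
- move=> U s3 F3 [t [L' [perm segL' key3 sorted_L' [Eg leU]]]] /= g_gt0.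
  have [Fr3 Fa3] := F3.
  have st3 : static es s3 by apply: (static_frame _ _ F3).
  exists (200 * (size L').+1).
  apply: (run_weaken (@sort_pass s3 L' t st3 segL' _ _ key3)) => //.
  + by rewrite (perm_uniq perm).
  + by move=> c; rewrite (perm_mem perm); apply: L_le.
  move=> s4 _ [segL4 key4 Eg4]; exists (T * bit_length (n %/ 2 ^ t.+1) + 10).
    exists t.+1; eexists; split; [| exact: segL4 | exact: key4 | exact: sorted_pass |].
    * apply: perm_trans perm; rewrite perm_catC; apply/permPl.
      exact: perm_filterC (fun c => odd (c %/ 2 ^ t)) L'.
    * have [_ _ _ halfE3] := st3.
      by rewrite Eg4 Eg halfE3 ?leq_div // -divn2 -divnMA -expnSr.
  have := bit_length_half g_gt0; rewrite Eg -divn2 -divnMA -expnSr => E.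
  rewrite -E in leU; rewrite (perm_size perm).
  have : 200 * (size L).+1 + 50 <= T by rewrite /T; lia.
  by move: leU; rewrite mulnSr /=; set X := T * _; lia.
Qed.

End Sort.

(** * Splitting the classes *)

Section Move.

Variable n : nat.
Implicit Types (s : memory) (v w : 'I_n) (c t : nat).

Definition classes s : Prop :=
  classes_ok n (arr s col_arr) (arr s end_arr) (arr s elt_arr) (arr s pos_arr).

Lemma class_size_recolour (a a' : 'I_n -> nat) v t :
  a v != t -> (forall w, a' w = if w == v then t else a w) ->
  [/\ class_size a (a v) = (class_size a' (a v)).+1,
      class_size a' t = (class_size a t).+1 &
      forall c, c != a v -> c != t -> class_size a' c = class_size a c].
Proof.
move=> ne a'E; split.
- rewrite /class_size (cardsD1 v) inE eqxx add1n; congr _.+1; apply: eq_card => w.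
  by rewrite !inE a'E; have [->|] := eqVneq w v; rewrite //= eq_sym (negbTE ne).
- rewrite /class_size (cardsD1 v) inE a'E eqxx eqxx add1n; congr _.+1; apply: eq_card => w.
  by rewrite !inE a'E; have [->|] := eqVneq w v; rewrite //= (negbTE ne).
- move=> c nv nt; apply: eq_card => w; rewrite !inE a'E; have [->|//] := eqVneq w v.
  by rewrite eq_sym (negbTE nt) eq_sym (negbTE nv).
Qed.

Lemma moveP s v t :
  classes s -> reg s w_reg = v -> reg s c_reg = arr s col_arr v ->
  reg s t_reg = t -> t <= n -> t != arr s col_arr v ->
  run move s 60 (fun s' => classes s' /\
    forall j, arr s' col_arr j = if j == v then t else arr s col_arr j).
Proof.
move=> ok Ew Ec Et t_le ne; have [okv oke] := ok.
set c := arr s col_arr v in Ec ne; have [c_le pos_v elt_v] := okv v; rewrite -/c in c_le pos_v.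
have c_ne : (t == c) = false by apply/negbTE.
apply: run_straight => //=; rewrite Ew Ec Et c_ne eqxx addn1.
set last := arr s end_arr c - 1.
have [|u [Eu Cu Pu]] := class_member ok c_le (p := last); first by rewrite /last; lia.
rewrite Eu; split; last by [].
have size_le d : d <= n -> arr s end_arr d <= d * n + n.
  by move=> d_le; rewrite oke // leq_add2l class_size_le.
(* The vertex [v] is not of colour [t], so the block of [t] has a free cell. *)
have ltend : arr s end_arr t < t * n + n.
  rewrite oke // ltn_add2l -[ltnRHS]card_ord; apply: proper_card; apply/properP.
  by split; [apply/subsetP | exists v; rewrite ?inE // eq_sym].
have ge_t : t * n <= arr s end_arr t by rewrite oke // leq_addr.
rewrite /classes /=; set col' := (X in classes_ok n X).
have [||s1 s2 s3] := @class_size_recolour (fun w => arr s col_arr w) (fun w => col' w) v t.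
- by rewrite eq_sym.
- by move=> w; rewrite /col'.
split=> [w | d d_le]; last first.
  have [-> | nt] := eqVneq d t; first by rewrite s2 addnS oke.
  have [-> | nc] := eqVneq d c; last by rewrite s3 // oke.
  by rewrite /last oke // s1 addnS subn1.
rewrite /col' /=; have [-> | nw] := eqVneq w v.
  by rewrite !eqxx ltnSn ge_t.
have -> : (w == v :> nat) = false by apply/negbTE.
have [cw_le pos_w elt_w] := okv w; split=> //.
(* Besides [v], only the last vertex [u] of the old class changes its place. If it differs from [v],
   the cell freed by [v] comes before the last one and stays inside the shortened block. *)
- have [Ewu | nwu] := eqVneq (w : nat) u.
    rewrite Ewu Cu eq_sym c_ne eqxx.
    have : arr s pos_arr v != last; last by rewrite /last; lia.
    by apply: contraNneq nw => E; apply/eqP/val_inj; rewrite /= Ewu -Eu -E elt_v.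
  have [Et' | nt] := eqVneq (arr s col_arr w) t; first by rewrite -Et'; lia.
  have [Ec' | //] := eqVneq (arr s col_arr w) c.
  have : arr s pos_arr w != last; last by rewrite /last -Ec'; rewrite Ec' in pos_w *; lia.
  by apply: contraNneq nwu => E; rewrite -Eu -E elt_w.
- have disj d p : d <= n -> d != t -> d * n <= p < arr s end_arr d ->
      (p == arr s end_arr t) = false.
    move=> d_le nd Hp; apply/eqP => Ep; have := size_le d d_le.
    by move: nd; rewrite neq_ltn => /orP[]; nia.
  have [Ewu | nwu] := eqVneq (w : nat) u.
    by rewrite (disj c) // ?eqxx // eq_sym.
  have -> : (arr s pos_arr w == arr s end_arr t) = false.
    have [Et' | nt] := eqVneq (arr s col_arr w) t; last exact: disj nt pos_w.
    by rewrite -Et'; apply/eqP; lia.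
  case: eqP => // E; case/eqP: nw; apply: val_inj.
  by rewrite /= -elt_w -elt_v E.
Qed.

End Move.

(** * Splitting one class by the counts *)

Section Split.

Variables (n : nat) (es : seq ('I_n * 'I_n)).
Implicit Types (s : memory) (a d : 'I_n -> nat) (v : 'I_n) (c k : nat).

Lemma class_size_touched a d c :
  class_size a c = part_size a d c 0 + touched_size a d c.
Proof.
rewrite /class_size -(cardsID [set v | d v == 0]); congr (_ + _); apply: eq_card => v.
  by rewrite !inE.
by rewrite !inE andbC lt0n.
Qed.

(** The largest count is 0 or one of the summands of [D]; this makes it affordable to run through
    all counts up to it. *)
Lemma count_degreesP a d s c (D := \sum_(v | a v == c) d v) :
  static es s -> touched_ok a d s -> (forall v, d v <= n) ->
  c <= n -> reg s c_reg = c -> arr s end_arr c = c * n + class_size a c ->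
  (forall i, i <= n -> arr s cnt_arr i = 0) ->
  run count_degrees s (80 * D.+1) (fun s' =>
    [/\ forall i, i <= n -> arr s' cnt_arr i = part_size a d c i,
        forall i, reg s' top_reg < i -> part_size a d c i = 0,
        reg s' top_reg <= n & reg s' top_reg <= D]).
Proof.
move=> [_ _ baseE _] tok d_le c_le Ec endE cnt0; have [degE tl _ _] := tok.
have tsize_le : touched_size a d c <= D by apply: touched_size_le.
apply: (@run_seq _ _ _ 8 (80 * D + 70)) => //; last by lia.
apply: run_straight => //=; rewrite Ec endE (tendE tok) //.
rewrite (class_size_touched a d) subnDl addnK.
apply: (@run_seq _ _ _ 2 (80 * D + 65)) => //; last by lia.
apply: run_straight => //=.
apply: (@run_seq _ _ _ 3 (80 * D + 60)) => //; last by lia.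
apply: run_straight => //=; rewrite Ec baseE //.
set s1 := set_reg _ _ _; set prog := for_loop _ _ _.
pose S q := seg (arr s telt_arr) (c * n) q.
pose inv q s' := [/\ forall i, i <= n -> arr s' cnt_arr i =
    (if i == 0 then part_size a d c 0 else 0) + count (fun z => arr s deg_arr z == i) (S q),
  {in S q, forall z, arr s deg_arr z <= reg s' top_reg} &
  reg s' top_reg = 0 \/ exists2 v, a v = c & reg s' top_reg = d v].
have run1 : run prog s1 (80 * D + 60)
    (fun s' => reg s' q_reg = arr s tend_arr c /\ inv (arr s tend_arr c) s').
  apply: (@run_for _ _ _ _ (c * n) _ (fun=> 40) _ inv) => //.
  - by rewrite (tendE tok) // leq_addr.
  - by move=> s2 [Fr Fa] /=; rewrite (Fr c_reg isT) (Fa tend_arr isT) /= Ec.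
  - split; rewrite /S ?seg_nil //; last by left.
    by move=> i i_le; rewrite /= addn0; case: eqP => // _; apply: cnt0.
  - move=> q s2 Hq Eq [Fr Fa] [cnt2 top2 wit2]; apply: run_straight => //=.
    rewrite Eq (Fa deg_arr isT) (Fa telt_arr isT) /=.
    have [v [Ev Cv dv]] := touched_member tok c_le Hq.
    rewrite Ev degE addn1.
    have SS : S q.+1 = rcons (S q) (val v) by rewrite /S segS ?Ev //; lia.
    have cnt' i : i <= n -> (if i == d v then (arr s2 cnt_arr (d v)).+1 else arr s2 cnt_arr i) =
        (if i == 0 then part_size a d c 0 else 0) + count (fun z => arr s deg_arr z == i) (S q.+1).
      move=> i_le; rewrite SS -cats1 count_cat /= addn0 degE addnA -cnt2 // eq_sym.
      by case: eqP => [-> | _] /=; rewrite ?addn0 ?addn1.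
    case: ltnP => cmp; split=> //=.
    + by move=> z; rewrite SS mem_rcons inE => /orP[/eqP-> | /top2]; rewrite ?degE //; lia.
    + by right; exists v.
    + by move=> z; rewrite SS mem_rcons inE => /orP[/eqP-> | /top2]; rewrite ?degE.
  - by rewrite sum_nat_const_nat (tendE tok) // addKn /=; lia.
apply: (run_weaken run1) => // s' _ [_ [cnt' top' wit']].
have perm : perm_eq (S (arr s tend_arr c)) (vertices (fun v => (a v == c) && (0 < d v))).
  by have [] := tl c c_le.
split.
- move=> i i_le; rewrite cnt' //; case: i i_le => [|i] i_le /=.
    rewrite (@eq_in_count _ _ pred0) ?count_pred0 ?addn0 // => z.
    rewrite (perm_mem perm) => /verticesP[v /andP[_ dv] ->].
    by rewrite degE eqn0Ngt dv.
  rewrite add0n (permP perm) -sum1_count big_map big_enum_cond /= sum1dep_card.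
  apply: eq_card => v; rewrite !inE degE unfold_in /=. have [-> | _] := eqVneq (d v) i.+1.
    by rewrite !andbT.
  by rewrite !andbF.
- move=> i lt_i; apply/eqP; rewrite cards_eq0; apply/eqP/setP=> v; rewrite !inE.
  apply/andP => -[/eqP Ev /eqP Dv]; have := top' (val v).
  rewrite (perm_mem perm) mem_vertices Ev eqxx degE Dv /=.
  by case: i lt_i {Dv} => // i lt_i /(_ isT); lia.
- by case: wit' => [-> // | [v _ ->]].
- case: wit' => [-> // | [v Ev ->]].
  by rewrite /D (bigD1 v) ?Ev //= leq_addr.
Qed.

Lemma find_heaviestP s f N (M := reg s top_reg) :
  (forall i, i <= N -> arr s cnt_arr i = f i) -> (forall i, M < i -> f i = 0) -> M <= N ->
  run find_heaviest s (60 * M.+1) (fun s' => reg s' b_reg = heaviest f N.+1).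
Proof.
move=> cntE f0 le_MN; rewrite (@heaviest_trunc f M.+1) //.
apply: (@run_seq _ _ _ 2 (60 * M + 55)) => //; last by lia.
apply: run_straight => //=; apply: (@run_seq _ _ _ 2 (60 * M + 50)) => //; last by lia.
apply: run_straight => //=; set s1 := set_reg _ _ _; set prog := for_loop _ _ _.
have run1 : run prog s1 (60 * M + 50) (fun s' => reg s' i_reg = M.+1 /\
    reg s' b_reg = heaviest f M.+1).
  apply: (@run_for _ _ _ _ 0 _ (fun=> 20) _ (fun i s' => reg s' b_reg = heaviest f i)) => //.
  - by move=> s2 [Fr Fa] /=; rewrite (Fr top_reg isT) /= addn1.
  - move=> i s2 /andP[_ lt_i] Ei [Fr Fa] b2; apply: run_straight => //=.
    rewrite Ei b2 (Fa cnt_arr isT) /= heaviestS !cntE.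
    + by case: (_ < f i).
    + by apply: leq_trans le_MN.
    + apply: leq_trans (heaviest_le _ _) _; apply: leq_trans le_MN.
      by rewrite -ltnS.
  - by rewrite sum_nat_const_nat /=; lia.
by apply: (run_weaken run1) => // s' _ [].
Qed.

Lemma name_partsP s f N (M := reg s top_reg) (b := reg s b_reg) (k := reg s k_reg) :
  (forall i, i <= N -> arr s cnt_arr i = f i) -> (forall i, M < i -> f i = 0) -> M <= N ->
  run name_parts s (80 * M.+1) (fun s' =>
    [/\ reg s' k_reg = k + rank f b N.+1,
        forall i, i <= N -> arr s' cnt_arr i = 0,
        b <= M -> arr s' name_arr b = reg s c_reg &
        forall i, renamed f b i -> arr s' name_arr i = k + (rank f b i).+1]).
Proof.
move=> cntE f0 le_MN; rewrite (@rank_trunc f b M.+1) //.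
apply: (@run_seq _ _ _ 2 (80 * M + 75)) => //; last by lia.
apply: run_straight => //=; set s1 := set_reg _ _ _; set prog := for_loop _ _ _.
pose inv i s' := [/\ reg s' k_reg = k + rank f b i,
  forall j, j <= N -> arr s' cnt_arr j = if j < i then 0 else f j,
  b < i -> arr s' name_arr b = reg s c_reg &
  forall j, j < i -> renamed f b j -> arr s' name_arr j = k + (rank f b j).+1].
have run1 : run prog s1 (80 * M + 75) (fun s' => reg s' i_reg = M.+1 /\ inv M.+1 s').
  apply: (@run_for _ _ _ _ 0 _ (fun=> 40) _ inv) => //.
  - by move=> s2 [Fr Fa] /=; rewrite (Fr top_reg isT) /= addn1.
  - by split=> //=; rewrite addn0.
  - move=> i s2 /andP[_ lt_i] Ei [Fr Fa] [k2 cnt2 b2 name2].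
    have i_le : i <= N by apply: leq_trans le_MN.
    have cnt' j : j <= N -> (if j == i then 0 else arr s2 cnt_arr j) = if j < i.+1 then 0 else f j.
      by move=> j_le; rewrite ltnS leq_eqVlt cnt2 //; case: eqP.
    have rS := rankS f b i.
    apply: run_straight => //=; rewrite Ei (Fr b_reg isT) (Fr c_reg isT) /= -/b cnt2 // ltnn.
    have [Eib | neb] := eqVneq i b.
      have ri : renamed f b i = false by rewrite /renamed Eib eqxx andbF.
      rewrite /inv /= rS ri addn0; split=> //; first by rewrite -Eib eqxx.
      move=> j; rewrite ltnS leq_eqVlt; have [-> | _] := eqVneq j i; first by rewrite ri.
      exact: name2.
    have b3 : b < i.+1 -> arr s2 name_arr b = reg s c_reg.
      by rewrite ltnS leq_eqVlt eq_sym (negbTE neb) => /b2.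
    have ri : renamed f b i = (0 < f i) by rewrite /renamed neb andbT.
    case: ltnP ri => [fi_gt0 | fi0] ri; rewrite /inv /= rS ri.
      rewrite k2 addn1 addnS addn0 addnS; split=> //.
        by move=> lt_b; rewrite eq_sym (negbTE neb) b3.
      move=> j; rewrite ltnS leq_eqVlt; have [-> | _] := eqVneq j i; last exact: name2.
      by rewrite addnS.
    rewrite addn0; split=> // j; rewrite ltnS leq_eqVlt.
    by have [-> | _] := eqVneq j i; [rewrite ri | apply: name2].
  - by rewrite sum_nat_const_nat /=; lia.
apply: (run_weaken run1) => // s' _ [_ [k' cnt' b' name']]; split=> //.
- by move=> i i_le; rewrite cnt' //; case: ltnP => // lt; apply: f0.
- move=> i ri; apply: name' => //; rewrite ltnS leqNgt; apply/negP => lt.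
  by move: ri; rewrite /renamed f0.
Qed.

Lemma copy_loopP s elt limit lo hi :
  elt != mov_arr -> limit != mov_arr -> reg s q_reg = lo -> reg s y_reg = 0 ->
  arr s limit (reg s c_reg) = hi -> lo <= hi ->
  run (copy_loop elt limit) s (30 * (hi - lo) + 10) (fun s' =>
    seg (arr s' mov_arr) 0 (reg s' y_reg) = seg (arr s elt) lo hi).
Proof.
move=> ne_elt ne_limit Eq Ey Ehi le.
have run1 : run (copy_loop elt limit) s (30 * (hi - lo) + 10) (fun s' =>
    reg s' q_reg = hi /\ seg (arr s' mov_arr) 0 (reg s' y_reg) = seg (arr s elt) lo hi).
  apply: (@run_for _ _ _ _ lo _ (fun=> 12) _ (fun q s' =>
    seg (arr s' mov_arr) 0 (reg s' y_reg) = seg (arr s elt) lo q)) => //.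
  - by move=> s2 [Fr Fa] /=; rewrite (Fr c_reg isT) Fa // inE.
  - by rewrite Ey !seg_nil.
  - move=> q s2 /andP[ge_q lt_q] Eq2 [Fr Fa] E2; apply: run_straight => //=.
    rewrite Eq2 (Fa elt) ?inE // addn1 [RHS]segS // -E2; apply: seg_rcons; rewrite ?eqxx // => p Hp.
    by case: eqP => //; lia.
  - by rewrite sum_nat_const_nat /=; lia.
by apply: (run_weaken run1) => // s' _ [].
Qed.

Lemma list_movableP s a d c (b := reg s b_reg) :
  static es s -> touched_ok a d s -> classes n s -> c <= n -> reg s c_reg = c ->
  (forall v, (arr s col_arr v == c) = (a v == c)) ->
  (b != 0 -> class_size a c <= 2 * touched_size a d c) ->
  run list_movable s (60 * touched_size a d c + 40) (fun s' =>
    perm_eq (seg (arr s' mov_arr) 0 (reg s' y_reg))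
      (vertices (fun v => (a v == c) && ((b == 0) ==> (0 < d v))))).
Proof.
move=> [_ _ baseE _] tok ok c_le Ec colE size_le.
have endE : arr s end_arr c = c * n + class_size a c.
  have [_ ->] := ok; rewrite //; congr (_ + _); apply: eq_card => v.
  by rewrite !inE colE.
apply: (@run_seq _ _ _ 2 (60 * touched_size a d c + 35)) => //; last by lia.
apply: run_straight => //=.
apply: (@run_seq _ _ _ 3 (60 * touched_size a d c + 30)) => //; last by lia.
apply: run_straight => //=; rewrite Ec baseE //; set s1 := set_reg _ _ _.
apply: (@run_if _ _ _ _ (60 * touched_size a d c + 20)); last by rewrite /=; lia.
rewrite /= -/b; have [b0 | b_ne0] := eqVneq b 0.
  have run1 := @copy_loopP s1 telt_arr tend_arr (c * n) (arr s tend_arr c).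
  apply: (run_weaken (run1 _ _ _ _ _ _)) => //=; rewrite ?Ec ?(tendE tok) ?leq_addr //.
    by rewrite addKn; lia.
  move=> s' _ ->; rewrite -(tendE tok) //.
  by have [_ /(_ c c_le)[_ perm] _ _] := tok.
have run1 := @copy_loopP s1 elt_arr end_arr (c * n) (arr s end_arr c).
apply: (run_weaken (run1 _ _ _ _ _ _)) => //=; rewrite ?Ec ?endE ?leq_addr //.
  by rewrite addKn; have := size_le b_ne0; lia.
move=> s' _ ->; rewrite -endE; have := class_seg ok c_le.
rewrite (@eq_vertices _ _ (fun v => (a v == c) && true)) // => v.
by rewrite andbT colE.
Qed.

Lemma move_partsP s (P : pred 'I_n) (tgt : 'I_n -> nat) c (N := reg s y_reg) :
  classes n s -> reg s c_reg = c ->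
  perm_eq (seg (arr s mov_arr) 0 N) (vertices P) ->
  (forall v, P v -> [/\ arr s col_arr v = c, arr s name_arr (arr s deg_arr v) = tgt v &
                        tgt v <= n]) ->
  run move_parts s (100 * N + 20) (fun s' => classes n s' /\
    forall v, arr s' col_arr v = if P v then tgt v else arr s col_arr v).
Proof.
move=> ok Ec perm Pok.
have mov_uniq : uniq (seg (arr s mov_arr) 0 N).
  by rewrite (perm_uniq perm) vertices_uniq.
apply: (@run_seq _ _ _ 2 (100 * N + 15)) => //; last by lia.
apply: run_straight => //=; set s1 := set_reg _ _ _; set prog := for_loop _ _ _.
pose M j := seg (arr s mov_arr) 0 j.
pose inv j s' := classes n s' /\
  forall v, arr s' col_arr v = if val v \in M j then tgt v else arr s col_arr v.
have run1 : run prog s1 (100 * N + 15) (fun s' => reg s' l_reg = N /\ inv N s').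
  apply: (@run_for _ _ _ _ 0 _ (fun=> 80) _ inv) => //.
  - by move=> s2 [Fr Fa] /=; rewrite (Fr y_reg isT).
  - by split=> // v; rewrite /M seg_nil in_nil.
  - move=> j s2 /andP[_ lt_j] Ej [Fr Fa] [ok2 col2].
    have : arr s mov_arr j \in M N by apply/segP; exists j.
    rewrite (perm_mem perm) => /verticesP[v Pv Ev]; have [Cv tv t_le] := Pok v Pv.
    have MS : M j.+1 = rcons (M j) (val v) by rewrite /M segS // Ev.
    have v_notin : val v \notin M j.
      have : uniq (M j.+1).
        have -> : M j.+1 = take j.+1 (M N).
          rewrite /M !segE -map_take take_iota !subn0.
          by rewrite (minn_idPl _).
        by rewrite take_uniq.
      by rewrite MS rcons_uniq => /andP[].
    have colv2 : arr s2 col_arr v = c by rewrite col2 (negbTE v_notin).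
    apply: (@run_seq _ _ _ 3 76) => //; apply: run_straight => //=.
    rewrite Ej (Fa mov_arr isT) /= Ev.
    apply: (@run_seq _ _ _ 5 70) => //; apply: run_straight => //=.
    rewrite (Fa deg_arr isT) (Fa name_arr isT) /= tv; set s3 := set_reg _ _ _.
    have c3 : reg s3 c_reg = c by rewrite /= (Fr c_reg isT).
    apply: (@run_if _ _ _ _ 62) => //.
    rewrite /= (Fr c_reg isT) /= Ec; have [Et | ne] := eqVneq (tgt v) c.
      apply: run_straight => //=; split=> // w.
      rewrite MS mem_rcons inE /=; have [-> | nw] := eqVneq w v.
        by rewrite eqxx colv2 Et.
      have -> : (w == v :> nat) = false by apply/negbTE.
      by rewrite col2.
    have := @moveP n s3 v (tgt v) ok2.
    rewrite c3 /= colv2 => /(_ erefl erefl erefl t_le ne) run3.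
    apply: (run_weaken run3) => // s4 _ [ok4 col4]; split=> // w.
    rewrite /= col4 MS mem_rcons inE /=; have [-> | nw] := eqVneq w v.
      by rewrite !eqxx.
    have -> : (w == v :> nat) = false by apply/negbTE.
    by rewrite col2.
  - by rewrite sum_nat_const_nat /=; lia.
apply: (run_weaken run1) => // s' _ [_ [ok' col']]; split=> // v.
by rewrite col' (perm_mem perm) mem_vertices.
Qed.

(** The current colouring [col] may differ from [a] through earlier splits of the round. Only the
    class of [c] has to be the same in both. *)
Lemma split_comP s a d c k (D := \sum_(v | a v == c) d v)
    (col := fun v => arr s col_arr v) (st' := split_class d (col, k) c) :
  static es s -> touched_ok a d s -> classes n s -> 1 <= c <= k -> onto col k -> k <= n ->
  reg s c_reg = c -> reg s k_reg = k ->
  (forall v, (arr s col_arr v == c) = (a v == c)) ->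
  (forall v, d v <= n) -> (forall i, i <= n -> arr s cnt_arr i = 0) ->
  run split_com s (600 * D.+1) (fun s' =>
    [/\ classes n s', forall v, arr s' col_arr v = st'.1 v, reg s' k_reg = st'.2 &
        forall i, i <= n -> arr s' cnt_arr i = 0]).
Proof.
move=> st tok ok c_le col_onto k_le Ec Ek colE d_le cnt0.
have c_le_n : c <= n by case/andP: c_le => _; move=> H; apply: leq_trans H k_le.
have cardI : #|'I_n| = n by rewrite card_ord.
have d_le' v : d v <= #|'I_n| by rewrite cardI.
have tsize_le : touched_size a d c <= D by apply: touched_size_le.
have onto' := split_class_onto d_le' col_onto c_le; rewrite -/st' in onto'.
have k'_le : st'.2 <= n by rewrite -[leqRHS]cardI (onto_card onto').
pose f := part_size a d c.
have fE : part_size col d c =1 f.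
  by move=> i; apply: eq_card => v; rewrite !inE /col colE.
pose b := heaviest f n.+1.
have st'1 v : st'.1 v = if (col v == c) && (d v != b) then k + (rank f b (d v)).+1 else col v.
  by rewrite /st' /= cardI (eq_heaviest _ fE) -/b (eq_rank _ _ fE).
have st'2 : st'.2 = k + rank f b n.+1.
  by rewrite /st' /= cardI (eq_heaviest _ fE) -/b (eq_rank _ _ fE).
have endE : arr s end_arr c = c * n + class_size a c.
  have [_ ->] := ok; rewrite //; congr (_ + _); apply: eq_card => v.
  by rewrite !inE colE.
have run1 := count_degreesP st tok d_le c_le_n Ec endE cnt0.
apply: (@run_seq _ _ _ (80 * D.+1) (500 * D + 400)); last by lia.
apply: (run_weaken run1) => // s1 F1 [cnt1 top1 M_le_n M_le]; have [Fr1 Fa1] := F1.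
set M := reg s1 top_reg in top1 M_le_n M_le.
have run2 := find_heaviestP cnt1 top1 M_le_n; rewrite -/f -/b in run2.
apply: (@run_seq _ _ _ (60 * M.+1) (430 * D + 330)); last by lia.
apply: (run_weaken run2) => // s2 F2 b2; have [Fr2 Fa2] := F2.
have top2 : reg s2 top_reg = M by rewrite (Fr2 top_reg isT).
have cnt2 i : i <= n -> arr s2 cnt_arr i = f i.
  by move=> i_le; rewrite (Fa2 cnt_arr isT) cnt1.
have k2 : reg s2 k_reg = k by rewrite (Fr2 k_reg isT) (Fr1 k_reg isT).
have c2 : reg s2 c_reg = c by rewrite (Fr2 c_reg isT) (Fr1 c_reg isT).
have run3 : run name_parts s2 (80 * M.+1) (fun s' =>
    [/\ reg s' k_reg = k + rank f b n.+1, forall i, i <= n -> arr s' cnt_arr i = 0,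
        b <= M -> arr s' name_arr b = c &
        forall i, renamed f b i -> arr s' name_arr i = k + (rank f b i).+1]).
  by have := @name_partsP s2 f n; rewrite b2 k2 c2 top2; apply.
apply: (@run_seq _ _ _ (80 * M.+1) (340 * D + 240)); last by lia.
apply: (run_weaken run3) => // s3 F3 [k3 cnt3 nameb name3]; have [Fr3 Fa3] := F3.
have b3 : reg s3 b_reg = b by rewrite (Fr3 b_reg isT) b2.
have st3 : static es s3.
  apply: (static_frame (c := name_parts) _ _ F3) => //.
  apply: (static_frame (c := find_heaviest) _ _ F2) => //.
  exact: (static_frame (c := count_degrees) _ _ F1).
have arr3 z : z \notin [:: cnt_arr; name_arr] -> arr s3 z = arr s z.
  rewrite !inE negb_or => /andP[n1 n2].
  by rewrite (Fa3 z) ?(Fa2 z) ?(Fa1 z) // !inE ?negb_or ?n1 ?n2.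
have reg3 r : r \notin [:: top_reg; q_reg; i_reg; b_reg; k_reg] -> reg s3 r = reg s r.
  rewrite !inE !negb_or => /and5P[n1 n2 n3 n4 n5].
  by rewrite (Fr3 r) ?(Fr2 r) ?(Fr1 r) // !inE !negb_or ?n1 ?n2 ?n3 ?n4 ?n5.
have tok3 : touched_ok a d s3.
  by rewrite /touched_ok (arr3 deg_arr isT) (arr3 tend_arr isT) (arr3 telt_arr isT)
    (arr3 touched_arr isT) (reg3 ntouched_reg isT).
have ok3 : classes n s3.
  by rewrite /classes (arr3 col_arr isT) (arr3 end_arr isT) (arr3 elt_arr isT)
    (arr3 pos_arr isT).
have part_d v : a v = c -> 0 < f (d v) by move=> Ev; rewrite /f -Ev part_size_gt0.
have fb_gt0 : 0 < f b.
  have [_ [//|v Ev]] := col_onto c; have Av : a v = c by apply/eqP; rewrite -colE -Ev.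
  by apply: leq_trans (part_d v Av) (heaviest_max _ _); rewrite ltnS.
have b_le : b <= M by rewrite leqNgt; apply/negP => /top1 fb0; rewrite /f fb0 in fb_gt0.
have part_touched i : 0 < i -> f i <= touched_size a d c.
  move=> i_gt0; apply: subset_leq_card; apply/subsetP=> v; rewrite !inE.
  by case/andP=> -> /eqP->.
have run4 : run list_movable s3 (60 * touched_size a d c + 40) (fun s' =>
    perm_eq (seg (arr s' mov_arr) 0 (reg s' y_reg))
      (vertices (fun v => (a v == c) && ((b == 0) ==> (0 < d v))))).
  have := @list_movableP s3 a d c st3 tok3 ok3 c_le_n.
  rewrite b3 (reg3 c_reg isT) (arr3 col_arr isT); apply=> // b_ne0.
  (* The untouched part is no larger than the heaviest one, which consists of touched vertices since
     [b] is not 0. *)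
  rewrite (class_size_touched a d) mul2n -addnn leq_add2r.
  by apply: leq_trans (heaviest_max f _ : f 0 <= f b) (part_touched b _); rewrite ?lt0n.
apply: (@run_seq _ _ _ (60 * touched_size a d c + 40) (260 * D + 190)); last by lia.
apply: (run_weaken run4) => // s4 F4 perm4; have [Fr4 Fa4] := F4.
have y_le : reg s4 y_reg <= 2 * D.
  have := perm_size perm4; rewrite size_seg size_vertices subn0 => ->.
  have [b0 | b_ne0] := eqVneq b 0.
    rewrite (_ : #|_| = touched_size a d c); first by lia.
    by apply: eq_card => v; rewrite !inE.
  apply: leq_trans (_ : class_size a c <= _).
    by apply: subset_leq_card; apply/subsetP=> v; rewrite !inE andbT.
  have le1 : part_size a d c 0 <= touched_size a d c.
    by apply: leq_trans (heaviest_max f _ : f 0 <= f b) (part_touched b _); rewrite ?lt0n.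
  by rewrite (class_size_touched a d); lia.
have deg4 v : arr s4 deg_arr v = d v.
  by rewrite (Fa4 deg_arr isT) (arr3 deg_arr isT); have [] := tok.
have col4 v : arr s4 col_arr v = col v by rewrite (Fa4 col_arr isT) (arr3 col_arr isT).
have ok4 : classes n s4.
  by rewrite /classes (Fa4 col_arr isT) (Fa4 end_arr isT) (Fa4 elt_arr isT)
    (Fa4 pos_arr isT).
have c4 : reg s4 c_reg = c by rewrite (Fr4 c_reg isT) (reg3 c_reg isT).
pose P v := (a v == c) && ((b == 0) ==> (0 < d v)).
have run5 := @move_partsP s4 P st'.1 c ok4 c4 perm4.
apply: (run_weaken (run5 _)).
- move=> v /andP[/eqP Ev _]; have Cv : col v = c by apply/eqP; rewrite /col colE Ev.
  have /andP[_ v_le] := onto_le v onto'.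
  rewrite col4 deg4 (Fa4 name_arr isT); split=> //; last exact: leq_trans k'_le.
  rewrite st'1 Cv eqxx; have [-> | ne] := eqVneq (d v) b; first exact: nameb.
  by rewrite name3 // /renamed part_d.
- by lia.
move=> s5 [Fr5 Fa5] [ok5 col5]; split=> //.
- move=> v; rewrite col5 /P; have [Av | nAv] := eqVneq (a v) c; last first.
    by rewrite col4 st'1 /col colE (negbTE nAv).
  have [b0 | //] := eqVneq b 0; have [dv | //] := posnP (d v).
  by rewrite col4 st'1 dv b0 eqxx /= andbF.
- by rewrite (Fr5 k_reg isT) (Fr4 k_reg isT) k3 st'2.
- by move=> i i_le; rewrite (Fa5 cnt_arr isT) (Fa4 cnt_arr isT) cnt3.
Qed.

End Split.

(** * A round of the refinement *)

Section Round.

Variables (n : nat) (es : seq ('I_n * 'I_n)).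
Implicit Types (s : memory) (a d : 'I_n -> nat) (v : 'I_n) (c k p : nat).

Lemma eq_split_class a a' d k c :
  a =1 a' -> (split_class d (a, k) c).1 =1 (split_class d (a', k) c).1 /\
  (split_class d (a, k) c).2 = (split_class d (a', k) c).2.
Proof.
move=> E; have fE : part_size a d c =1 part_size a' d c.
  by move=> i; apply: eq_card => v; rewrite !inE E.
split=> [v|] /=; rewrite (eq_heaviest _ fE) (eq_rank _ _ fE) //.
by rewrite E.
Qed.

Lemma eq_onto a a' k : a =1 a' -> onto a k -> onto a' k.
Proof.
move=> E Ha c; rewrite -Ha; split=> -[v <-]; by exists v.
Qed.

Lemma split_allP s a d k S (st' := split_classes d (a, k) S) (D := \sum_v d v) :
  static es s -> touched_ok a d s -> classes n s ->
  (forall v, arr s col_arr v = a v) -> reg s k_reg = k -> onto a k ->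
  (forall v, d v <= n) -> (forall i, i <= n -> arr s cnt_arr i = 0) ->
  seg (arr s split_arr) 0 (reg s nsplit_reg) = S -> uniq S ->
  {in S, forall c, 1 <= c <= k} -> {in S, forall c, splits a d c} ->
  run split_all s (1300 * D + 20) (fun s' =>
    [/\ classes n s', forall v, arr s' col_arr v = st'.1 v, reg s' k_reg = st'.2 &
        forall i, i <= n -> arr s' cnt_arr i = 0]).
Proof.
move=> st tok ok colE Ek a_onto d_le cnt0 segS_ S_uniq S_le S_splits.
have cardI : #|'I_n| = n by rewrite card_ord.
have d_le' v : d v <= #|'I_n| by rewrite cardI.
apply: (@run_seq _ _ _ 2 (1300 * D + 15)) => //; last by lia.
apply: run_straight => //=; set s1 := set_reg _ _ _; set prog := for_loop _ _ _.
set N := reg s nsplit_reg in segS_.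
pose T j := seg (arr s split_arr) 0 j.
pose st_ j := split_classes d (a, k) (T j).
pose inv j s' := [/\ classes n s', forall v, arr s' col_arr v = (st_ j).1 v,
  reg s' k_reg = (st_ j).2 & forall i, i <= n -> arr s' cnt_arr i = 0].
have T_take j : j <= N -> T j = take j S.
  move=> le_j; rewrite -segS_ /T !segE -map_take take_iota !subn0.
  by rewrite (minn_idPl le_j).
have T_sub j : j <= N -> {subset T j <= S}.
  by move=> le_j c; rewrite T_take // => /mem_take.
have T_uniq j : j <= N -> uniq (T j) by move=> le_j; rewrite T_take // take_uniq.
pose dsum c := \sum_(v | a v == c) d v.
have run1 : run prog s1 (1300 * D + 15) (fun s' => reg s' j_reg = N /\ inv N s').
  apply: (@run_for _ _ _ _ 0 _ (fun j => 600 * (dsum (arr s split_arr j)).+1 + 10) _ inv) => //.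
  - by move=> s2 [Fr Fa] /=; rewrite (Fr nsplit_reg isT).
  - by split=> //; rewrite /st_ /T seg_nil.
  - move=> j s2 /andP[_ lt_j] Ej F [ok2 col2 k2 cnt2]; have [Fr Fa] := F.
    set c := arr s split_arr j.
    have TS : T j.+1 = rcons (T j) c by rewrite /T segS.
    have Sc : c \in S by apply: (T_sub j.+1) => //; rewrite TS mem_rcons mem_head.
    have c_notin : c \notin T j.
      by have := T_uniq j.+1 lt_j; rewrite TS rcons_uniq => /andP[].
    have [|onto_j le_k _ alt_j _] := split_classes_spec d_le' a_onto (T_uniq j (ltnW lt_j)).
      by move=> c' /(T_sub j (ltnW lt_j)); apply: S_le.
    rewrite -/(st_ j) in onto_j le_k alt_j.
    have st_S : st_ j.+1 = split_class d (st_ j) c by rewrite /st_ TS /split_classes foldl_rcons.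
    have k_j_le : (st_ j).2 <= n by rewrite -[leqRHS]cardI (onto_card onto_j).
    apply: (@run_seq _ _ _ 3 (600 * (dsum c).+1 + 5)) => //; last by rewrite /c; lia.
    apply: run_straight => //=; rewrite Ej (Fa split_arr isT) /= -/c.
    set s3 := set_reg _ _ _.
    have run3 := @split_comP n es s3 a d c (st_ j).2.
    apply: (run_weaken (run3 _ _ _ _ _ _ _ _ _ _ _)) => //.
    + exact: (static_frame (c := prog) _ _ F).
    + rewrite /touched_ok /= (Fa deg_arr isT) (Fa tend_arr isT) (Fa telt_arr isT).
      by rewrite (Fa touched_arr isT) (Fr ntouched_reg isT).
    + by have /andP[-> c_le] := S_le c Sc; apply: leq_trans le_k.
    + by apply: eq_onto onto_j => v; rewrite /= col2.
    (* Earlier splits moved vertices only out of classes in [T j] and only to colours above [k], so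
       the class of [c] is intact. *)
    + move=> v; rewrite /= col2; have [-> // | [lt Ta _]] := alt_j v.
      have -> : ((st_ j).1 v == c) = false by have := S_le c Sc; lia.
      by apply/esym; apply: contraNF c_notin => /eqP<-.
    + by rewrite /dsum; lia.
    + have /andP[_ c_le] := S_le c Sc.
      move=> s4 _ [ok4 col4 k4 cnt4].
      have [E1 E2] := @eq_split_class (fun v => arr s3 col_arr v) (st_ j).1 d (st_ j).2 c col2.
      split=> //.
        by move=> v; rewrite /= col4 E1 st_S; case: (st_ j).
      by rewrite /= k4 E2 st_S; case: (st_ j).
  - have le1 : \sum_(0 <= j < N) dsum (arr s split_arr j) <= D.
      by rewrite (sum_seg _ _ _ dsum) segS_; apply: sum_classes_le.
    (* A class that splits contains a touched vertex, so the fixed cost per class is also charged to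
       arcs. *)
    have le2 : N <= \sum_(0 <= j < N) dsum (arr s split_arr j).
      rewrite -{1}[N]muln1 -{1}[N]subn0 -sum_nat_const_nat big_nat [leqRHS]big_nat.
      apply: leq_sum => j lt_j.
      have Sc : arr s split_arr j \in S by rewrite -segS_; apply/segP; exists j.
      have [v Ev dv] := splits_touched d_le' (S_splits _ Sc).
      by rewrite /dsum (bigD1 v) ?Ev //=; lia.
    rewrite (eq_bigr (fun j => 600 * dsum (arr s split_arr j) + 620)); last first.
      by move=> j _; rewrite /=; lia.
    rewrite big_split /= -big_distrr /= sum_nat_const_nat.
    by move: le1 le2; set X := \sum_(0 <= j < N) _; lia.
by apply: (run_weaken run1) => // s' _ [_]; rewrite /inv /st_ /T segS_.
Qed.

Lemma resetP s a d (D := \sum_v d v) :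
  static es s -> touched_ok a d s -> (forall v, a v <= n) ->
  run reset s (100 * D.+1) (fun s' =>
    (forall v, arr s' deg_arr v = 0) /\ forall c, c <= n -> arr s' tend_arr c = c * n).
Proof.
move=> [_ _ baseE _] tok a_le; have [degE tl tc_uniq tcE] := tok.
apply: (@run_seq _ _ _ 2 (100 * D + 80)) => //; last by lia.
apply: run_straight => //=; set s1 := set_reg _ _ _; set prog := for_loop _ _ _.
pose N := reg s ntouched_reg; pose T j := seg (arr s touched_arr) 0 j.
pose inv j s' :=
  (forall v, arr s' deg_arr v = if a v \in T j then 0 else d v) /\
  (forall c, arr s' tend_arr c = if c \in T j then c * n else arr s tend_arr c).
pose cost j := 40 * touched_size a d (arr s touched_arr j) + 40.
have run1 : run prog s1 (100 * D + 80) (fun s' => reg s' j_reg = N /\ inv N s').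
  apply: (@run_for _ _ _ _ 0 _ cost _ inv) => //.
  - by move=> s2 [Fr Fa] /=; rewrite (Fr ntouched_reg isT).
  - by split=> [v | c]; rewrite /T seg_nil in_nil // degE.
  - move=> j s2 /andP[_ lt_j] Ej [Fr Fa] [deg2 tend2].
    set c := arr s touched_arr j.
    have TS : T j.+1 = rcons (T j) c by rewrite /T segS.
    have Tc : c \in T N by apply/segP; exists j.
    have c_le : c <= n by move: Tc; rewrite tcE => /andP[].
    have c_notin : c \notin T j.
      have : uniq (T j.+1).
        have -> : T j.+1 = take j.+1 (T N).
          rewrite /T !segE -map_take take_iota !subn0.
          by rewrite (minn_idPl _).
        by rewrite take_uniq.
      by rewrite TS rcons_uniq => /andP[].
    have tend2c : arr s2 tend_arr c = arr s tend_arr c by rewrite tend2 (negbTE c_notin).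
    apply: (@run_seq _ _ _ 3 (40 * touched_size a d c + 35)) => //; last by rewrite /cost -/c; lia.
    apply: run_straight => //=; rewrite Ej (Fa touched_arr isT) /= -/c.
    apply: (@run_seq _ _ _ 3 (40 * touched_size a d c + 30)) => //; last by lia.
    apply: run_straight => //=; rewrite (Fa base_arr isT) /= baseE //.
    set s3 := set_reg _ _ _; set prog2 := for_loop _ _ _.
    pose S q := seg (arr s telt_arr) (c * n) q.
    have run2 : run prog2 s3 (40 * touched_size a d c + 15) (fun s' =>
        reg s' q_reg = arr s tend_arr c /\
        forall v, arr s' deg_arr v =
          if val v \in S (arr s tend_arr c) then 0 else arr s2 deg_arr v).
      apply: (@run_for _ _ _ _ (c * n) _ (fun=> 10) _ (fun q s' =>
        forall v, arr s' deg_arr v = if val v \in S q then 0 else arr s2 deg_arr v)) => //.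
      + by have [] := tl c c_le.
      + by move=> s4 [Fr4 Fa4] /=; rewrite (Fa4 tend_arr isT) (Fr4 c_reg isT) /= tend2c.
      + by move=> v; rewrite /S seg_nil in_nil.
      + move=> q s4 /andP[ge_q lt_q] Eq4 [Fr4 Fa4] deg4; apply: run_straight => //= v.
        rewrite Eq4 (Fa4 telt_arr isT) /= (Fa telt_arr isT) /= /S segS // mem_rcons inE.
        by rewrite deg4; case: eqP.
      + by rewrite sum_nat_const_nat (tendE tok) // addKn /=; lia.
    apply: (@run_seq _ _ _ (40 * touched_size a d c + 15) 10) => //; last by lia.
    apply: (run_weaken run2) => // s4 [Fr4 Fa4] [_ deg4]; apply: run_straight => //=.
    rewrite (Fr4 c_reg isT) (Fa4 base_arr isT) /= (Fa base_arr isT) /= baseE //.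
    have [_ /perm_mem perm] := tl c c_le.
    split=> [v | c'] /=; rewrite TS mem_rcons inE.
      rewrite deg4 /S perm mem_vertices deg2; case: (a v =P c) => //= Ev.
      by rewrite Ev (negbTE c_notin); case: posnP.
    by rewrite (Fa4 tend_arr isT) /= tend2; case: eqP => // ->.
  - have -> : \sum_(0 <= i < reg s1 ntouched_reg) (cost i + expr_cost (Reg ntouched_reg) + 9) =
        \sum_(0 <= i < reg s ntouched_reg)
          (fun c => 40 * touched_size a d c + 50) (arr s touched_arr i).
      by apply: eq_bigr => i _; rewrite /cost /=; lia.
    have : \sum_(0 <= i < reg s ntouched_reg) touched_size a d (arr s touched_arr i) <= D.
      by apply: (sum_ntouched tok) => c _; apply: touched_size_le.
    have : \sum_(0 <= i < reg s ntouched_reg) (fun=> 1) (arr s touched_arr i) <= D.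
      apply: (sum_ntouched tok (F := fun=> 1)) => c c_gt0.
      exact: leq_trans c_gt0 (touched_size_le _ _ _).
    rewrite big_split /= -big_distrr /= sum_nat_const_nat (sum_nat_const_nat _ _ 50).
    by set X := \sum_(_ <= _ < _) _; rewrite /=; lia.
apply: (run_weaken run1) => // s' _ [_ [deg' tend']]; split=> [v | c c_le].
  rewrite deg'; case: ifP => // /negbT no; apply/eqP; rewrite -leqn0 leqNgt.
  by apply: contra no => dv; apply/(touchedP tok); split; [apply: a_le | exists v].
rewrite tend'; case: ifP => // /negbT; rewrite tcE c_le -leqNgt => le.
by apply/eqP; rewrite eqn_leq le; have [-> _] := tl c c_le.
Qed.

End Round.

(** * Assembling a complete round *)

Section Refine.

Variables (n : nat) (G : rel 'I_n) (es : seq ('I_n * 'I_n)).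
Hypothesis es_G : edge_list G es.
Implicit Types (s : memory) (a d : 'I_n -> nat) (v : 'I_n) (c k p : nat).

(** The invariant between rounds; the last group says that the work arrays are clean. *)
Definition ready a k p s : Prop :=
  [/\ static es s, classes n s, forall v, arr s col_arr v = a v,
      reg s k_reg = k /\ reg s p_reg = p &
      [/\ forall v, arr s deg_arr v = 0, forall c, c <= n -> arr s tend_arr c = c * n &
          forall i, i <= n -> arr s cnt_arr i = 0]].

Lemma sum_count_mem (L : seq 'I_n) : \sum_v count_mem v L = size L.
Proof.
elim: L => [|w L IH] /=; first by rewrite big1.
rewrite big_split /= IH (bigD1 w) //= eqxx big1 // => v.
by rewrite eq_sym => /negbTE->.
Qed.

(** The counting work is charged to the weight of the refining class. Each split class yields a new
    colour, so sorting is charged to [k' - k], with one more unit for the passes over the bits when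
    nothing splits. *)
Lemma round_comP s a k p (a' := (split_round G a k p.+1).1)
    (k' := (split_round G a k p.+1).2) (W := \sum_(v | a v == p.+1) wt es v) :
  ready a k p s -> onto a k -> p < k ->
  run round_com s (2000 * W.+1 + 300 * (k' - k).+1 * (trunc_log 2 n).+2)
    (ready a' k' p.+1).
Proof.
move=> [st ok colE [Ek Ep] [deg0 tend0 cnt0]] a_onto lt_pk.
have cardI : #|'I_n| = n by rewrite card_ord.
have k_le : k <= n by rewrite -[leqRHS]cardI (onto_card a_onto).
pose d := out_count G a p.+1.
have d_le v : d v <= n by rewrite -[leqRHS]cardI out_count_le.
have d_le' v : d v <= #|'I_n| by rewrite cardI.
have a_le v : a v <= n by have /andP[_ H] := onto_le v a_onto; apply: leq_trans k_le.
pose S := [seq c <- iota 1 k | splits a d c].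
have S_uniq : uniq S by rewrite filter_uniq ?iota_uniq.
have S_le : {in S, forall c, 1 <= c <= k}.
  by move=> c; rewrite mem_filter mem_iota add1n ltnS => /andP[].
have S_splits : {in S, forall c, splits a d c}.
  by move=> c; rewrite mem_filter => /andP[].
have [onto' size' _ _ _] := split_round_spec G p.+1 a_onto.
rewrite -/a' -/k' -/d -/S in onto' size'.
set lg := (trunc_log 2 n).+2; pose X := (size S).+1 * lg.
have X_le : 300 * X <= 300 * (k' - k).+1 * lg.
  have size_le : size S <= k' - k by lia.
  by rewrite -mulnA leq_mul2l leq_mul2r ltnS size_le !orbT.
apply: (@run_seq _ _ _ 4 (2000 * W + 1990 + 300 * X)); last by lia.
apply: run_straight => //=; rewrite Ep addn1; set s1 := set_reg _ _ _.
have run1 := @scan_classP n G es es_G s1 a p.+1 st colE ok deg0 tend0 erefl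
  (leq_trans lt_pk k_le).
rewrite -/W in run1.
apply: (@run_seq _ _ _ (100 * (1 + W)) (1900 * W + 1880 + 300 * X)); last by lia.
apply: (run_weaken run1) => // s2 F2 [L inv2 [countL sizeL]]; have [Fr2 Fa2] := F2.
rewrite -/W in sizeL.
have st2 : static es s2 := static_frame (c := scan_class) isT isT F2 st.
have tok2 : touched_ok a d s2.
  by apply: scan_inv_touched inv2 => // v; rewrite (Fa2 col_arr isT); apply: colE.
pose D := \sum_v d v.
have D_le : D <= W.
  apply: leq_trans sizeL; rewrite -sum_count_mem /D.
  by rewrite (eq_bigr _ (fun v _ => countL v)).
have end2 c : c <= n -> arr s2 end_arr c = c * n + class_size a c.
  move=> c_le; rewrite (Fa2 end_arr isT) /=; have [_ ->] := ok; rewrite //.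
  by congr (_ + _); apply: eq_card => v; rewrite !inE colE.
have run2 := selectP st2 tok2 d_le' a_onto k_le end2; rewrite -/D -/S in run2.
apply: (@run_seq _ _ _ (200 * (1 + D)) (1700 * W + 1670 + 300 * X)); last by lia.
apply: (run_weaken run2) => // s3 F3 perm3; have [Fr3 Fa3] := F3.
have st3 : static es s3 := static_frame (c := select) isT isT F3 st2.
set L3 := seg _ _ _ in perm3.
have L3_uniq : uniq L3 by rewrite (perm_uniq perm3).
have L3_le : {in L3, forall c, c <= n}.
  by move=> c; rewrite (perm_mem perm3) => /S_le /andP[_ H]; apply: leq_trans k_le.
have run3 := sort_classesP st3 erefl L3_uniq L3_le; rewrite (perm_size perm3) in run3.
apply: (@run_seq _ _ _ (300 * X) (1700 * W + 1660)); last by lia.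
apply: (run_weaken run3) => [|s4 F4]; first by rewrite -/lg -mulnA.
(* The selected classes come in an order that depends on the arc list; sorting makes them the
   increasing list of [split_round]. *)
have -> : sort leq L3 = S.
  apply: (sorted_eq leq_trans anti_leq).
  - exact: sort_sorted leq_total _.
  - by apply: sorted_filter; [apply: leq_trans | apply: iota_sorted].
  - by rewrite perm_sort.
move=> seg4; have [Fr4 Fa4] := F4.
have st4 : static es s4 := static_frame (c := sort_classes) isT isT F4 st3.
have tok4 : touched_ok a d s4.
  rewrite /touched_ok (Fa4 deg_arr isT) (Fa4 tend_arr isT) (Fa4 telt_arr isT)
    (Fa4 touched_arr isT) (Fr4 ntouched_reg isT).
  by rewrite (Fa3 deg_arr isT) (Fa3 tend_arr isT) (Fa3 telt_arr isT)
    (Fa3 touched_arr isT) (Fr3 ntouched_reg isT).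
have col4 : arr s4 col_arr = arr s col_arr.
  by rewrite (Fa4 col_arr isT) (Fa3 col_arr isT) (Fa2 col_arr isT).
have cnt4 : arr s4 cnt_arr = arr s cnt_arr.
  by rewrite (Fa4 cnt_arr isT) (Fa3 cnt_arr isT) (Fa2 cnt_arr isT).
have ok4 : classes n s4.
  rewrite /classes col4 (Fa4 end_arr isT) (Fa4 elt_arr isT) (Fa4 pos_arr isT).
  rewrite (Fa3 end_arr isT) (Fa3 elt_arr isT) (Fa3 pos_arr isT).
  by rewrite (Fa2 end_arr isT) (Fa2 elt_arr isT) (Fa2 pos_arr isT).
have k4 : reg s4 k_reg = k by rewrite (Fr4 k_reg isT) (Fr3 k_reg isT) (Fr2 k_reg isT).
have p4 : reg s4 p_reg = p.+1 by rewrite (Fr4 p_reg isT) (Fr3 p_reg isT) (Fr2 p_reg isT).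
have run4 : run split_all s4 (1300 * D + 20) (fun s' =>
    [/\ classes n s', forall v, arr s' col_arr v = a' v, reg s' k_reg = k' &
        forall i, i <= n -> arr s' cnt_arr i = 0]).
  by apply: (@split_allP n es s4 a d k S); rewrite ?cnt4 ?col4.
apply: (@run_seq _ _ _ (1300 * D + 20) (400 * W + 1630)); last by lia.
apply: (run_weaken run4) => // s5 F5 [ok5 col5 k5 cnt5]; have [Fr5 Fa5] := F5.
have st5 : static es s5 := static_frame (c := split_all) isT isT F5 st4.
have tok5 : touched_ok a d s5.
  by rewrite /touched_ok (Fa5 deg_arr isT) (Fa5 tend_arr isT) (Fa5 telt_arr isT)
    (Fa5 touched_arr isT) (Fr5 ntouched_reg isT).
have run5 := resetP st5 tok5 a_le; rewrite -/D in run5.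
apply: (run_weaken run5) => [|s6 F6 [deg6 tend6]]; first by lia.
have [Fr6 Fa6] := F6; split.
- exact: (static_frame (c := reset) _ _ F6).
- by rewrite /classes (Fa6 col_arr isT) (Fa6 end_arr isT) (Fa6 elt_arr isT) (Fa6 pos_arr isT).
- by move=> v; rewrite (Fa6 col_arr isT) col5.
- by rewrite (Fr6 k_reg isT) k5 (Fr6 p_reg isT) (Fr5 p_reg isT) p4.
- by split=> // i i_le; rewrite (Fa6 cnt_arr isT) cnt5.
Qed.

End Refine.

(** * Refinement and choice *)

Section Loop.

Variables (n : nat) (G : rel 'I_n) (es : seq ('I_n * 'I_n)).
Hypothesis es_G : edge_list G es.
Implicit Types (s : memory) (a : 'I_n -> nat) (v u : 'I_n) (c k p : nat).

Let lg : nat := (trunc_log 2 n).+2.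

Let cardI : #|'I_n| = n. Proof. by rewrite card_ord. Qed.

(** The potential pays for scans, [n - k] for sorting the classes that yield new colours, and
    [n - p] for the fixed cost of a round. The factor 3000 exceeds the 2000 per unit of weight, and
    since [lg] is at least 2, [3000 * lg] exceeds the fixed cost [2010 + 300 * lg]. *)
Definition energy (st : ('I_n -> nat) * nat * nat) : nat :=
  let: (a, k, p) := st in
  3000 * (potential (wt es) a p + lg * ((n - k) + (n - p))).

#[global] Arguments energy : simpl never.

Lemma onto_le_n a k : onto a k -> k <= n.
Proof. by move/onto_card; rewrite cardI. Qed.

Lemma energy_next a k p (a' := (split_round G a k p.+1).1)
    (k' := (split_round G a k p.+1).2) :
  onto a k -> p < k ->
  energy (a', k', p.+1) + 10 +
    (2000 * (\sum_(v | a v == p.+1) wt es v).+1 + 300 * (k' - k).+1 * lg) <=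
  energy (a, k, p).
Proof.
move=> a_onto lt_pk; have [onto' size' _ _ _] := split_round_spec G p.+1 a_onto.
have := @potential_split_round _ G (wt es) a k p a' k' a_onto lt_pk.
rewrite /a' /k'; case E: (split_round G a k p.+1) => [a1 k1] in onto' size' * => /(_ erefl) /=.
rewrite /= in onto' size'; set W := \sum_(v | _) _ => le_pot.
have k1_le := onto_le_n onto'.
have le_k : k <= k1 by apply: leq_trans size'; rewrite leq_addr.
rewrite /energy /=; have -> : n - k = (n - k1) + (k1 - k) by lia.
have -> : n - p = (n - p.+1).+1 by lia.
have : 2 <= lg by [].
have -> : 300 * (k1 - k).+1 * lg = 300 * lg + 300 * (lg * (k1 - k)) by nia.
have -> : lg * (n - k1 + (k1 - k) + (n - p.+1).+1) =
  lg * (n - k1 + (n - p.+1)) + lg * (k1 - k) + lg by nia.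
by set A := lg * (_ + _); set C := lg * (k1 - k); lia.
Qed.

(** Guarantees that the truncated differences of energies used as time bounds are true
    differences. *)
Lemma energy_final a0 st : sound_state G a0 st -> energy (final_state G st) <= energy st.
Proof.
rewrite /final_state; elim: #|'I_n| st => //= j IH st Ist.
rewrite -iterS iterSr; apply: leq_trans (IH _ (sound_state_next Ist)) _.
case: st Ist => [[a k] p] [a_onto le_pk _ _ _] /=; case: ltnP => // lt_pk.
have := energy_next a_onto lt_pk.
case: (split_round _ _ _ _) => a' k' H; apply: leq_trans H.
by rewrite -addnA leq_addr.
Qed.

(** Time is a difference of energies, so that the bounds of successive refinements telescope. *)
Lemma refine_comP s a0 a k p (fin := final_state G (a, k, p)) :
  ready es a k p s -> sound_state G a0 (a, k, p) ->
  run refine_com s (energy (a, k, p) + 10 - energy fin)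
    (ready es fin.1.1 fin.1.2 fin.1.2).
Proof.
move=> rs Ia; have [_ fin_k] := final_state_done Ia; rewrite -/fin in fin_k.
apply: (@run_while _ _ _ _ (fun T s' => exists a1 k1 p1,
  [/\ ready es a1 k1 p1 s', sound_state G a0 (a1, k1, p1),
      final_state G (a1, k1, p1) = fin & energy (a1, k1, p1) + 10 - energy fin <= T])).
- by exists a, k, p.
- move=> T s' _ [a1 [k1 [p1 [rs1 I1 E1 leT]]]]; have [_ _ _ [Ek Ep] _] := rs1.
  rewrite /= Ek Ep -leqNgt => le_kp.
  have [_ le_pk _ _ _] := I1; have Epk : p1 = k1 by apply/eqP; rewrite eqn_leq le_pk.
  rewrite Epk in rs1 E1 leT *; rewrite final_state_id in E1.
  rewrite -E1 addKn in leT *; split=> //.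
  by apply: leq_trans leT.
- move=> T s' _ [a1 [k1 [p1 [rs1 I1 E1 leT]]]]; have [_ _ _ [Ek Ep] _] := rs1.
  rewrite /= Ek Ep => lt_pk; have [onto1 _ _ _ _] := I1.
  have run1 := round_comP es_G rs1 onto1 lt_pk.
  have := energy_next onto1 lt_pk.
  set R := 2000 * _ + _ in run1 * => leR; exists R.
  apply: (run_weaken run1) => // s2 _ rs2.
  have I2 := sound_state_next I1; have E2 := final_state_next I1.
  have le2 := energy_final I2; rewrite E2 E1 /= lt_pk in le2.
  rewrite E1 /= lt_pk in E2; rewrite /= lt_pk in I2.
  move: rs2 E2 I2 leR le2; rewrite /R.
  case: (split_round G a1 k1 p1.+1) => a2 k2 /= rs2 E2 I2 leR le2.
  set e1 := energy (a1, k1, p1) in leT leR; set e2 := energy (a2, k2, p1.+1) in leR le2.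
  move: leR; set R' := 2000 * _ + _ => leR.
  exists (T - R' - 4); last by rewrite /=; lia.
  by exists a2, k2, p1.+1; split=> //; rewrite -/e2; lia.
Qed.

Definition singletons_below a (i : nat) : Prop :=
  forall v, v < i -> class_size a (a v) = 1.

Lemma class_size_mono a a' v :
  (forall u, a' u = a' v -> a u = a v) -> class_size a' (a' v) <= class_size a (a v).
Proof.
by move=> H; apply: subset_leq_card; apply/subsetP=> u; rewrite !inE => /eqP/H->.
Qed.

Lemma choose_comP s a k i :
  ready es a k k s -> onto a k -> k < n -> reg s cursor_reg = i -> singletons_below a i ->
  exists v : 'I_n, let a1 w := if w == v then k.+1 else a w in
  [/\ i <= v, exists2 u, u != v & a u = a v, singletons_below a1 v &
      run choose_com s (20 * (v - i) + 200) (fun s' =>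
        [/\ ready es a1 k.+1 k s', reg s' cursor_reg = v &
            forall j, arr s' col_arr j = if j == v then k.+1 else arr s col_arr j])].
Proof.
move=> [st ok colE [Ek Ep] [deg0 tend0 cnt0]] a_onto lt_kn Ei single.
have a_le v : 1 <= a v <= k := onto_le v a_onto.
have ex_v : exists j, [exists v : 'I_n, (val v == j) && (1 < class_size a (a v))].
  suff /existsP[v Hv] : [exists v : 'I_n, 1 < class_size a (a v)].
    by exists (val v); apply/existsP; exists v; rewrite eqxx.
  apply/contraT; rewrite negb_exists => /forallP all1.
  have a_inj : injective (fun v => inord (a v) : 'I_k.+1).
    move=> u v /(congr1 val); rewrite /= !inordK ?ltnS; last 2 first.
    - by have /andP[] := a_le v.
    - by have /andP[] := a_le u.
    move=> E; apply/eqP; apply: contraT => ne.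
    have : #|[set u; v]| <= class_size a (a v).
      apply: subset_leq_card; apply/subsetP=> w; rewrite !inE => /orP[]/eqP-> //.
      by rewrite E.
    by rewrite cards2 ne => H; have := all1 v; rewrite H.
  (* Pigeonhole: the colour 0 does not occur, so an injective colouring would use at most [k < n]
     values. *)
  have : #|'I_n| <= #|[set~ (ord0 : 'I_k.+1)]|.
    rewrite -(card_codom a_inj); apply: subset_leq_card; apply/subsetP=> _ /codomP[v ->].
    rewrite !inE -val_eqE /= inordK ?ltnS; first by have := a_le v; lia.
    by have /andP[] := a_le v.
  by rewrite cardI cardsC1 card_ord /=; lia.
(* The cursor stops at the least vertex whose colour is shared. *)
case: (ex_minnP ex_v) => v0 /existsP[v /andP[/eqP Ev big_v]] j_min.
rewrite -{v0}Ev in j_min.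
have lt_single u : u < v -> class_size a (a u) = 1.
  move=> lt_uv; apply/eqP; rewrite eqn_leq class_size_gt0 andbT leqNgt; apply/negP => big_u.
  have : v <= u by apply: j_min; apply/existsP; exists u; rewrite eqxx.
  by rewrite leqNgt lt_uv.
have le_iv : i <= v.
  by rewrite leqNgt; apply/negP => /single E; rewrite E in big_v.
have [u ne_u Eu] : exists2 u, u != v & a u = a v.
  have : 0 < #|[set u | a u == a v] :\ v|.
    by have := cardsD1 v [set u | a u == a v]; rewrite inE eqxx; move: big_v; rewrite /class_size; lia.
  by case/card_gt0P=> u; rewrite !inE => /andP[ne /eqP Eu]; exists u.
exists v => a1; split=> //; first by exists u.
  move=> w lt_w; have ne_w : w != v by rewrite -val_eqE neq_ltn lt_w.
  apply/eqP; rewrite eqn_leq class_size_gt0 andbT -(lt_single w lt_w).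
  apply: class_size_mono => x; rewrite /a1 (negbTE ne_w).
  by have := a_le w; case: (x == v) => //; lia.
have testE s1 w : frame choose_com s s1 -> arr s1 col_arr = arr s col_arr -> 
    arr s1 end_arr = arr s end_arr -> reg s1 cursor_reg = val w ->
    holds (Lt (Minus (Cell end_arr (Cell col_arr (Reg cursor_reg)))
                   (Cell base_arr (Cell col_arr (Reg cursor_reg)))) (Const 2)) s1 =
    (class_size a (a w) < 2).
  move=> [_ Fa] E2 E6 Ew; rewrite /= Ew E2 E6 (Fa base_arr isT) colE.
  have [_ _ baseE _] := st; have [_ endE] := ok.
  have aw_le : a w <= n by have := a_le w; lia.
  rewrite baseE // endE // addKn; congr (_ < _).
  by apply: eq_card => x; rewrite !inE colE.
pose loop := While (Lt (Minus (Cell end_arr (Cell col_arr (Reg cursor_reg)))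
      (Cell base_arr (Cell col_arr (Reg cursor_reg)))) (Const 2)) (incr cursor_reg).
have run1 : run loop
    s (20 * (v - i) + 20) (fun s' => reg s' cursor_reg = v).
  apply: (@run_while _ _ _ _ (fun T s' => exists j,
    [/\ i <= j <= v, reg s' cursor_reg = j & 20 * (v - j) + 20 <= T])).
  - by exists i; rewrite leqnn le_iv.
  - move=> T s1 F1 [j [/andP[le_ij le_jv] Ej leT]].
    have F1' : frame choose_com s s1.
      by apply: frame_sub F1 => z //=; rewrite inE => /eqP->.
    have [Fr1 Fa1] := F1; have lt_jn : j < n := leq_ltn_trans le_jv (ltn_ord v).
    rewrite (@testE s1 (Ordinal lt_jn)) ?Fa1 // => big_j.
    split; first by rewrite /=; lia.
    rewrite Ej; apply/eqP; rewrite eqn_leq le_jv /= leqNgt; apply/negP => lt_jv.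
    by rewrite (lt_single (Ordinal lt_jn)) in big_j.
  - move=> T s1 F1 [j [/andP[le_ij le_jv] Ej leT]].
    have F1' : frame choose_com s s1.
      by apply: frame_sub F1 => z //=; rewrite inE => /eqP->.
    have [Fr1 Fa1] := F1; have lt_jn : j < n := leq_ltn_trans le_jv (ltn_ord v).
    rewrite (@testE s1 (Ordinal lt_jn)) ?Fa1 // => small_j.
    have lt_jv : j < v.
      rewrite ltn_neqAle le_jv andbT; apply/eqP => E.
      have Ev : Ordinal lt_jn = v by apply: val_inj.
      by move: big_v; rewrite -Ev; lia.
    exists 4; apply: run_straight => //=; rewrite Ej addn1.
    exists (20 * (v - j.+1) + 20); last by lia.
    by exists j.+1; rewrite lt_jv (leq_trans le_ij).
apply: (@run_seq _ _ _ (20 * (v - i) + 20) 170); last by lia.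
apply: (run_weaken run1) => // s2 F2 cur2; have [Fr2 Fa2] := F2.
apply: (@run_seq _ _ _ 5 160) => //; apply: run_straight => //=.
rewrite (Fr2 k_reg isT) Ek addn1.
apply: (@run_seq _ _ _ 5 150) => //; apply: run_straight => //=; rewrite cur2.
apply: (@run_seq _ _ _ 5 140) => //; apply: run_straight => //=.
rewrite (Fa2 col_arr isT).
apply: (@run_seq _ _ _ 5 130) => //; apply: run_straight => //=; set s3 := set_reg _ _ _.
have ok3 : classes n s3.
  by rewrite /classes /= (Fa2 col_arr isT) (Fa2 end_arr isT) (Fa2 elt_arr isT) (Fa2 pos_arr isT).
have run3 := @moveP n s3 v k.+1 ok3 erefl.
rewrite /= (Fa2 col_arr isT) colE in run3.
have ne_k : k.+1 != a v by have := a_le v; lia.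
apply: (run_weaken (run3 erefl erefl lt_kn ne_k)) => // s4 F4 [ok4 col4]; have [Fr4 Fa4] := F4.
rewrite /= in col4; split.
- split=> //.
  + have st2 : static es s2 := static_frame (c := loop) isT isT F2 st.
    have st3 : static es s3 by exact: st2.
    exact: (static_frame (c := move) _ _ F4).
  + by move=> w; rewrite col4 colE.
  + rewrite (Fr4 k_reg isT) (Fr4 p_reg isT) /=; split=> //.
    by rewrite (Fr2 p_reg isT).
  + rewrite (Fa4 deg_arr isT) (Fa4 tend_arr isT) (Fa4 cnt_arr isT) /=.
    by rewrite (Fa2 deg_arr isT) (Fa2 tend_arr isT) (Fa2 cnt_arr isT).
- by rewrite (Fr4 cursor_reg isT) /= cur2.
- by move=> j'; rewrite col4.
Qed.

End Loop.

(** * Setup *)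

Section Setup.

Variables (n : nat) (es : seq ('I_n * 'I_n)).
Implicit Types (s : memory) (v w x : 'I_n) (c : nat).

(** Strengthens [in_list]: such a list uses only cells below [i], so the insertion of arc [i] does
    not disturb it. *)
Fixpoint in_list_below (i : nat) (src next : nat -> nat) (e : nat) (L : seq 'I_n) : Prop :=
  if L is w :: L' then
    [/\ 0 < e <= i, src (e - 1) = w & in_list_below i src next (next (e - 1)) L']
  else e = 0.

Lemma in_list_below_list i src next e L :
  in_list_below i src next e L -> in_list src next e L.
Proof. by elim: L e => //= w L IH e [/andP[e_gt0 _] E /IH]. Qed.

Lemma in_list_below_next i src next next' e L :
  (forall j, j < i -> next' j = next j) ->
  in_list_below i src next e L -> in_list_below i.+1 src next' e L.
Proof.
move=> E; elim: L e => //= w L IH e [e_le Ew /IH]; rewrite E; last by lia.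
by split=> //; lia.
Qed.

Definition in_nbrs_of (l : seq ('I_n * 'I_n)) x : seq 'I_n :=
  rev [seq e.1 | e <- l & e.2 == x].

Lemma build_listsP s :
  reg s m_reg = size es -> reg s e_reg = 0 ->
  (forall j, arr s src_arr j = nth 0 [seq val e.1 | e <- es] j) ->
  (forall j, arr s tgt_arr j = nth 0 [seq val e.2 | e <- es] j) ->
  (forall x, arr s head_arr x = 0) ->
  run build_lists s (40 * size es + 10) (fun s' => forall x,
    in_list (arr s src_arr) (arr s' next_arr) (arr s' head_arr x) (in_nbrs es x)).
Proof.
move=> Em Ee srcE tgtE head0.
pose inv i s' := forall x,
  in_list_below i (arr s src_arr) (arr s' next_arr) (arr s' head_arr x)
    (in_nbrs_of (take i es) x).
have run1 : run build_lists s (40 * size es + 10)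
    (fun s' => reg s' e_reg = size es /\ inv (size es) s').
  apply: (@run_for _ _ _ _ 0 _ (fun=> 20) _ inv) => //.
  - by move=> s2 [Fr Fa] /=; rewrite (Fr m_reg isT).
  - by move=> x; rewrite take0 /= head0.
  - move=> i s2 /andP[_ lt_i] Ei [Fr Fa] inv2.
    have [d _] : exists d : 'I_n * 'I_n, True by case: (es) lt_i => [|d]; [|exists d].
    apply: run_straight => //= x; rewrite /= Ei (Fa tgt_arr isT) tgtE (nth_map d) //= addn1.
    set e := nth d es i.
    have -> : in_nbrs_of (take i.+1 es) x =
        if e.2 == x then e.1 :: in_nbrs_of (take i es) x else in_nbrs_of (take i es) x.
      rewrite /in_nbrs_of (take_nth d) // filter_rcons -/e; case: eqP => // _.
      by rewrite map_rcons rev_rcons.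
    have old : forall x', in_list_below i.+1 (arr s src_arr)
        (fun j => if j == i then arr s2 head_arr (nat_of_ord e.2) else arr s2 next_arr j)
        (arr s2 head_arr x') (in_nbrs_of (take i es) x').
      move=> x'; apply: in_list_below_next (inv2 x') => j lt_j.
      by case: eqP => //; lia.
    have [<- | ne] := eqVneq e.2 x.
      rewrite /= eqxx subn1 /= eqxx ltnSn; split=> //.
      by rewrite srcE (nth_map d).
    have -> : (x == e.2 :> nat) = false by apply/negbTE; rewrite eq_sym.
    exact: old.
  - by rewrite sum_nat_const_nat /=; lia.
apply: (run_weaken run1) => // s' _ [_ inv'] x.
by have := in_list_below_list (inv' x); rewrite take_size.
Qed.

Lemma build_tablesP s :
  reg s n_reg = n -> reg s i_reg = 0 ->
  [/\ arr s base_arr 0 = 0, arr s end_arr 0 = 0, arr s tend_arr 0 = 0,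
      arr s half_arr 0 = 0 & arr s half_arr 1 = 0] ->
  run build_tables s (60 * n + 10) (fun s' =>
    (forall c, c <= n -> [/\ arr s' base_arr c = c * n, arr s' end_arr c = c * n &
                             arr s' tend_arr c = c * n]) /\
    forall i, i <= n -> arr s' half_arr i = i./2).
Proof.
move=> En Ei [base0 end0 tend0 half0 half1].
pose inv i s' := (forall c, c <= i -> [/\ arr s' base_arr c = c * n,
    arr s' end_arr c = c * n & arr s' tend_arr c = c * n]) /\
  forall j, j <= i.+1 -> arr s' half_arr j = j./2.
have run1 : run build_tables s (60 * n + 10) (fun s' => reg s' i_reg = n /\ inv n s').
  apply: (@run_for _ _ _ _ 0 _ (fun=> 40) _ inv) => //.
  - by move=> s2 [Fr Fa] /=; rewrite (Fr n_reg isT).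
  - split=> [c | j]; first by rewrite leqn0 => /eqP->; rewrite mul0n.
    by case: j => [|[|]].
  - move=> i s2 /andP[_ lt_i] Ei2 [Fr Fa] [tab half]; apply: run_straight => //=.
    rewrite Ei2 (Fr n_reg isT) En !addn1 eqxx; split=> [c | j] /=.
      rewrite leq_eqVlt ltnS; case: eqP => [-> _ | _ /tab //].
      by have [-> _ _] := tab i (leqnn i); rewrite mulSn addnC.
    rewrite leq_eqVlt ltnS; case: eqP => [-> _ | _ /half //].
    by rewrite half //= ltnW.
  - by rewrite sum_nat_const_nat /=; lia.
apply: (run_weaken run1) => // s' _ [_ [tab half]]; split=> // i i_le.
by apply: half; rewrite ltnW.
Qed.

Lemma build_classP s :
  reg s n_reg = n -> reg s q_reg = 0 -> (forall c, c <= n -> arr s end_arr c = c * n) ->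
  run build_class s (60 * n + 10) (fun s' =>
    classes n s' /\ forall v, arr s' col_arr v = 1).
Proof.
move=> En Eq end0.
pose inv j s' := [/\ forall u, u < j ->
    [/\ arr s' col_arr u = 1, arr s' pos_arr u = n + u & arr s' elt_arr (n + u) = u],
  0 < n -> arr s' end_arr 1 = n + j &
  forall c, c <= n -> c != 1 -> arr s' end_arr c = c * n].
have run1 : run build_class s (60 * n + 10) (fun s' => reg s' q_reg = n /\ inv n s').
  apply: (@run_for _ _ _ _ 0 _ (fun=> 40) _ inv) => //.
  - by move=> s2 [Fr Fa] /=; rewrite (Fr n_reg isT).
  - split=> // [n_gt0 | c c_le _]; last exact: end0.
    by rewrite end0 // mul1n addn0.
  - move=> j s2 /andP[_ lt_j] Ej [Fr Fa] [ok1 end1 end2].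
    have n_gt0 : 0 < n by apply: leq_ltn_trans lt_j.
    apply: run_straight => //=; rewrite Ej end1 // addn1; split=> //= [u | _ | c c_le ne].
    + rewrite ltnS leq_eqVlt; case: eqP => [-> _ | ne /= lt_u]; first by rewrite eqxx.
      have [-> -> ->] := ok1 u lt_u; split=> //.
      by case: eqP => //; lia.
    + by rewrite addnS.
    + by rewrite (negbTE ne) end2.
  - by rewrite sum_nat_const_nat /=; lia.
apply: (run_weaken run1) => // s' _ [_ [ok1 end1 end2]]; split; last first.
  by move=> v; have [] := ok1 v (ltn_ord v).
split=> [v | c c_le].
  have n_gt0 : 0 < n := leq_ltn_trans (leq0n v) (ltn_ord v).
  have [-> -> ->] := ok1 v (ltn_ord v); split=> //.
  by rewrite end1 // mul1n leq_addr ltn_add2l ltn_ord.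
have [Ec | ne] := eqVneq c 1.
  rewrite Ec in c_le *; rewrite end1 // mul1n; congr (_ + _).
  rewrite -[LHS]card_ord -cardsT; apply: eq_card => v; rewrite !inE.
  by have [-> _ _] := ok1 v (ltn_ord v).
rewrite end2 // /class_size (_ : [set v | _] = set0) ?cards0 ?addn0 //.
apply/setP=> v; rewrite !inE; have [-> _ _] := ok1 v (ltn_ord v).
by rewrite eq_sym (negbTE ne).
Qed.

Lemma setup_comP :
  run setup_com (input_mem es) (200 * (n + size es).+1) (fun s' =>
    ready es (fun=> 1) (0 < n) 0 s' /\ reg s' cursor_reg = 0).
Proof.
set s := input_mem es; set m := size es.
have run1 : run build_lists s (40 * m + 10) (fun s' => forall x,
    in_list (arr s src_arr) (arr s' next_arr) (arr s' head_arr x) (in_nbrs es x)).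
  exact: build_listsP.
apply: (@run_seq _ _ _ (40 * m + 10) (160 * m + 200 * n + 180)); last by lia.
apply: (run_weaken run1) => // s1 F1 lists1; have [Fr1 Fa1] := F1.
have run2 := @build_tablesP s1; rewrite (Fr1 n_reg isT) (Fr1 i_reg isT) in run2.
rewrite (Fa1 base_arr isT) (Fa1 end_arr isT) (Fa1 tend_arr isT) (Fa1 half_arr isT) in run2.
apply: (@run_seq _ _ _ (60 * n + 10) (160 * m + 140 * n + 160)); last by lia.
apply: (run_weaken (run2 _ _ _)) => // s2 F2 [tab2 half2]; have [Fr2 Fa2] := F2.
have run3 := @build_classP s2.
rewrite (Fr2 n_reg isT) (Fr2 q_reg isT) (Fr1 n_reg isT) (Fr1 q_reg isT) in run3.
apply: (@run_seq _ _ _ (60 * n + 10) (160 * m + 80 * n + 140)); last by lia.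
apply: (run_weaken (run3 _ _ _)) => // [c c_le | s3 F3 [ok3 col3]].
  by have [] := tab2 c c_le.
have [Fr3 Fa3] := F3.
have n3 : reg s3 n_reg = n by rewrite (Fr3 n_reg isT) (Fr2 n_reg isT) (Fr1 n_reg isT).
have st3 : static es s3.
  split=> // [x | c c_le | i i_le].
  - rewrite (Fa3 src_arr isT) (Fa3 next_arr isT) (Fa3 head_arr isT).
    rewrite (Fa2 src_arr isT) (Fa2 next_arr isT) (Fa2 head_arr isT).
    by rewrite (Fa1 src_arr isT); apply: lists1.
  - by rewrite (Fa3 base_arr isT); have [] := tab2 c c_le.
  - by rewrite (Fa3 half_arr isT) half2.
have k3 : reg s3 k_reg = 0 by rewrite (Fr3 k_reg isT) (Fr2 k_reg isT) (Fr1 k_reg isT).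
have p3 : reg s3 p_reg = 0 by rewrite (Fr3 p_reg isT) (Fr2 p_reg isT) (Fr1 p_reg isT).
have cur3 : reg s3 cursor_reg = 0.
  by rewrite (Fr3 cursor_reg isT) (Fr2 cursor_reg isT) (Fr1 cursor_reg isT).
have clean3 : [/\ forall v, arr s3 deg_arr v = 0,
    forall c, c <= n -> arr s3 tend_arr c = c * n &
    forall i, i <= n -> arr s3 cnt_arr i = 0].
  split=> [v | c c_le | i _].
  - by rewrite (Fa3 deg_arr isT) (Fa2 deg_arr isT) (Fa1 deg_arr isT).
  - by rewrite (Fa3 tend_arr isT); have [] := tab2 c c_le.
  - by rewrite (Fa3 cnt_arr isT) (Fa2 cnt_arr isT) (Fa1 cnt_arr isT).
apply: run_straight => /=; first by lia.
by rewrite n3; case: ltnP => _.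
Qed.

End Setup.

(** * The whole procedure *)

Section Procedure.

Variables (n : nat) (G : rel 'I_n) (es : seq ('I_n * 'I_n)).
Hypothesis es_G : edge_list G es.
Implicit Types (s : memory) (a : 'I_n -> nat) (v u : 'I_n) (k : nat).

Lemma eq_cells (b b' : 'I_n -> int) : b =1 b' -> cells b = cells b'.
Proof.
move=> E; apply: eq_imset => v; apply/setP=> x; by rewrite !inE !E.
Qed.

(** Canonicity along the identity takes the place of functional extensionality. *)
Lemma refinement_eq (b b' : 'I_n -> int) : b =1 b' -> refinement G b =1 refinement G b'.
Proof.
move=> E; apply: (@refinement_canonical _ _ G G b b' id) => //.
by split=> //; exists id.
Qed.

Lemma ready_colour a k p s : ready es a k p s -> colour_of n s =1 Posz \o a.
Proof. by move=> [_ _ E _ _] v; rewrite /colour_of /= E. Qed.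

Lemma ready_refine_step a a' k k' s s' :
  ready es a k.+1 k s -> ready es a' k' k' s' -> sound_state G a (a, k.+1, k) ->
  final_state G (a, k.+1, k) = (a', k', k') ->
  refine_step refinement G (colour_of n s) (colour_of n s') (k_of s').
Proof.
move=> rs rs' Ia E; have [Ia' _] := final_state_done Ia; rewrite E in Ia'.
have [onto' _ _ _ _] := Ia'; have [a_onto _ _ _ _] := Ia.
have Es := ready_colour rs; have Es' := ready_colour rs'.
have [_ _ _ [Ek' _] _] := rs'; split.
- by move=> v; rewrite Es' (refinement_eq Es) (refinementE a_onto E).
- rewrite /k_of Ek' => c; rewrite -(onto_surjective onto' c).
  by split=> -[v <-]; exists v; rewrite Es'.
- by rewrite (eq_cells Es) (eq_cells Es'); apply: cells_coarsest Ia'.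
Qed.

(** A bound for the rest of the main loop; the middle term pays for the way the cursor still has to
    go. *)
Definition run_time a k cursor : nat :=
  energy es (a, k, k) + 3000 * (n - cursor) + 100.

(** The potential does not grow and [n - k] falls by one, which releases at least 3000 units for the
    choice. *)
Lemma energy_individualize a k v a1 :
  onto a k -> k < n -> (exists2 u, u != v & a u = a v) ->
  a1 =1 (fun w => if w == v then k.+1 else a w) ->
  energy es (a1, k.+1, k) + 3000 <= energy es (a, k, k).
Proof.
move=> a_onto lt_kn twin E1; have := potential_individualize (wt es) a_onto twin E1.
rewrite /energy; have -> : n - k = (n - k.+1).+1 by lia.
have : 1 <= (trunc_log 2 n).+2 by [].
by set lg := (trunc_log 2 n).+2; nia.
Qed.

(** The word bound [W] is fixed in advance. The bound [M] on the values grows with the time spent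
    while [run_time] falls at least as fast, so the last hypothesis is kept along the loop. *)
Lemma loopP W M a k s cursor :
  bounded n.+1 M s -> ready es a k k s -> onto a k -> stable_colouring G a ->
  reg s cursor_reg = cursor -> singletons_below a cursor ->
  M + n.+1 * run_time a k cursor < W ->
  exists t s', loop_run W refinement G choose_com refine_com s t s' /\
    t <= run_time a k cursor.
Proof.
have [N leN] := ubnP (run_time a k cursor).
elim: N M a k s cursor leN => // N IH M a k s cursor leN Ms rs a_onto a_stable Ecur single leW.
have [[En _ _ _] _ colE [Ek _] _] := rs.
have [le_nk | lt_kn] := leqP n k.
  exists (test_cost loop_test).+1, s; split; last by rewrite /run_time /=; lia.
  by apply: LoopExit; rewrite //= Ek En -leqNgt.
have [v [le_cv twin single1 run1]] := choose_comP rs a_onto lt_kn Ecur single.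
set a1 := fun w => _ in single1 run1.
have [W1 [t1 [s1 [ex1 le1 [rs1 cur1 col1]]]]] := run1.
have I1 : sound_state G a1 (a1, k.+1, k) by apply: sound_state_individualize twin _.
have [W2 [t2 [s2 [ex2 le2 rs2]]]] := refine_comP es_G rs1 I1.
have [I2 fin2] := final_state_done I1; have le_fin := energy_final es I1.
have leE := energy_individualize a_onto lt_kn twin (frefl a1).
move: I2 fin2 le_fin le2 rs2; case E2: (final_state G (a1, k.+1, k)) => [[a2 k2] p2] /=.
move=> I2 Ep2; rewrite {}Ep2 in E2 I2 * => le_fin le2 rs2.
have [onto2 _ _ ref2 _] := I2.
(* Refining cannot enlarge a class, so the vertices below the cursor keep classes of size one. *)
have single2 : singletons_below a2 v.
  move=> u lt_u; apply/eqP; rewrite eqn_leq class_size_gt0 andbT -(single1 u lt_u).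
  by apply: class_size_mono => w /ref2.
have leT : t1 + t2 + 10 + run_time a2 k2 v <= run_time a k cursor.
  by rewrite /run_time; have := ltn_ord v; lia.
have [ex1' M1] : exec W choose_com s t1 s1 /\ bounded n.+1 (M + n.+1 * t1) s1.
  by apply: exec_slow ex1 Ms _ => //; nia.
have [ex2' M2] : exec W refine_com s1 t2 s2 /\ bounded n.+1 (M + n.+1 * t1 + n.+1 * t2) s2.
  by apply: exec_slow ex2 M1 _ => //; nia.
have cur2 : reg s2 cursor_reg = v by rewrite (proj1 (exec_frame ex2) cursor_reg isT).
have [||t3 [s3 [loop3 le3]]] := IH _ _ _ _ _ _ M2 rs2 onto2 (sound_state_stable I2) cur2 single2.
- by lia.
- by nia.
exists (test_cost loop_test + (t1 + t2).+1 + t3).+1, s3; split; last by rewrite /=; lia.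
apply: LoopIter ex1' _ ex2' _ loop3 => //.
- by rewrite /= Ek En.
- have [u ne_u Eu] := twin; exists v.
    by exists u => //; rewrite /colour_of !colE Eu.
  move=> w; rewrite /colour_of col1 /k_of Ek.
  have [-> | ne] := eqVneq w v; first by rewrite eqxx.
  by have -> : (w == v :> nat) = false by apply/negbTE.
- exact: ready_refine_step rs1 rs2 I1 E2.
Qed.

Lemma initP :
  exists t0 s0 a k W,
    [/\ exec W init_com (input_mem es) t0 s0,
        ready es a k k s0 /\ reg s0 cursor_reg = 0,
        onto a k /\ stable_colouring G a,
        initial_step refinement G (colour_of n s0) (k_of s0) &
        t0 + energy es (a, k, k) <= 200 * (n + size es).+1 +
          energy es (fun=> 1, (0 < n : nat), 0) + 20].
Proof.
have cardI : #|'I_n| = n by rewrite card_ord.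
have I0 := sound_state_unit G; rewrite cardI in I0.
have [onto0 _ _ _ _] := I0.
have [fin_sound fin_k] := final_state_done I0; have le_fin := energy_final es I0.
have run0 : run init_com (input_mem es) (200 * (n + size es).+1 +
    (energy es (fun=> 1, (0 < n : nat), 0) + 10
     - energy es (final_state G (fun=> 1, (0 < n : nat), 0))) + 1)
    (fun s => ready es (final_state G (fun=> 1, (0 < n : nat), 0)).1.1
       (final_state G (fun=> 1, (0 < n : nat), 0)).1.2
       (final_state G (fun=> 1, (0 < n : nat), 0)).1.2 s /\ reg s cursor_reg = 0).
  apply: run_seq; last by rewrite addn1.
  apply: (run_weaken (setup_comP es)) => // s1 _ [rs1 cur1].
  apply: (run_weaken (refine_comP es_G rs1 I0)) => // s2 [Fr2 _] rs2; split=> //.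
  by rewrite (Fr2 cursor_reg isT).
move: fin_sound fin_k le_fin run0.
case E: (final_state G _) => [[a k] p] /= I1 Ep; rewrite {}Ep in E I1 * => le_fin.
case=> W [t0 [s0 [ex0 le0 [rs0 cur0]]]].
have [a_onto _ _ _ _] := I1.
exists t0, s0, a, k, W; split=> //.
- by split=> //; apply: sound_state_stable I1.
- have Es := ready_colour rs0; have [_ _ _ [Ek _] _] := rs0.
  (* [refinementE] starts from the predecessor of the number of colours, which is 0 for no colour as
     well as for one. *)
  have E' : final_state G (fun=> 1, (0 < n : nat), (0 < n : nat).-1) = (a, k, k).
    by rewrite -E; case: (0 < n).
  have [stab _ coarse] := cells_coarsest I1; split.
  + by move=> v; rewrite Es -(refinementE onto0 E').
  + rewrite /k_of Ek => c; rewrite -(onto_surjective a_onto c).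
    by split=> -[v <-]; exists v; rewrite Es.
  + rewrite (eq_cells Es); split=> // Q Q_stable; apply: coarse => // A QA.
    have [/and3P[_ _ Q0] _] := Q_stable.
    have [A0 | [v Av]] := set_0Vmem A; first by rewrite -A0 QA in Q0.
    exists [set x | (Posz \o (fun=> 1)) x == (Posz \o (fun=> 1)) v]; first exact: cell_in.
    by apply/subsetP=> x _; rewrite inE.
- by lia.
Qed.

(** * Closed bounds for the time and the word size *)

Lemma sum_wt : \sum_v wt es v = n + size es.
Proof.
rewrite /wt (eq_bigr (fun v => 1 + size (in_nbrs es v))) // big_split /=.
rewrite sum_nat_const card_ord muln1; congr (_ + _).
rewrite -[in RHS](size_map snd) -sum_count_mem; apply: eq_bigr => v _.
by rewrite size_rev size_map size_filter count_map.
Qed.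

Lemma size_edges : size es = num_edges G.
Proof.
have [es_uniq es_mem] := es_G; rewrite -(card_uniqP es_uniq).
by apply: eq_card => -[u v]; rewrite inE es_mem.
Qed.

Lemma size_edges_le : size es <= n * n.
Proof.
have [es_uniq _] := es_G; rewrite -(card_uniqP es_uniq).
by apply: leq_trans (max_card _) _; rewrite card_prod card_ord.
Qed.

Lemma input_bounded : bounded n.+1 (n + size es) (input_mem es).
Proof.
split=> /= [|r|a i]; first exact: leqnSn.
  by case: ifP => _; [rewrite leq_addr | case: ifP => _; rewrite ?leq_addl].
have le_nth (f : 'I_n * 'I_n -> 'I_n) : nth 0 [seq val (f e) | e <- es] i <= n + size es.
  have [lt_i | ge_i] := ltnP i (size es); last by rewrite nth_default ?size_map.
  have /mapP[e _ ->] : nth 0 [seq val (f e) | e <- es] i \in [seq val (f e) | e <- es].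
    by rewrite mem_nth ?size_map.
  by apply: leq_trans (leq_addr _ _); apply: ltnW (ltn_ord _).
by case: ifP => _; [apply: le_nth | case: ifP => _; [apply: le_nth|]].
Qed.

Lemma energy0_le (lg := trunc_log 2 n) :
  energy es (fun=> 1, (0 < n : nat), 0) <=
  3000 * ((n + size es) * lg.+1 + lg.+2 * (2 * n)).
Proof.
rewrite /energy leq_mul2l leq_add ?leq_mul2l //=; last by lia.
rewrite -sum_wt big_distrl /=; apply: leq_sum => v _.
rewrite leq_mul2l addn1 ltnS; apply/orP; right; apply: leq_trunc_log.
exact: class_size_le.
Qed.

End Procedure.

Definition total_time (n m : nat) : nat :=
  200 * (n + m).+1 + 3000 * ((n + m) * (trunc_log 2 n).+1 + (trunc_log 2 n).+2 * (2 * n)) +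
  3000 * n + 121.

Lemma total_time_le n m :
  1 < n -> total_time n m <= 10 * 3000 * ((n + m) * trunc_log 2 n).
Proof.
move=> n_gt1; have : 0 < trunc_log 2 n by rewrite trunc_log_gt0 /=; lia.
by rewrite /total_time; set l := trunc_log 2 n => l_gt0; nia.
Qed.

(** With [N = n.+2], the time is at most a constant below [2 ^ 15] times [N ^ 3]. As [N] is at least
    2, that constant is absorbed by [N ^ 15], and the remaining [N ^ 5] has room for the growth per
    time unit and the input values. *)
Lemma total_time_words n m :
  m <= n * n -> n + m + n.+1 * total_time n m < n.+2 ^ 20.
Proof.
move=> m_le.
have l_le : trunc_log 2 n <= n.
  case: n {m_le} => // n; apply: leq_trans (_ : trunc_log 2 (2 ^ n.+1) <= _).
    by apply: leq_trunc_log; rewrite ltnW // ltn_expl.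
  by rewrite trunc_expnK.
have [N EN] : exists N, N = n.+2 by exists n.+2.
have N_ge2 : 2 <= N by rewrite EN.
have nm : n + m <= N * N by nia.
pose C := N * (N * N).
have [J J_lt T_le] : exists2 J, J.+1 < 2 ^ 15 & total_time n m <= J * C.
  exists (12 * 1000); first by rewrite !expnS expn0; lia.
  have H1 : (n + m) * (trunc_log 2 n).+1 <= C by rewrite /C mulnC leq_mul //; lia.
  have H2 : (trunc_log 2 n).+2 * (2 * n) <= 2 * (N * N) by nia.
  have H3 : 2 * (N * N) <= C by rewrite leq_mul.
  have H4 : 8 <= C by rewrite /C; nia.
  have H5 : 2 * n <= N * N by nia.
  rewrite /total_time; move: H1 H2 H3 H4 H5 nm.
  set x := (n + m) * _; set y := _.+2 * _; set z := N * N; set t := C.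
  by lia.
rewrite -EN -[20]/(15 + 5) expnD.
have -> : N ^ 5 = N * C * N by rewrite !expnS expn0 muln1 /C -!mulnA.
have E15 : 2 ^ 15 <= N ^ 15 by rewrite leq_exp2r.
have NC : n + m <= N * C by rewrite /C; nia.
have le1 : n.+1 * total_time n m <= N * (J * C) by apply: leq_mul T_le; lia.
have C_gt0 : 0 < N * C by rewrite /C; nia.
have {}J_lt : J.+1 < N ^ 15 by apply: leq_trans E15.
move: (N ^ 15) J_lt => P J_lt; apply: leq_ltn_trans (_ : J.+1 * (N * C) < _); first by nia.
apply: leq_trans (_ : P * (N * C) <= _); first by rewrite ltn_pmul2r.
by rewrite leq_mul2l leq_pmulr ?orbT //; lia.
Qed.

Theorem theorem2 :
  exists (F : colouring_method) (init choose refine : com) (c d : nat),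
    canonical F /\
    forall (n : nat) (G : rel 'I_n) (es : seq ('I_n * 'I_n)),
      edge_list G es ->
      exists (t : nat) (s' : memory),
        procedure_run (n.+2 ^ d) F G init choose refine (input_mem es) t s' /\
        (1 < n -> t <= c * ((n + num_edges G) * trunc_log 2 n)).
Proof.
exists refinement, init_com, choose_com, refine_com, (10 * 3000), 20.
split; first exact: refinement_canonical.
move=> n G es es_G; have m_le := size_edges_le es_G; rewrite -(size_edges es_G).
have [t0 [s0 [a [k [W [ex0 [rs0 cur0] [a_onto a_stable] step0 le0]]]]]] := initP es_G.
have := energy0_le es; set E0 := energy es _ in le0 * => leE0.
(* Strict, because the sequencing of initialization and loop costs one more unit. *)
have leT : t0 + run_time es a k 0 < total_time n (size es).
  by rewrite /run_time /total_time subn0; lia.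
have := total_time_words m_le; move: (n.+2 ^ 20) => Wd words.
have [ex0' M0] : exec Wd init_com (input_mem es) t0 s0 /\
    bounded n.+1 (n + size es + n.+1 * t0) s0.
  apply: exec_slow ex0 (input_bounded es) _ => //.
  by apply: leq_ltn_trans words; rewrite leq_add2l leq_mul2l; apply/orP; right; lia.
have [||t1 [s1 [loop1 le1]]] := loopP es_G M0 rs0 a_onto a_stable cur0 _ (W := Wd).
- by [].
- apply: leq_ltn_trans words; rewrite -addnA leq_add2l -mulnDr leq_mul2l.
  by apply/orP; right; lia.
exists (t0 + t1).+1, s1; split; first by exists t0, s0, t1.
move=> n_gt1; apply: leq_trans (total_time_le _ n_gt1).
by apply: leq_trans leT; lia.
Qed.
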